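(* Consider the wall process on $\mathbb{Z}^d$ with $\mu_n=\mathbb{E}\,W_n(0)$, driven by integrable symmetric i.i.d. noise with law $F$. There exist constants $c$ and $C$ that may depend on the dimension such that (i) for $d=1$, if $F\in\mathcal{L}_1^-$, $$c\,n^{1/4}\le\mu_n\le C\,n^{1/4}\sqrt{\log n};$$ (ii) for $d=2$, if $F\in\mathcal{L}_\alpha$ for some $\alpha\ge 1$, $$c\,(\log n)^{\frac1\alpha\vee\frac12}\le\mu_n\le C\log n;$$ (iii) for $d\ge 3$, if $F\in\mathcal{L}_\alpha$ for some $1\le\alpha\ne 1+d/2$, $$c\,(\log n)^{\frac1\alpha}\le\mu_n\le C(\log n)^{\frac1\alpha\vee\frac{2}{2+d}};$$ (iv) for $d\ge 3$, if $F\in\mathcal{L}_{1+d/2}$, $$c\,(\log n)^{\frac{2}{2+d}}\le\mu_n\le C(\log n)^{\frac{2}{2+d}}(\log\log n)^{\frac{d}{2+d}}.$$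
   Context: Fix $d\ge 1$ and $p:\mathbb{Z}^d\to[0,1]$ with $\sum_j p(j)=1$, $\sum_j j\,p(j)=0$, $p(j)=0$ whenever $|j|>v$ for some finite $v$, and such that $\{j\in\mathbb{Z}^d: p(j)\ne 0\}$ generates $\mathbb{Z}^d$. Put $p(i,j)=p(j-i)$ and, for a function $f$ on $\mathbb{Z}^d$, $(\mathcal{P}f)(i)=\sum_{j\in\mathbb{Z}^d}p(i,j)f(j)$. Let $\varepsilon$ and $\varepsilon_n(i)$ ($n\in\mathbb{Z}$, $i\in\mathbb{Z}^d$) be i.i.d. integrable symmetric real random variables (symmetric: $\varepsilon$ and $-\varepsilon$ have the same law), and $\varepsilon_n=(\varepsilon_n(i))_{i\in\mathbb{Z}^d}$. With $a^+=\max(a,0)$ (applied coordinatewise), the wall process is $W_0(i)=0$ for all $i$ and $W_n=(\mathcal{P}W_{n-1}+\varepsilon_n)^+$ for $n\ge 1$. Set $\mu_n=\mathbb{E}\,W_n(0)$. Let $F$ be the law of $\varepsilon$ and $\bar F(x)=\mathbb{P}(\varepsilon>x)$. Then $F\in\mathcal{L}_\alpha^-$ if there are positive constants $c,c'$ with $\bar F(x)\le c\,e^{-c'x^\alpha}$ for all $x>0$; $F\in\mathcal{L}_\alpha^+$ if there are positive constants $c,c'$ with $\bar F(x)\ge c\,e^{-c'x^\alpha}$ for all $x>0$; and $\mathcal{L}_\alpha=\mathcal{L}_\alpha^-\cap\mathcal{L}_\alpha^+$. Notation: $a\vee b=\max(a,b)$.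
   Formalization: In (i) the noise is assumed not almost surely zero (otherwise the mean is 0 and no positive c works); the bounds are stated for n at least 2 in (i)-(iii) and n at least 3 in (iv), where the logarithmic factors are positive. *)

(* Defs.v *)
From HB Require Import structures.
From mathcomp Require Import all_boot all_order all_algebra finmap.
From mathcomp Require Import all_classical all_reals all_analysis.

Set Implicit Arguments.
Unset Strict Implicit.
Unset Printing Implicit Defensive.

Import Order.TTheory GRing.Theory Num.Theory.
Import numFieldNormedType.Exports.

Local Open Scope classical_set_scope.
Local Open Scope ring_scope.

(* The sums \sum_(j \in setT) are sums over the support of the summand, with
   value 0 when that support is infinite. The field step_bounded makes every
   such sum below a genuine finite sum. The choice of norm in that field does
   not matter, since v is existentially quantified; the sup norm is used.
   The last field says that the only additive subgroup of Z^d that contains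
   the support of p is Z^d itself. *)
Record step_distribution (R : realType) (d : nat) (p : 'rV[int]_d -> R) :
    Prop := StepDistribution {
  step_range : forall j, 0 <= p j <= 1 ;
  step_mass : \sum_(j \in [set: 'rV[int]_d]) p j = 1 ;
  step_centered : forall k : 'I_d,
    \sum_(j \in [set: 'rV[int]_d]) ((j 0 k)%:~R * p j) = 0 ;
  step_bounded : exists v : nat, forall j : 'rV[int]_d,
    (exists k : 'I_d, v%:Z < `|j 0 k|) -> p j = 0 ;
  step_generates : forall G : {pred 'rV[int]_d}, zmod_closed G ->
    (forall j, p j != 0 -> j \in G) -> forall x, x \in G
}.

Definition avg (R : realType) (d : nat) (p f : 'rV[int]_d -> R)
    (i : 'rV[int]_d) : R :=
  \sum_(j \in [set: 'rV[int]_d]) (p (j - i) * f j).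

Fixpoint wall (R : realType) (d : nat) (p : 'rV[int]_d -> R)
    (e : int -> 'rV[int]_d -> R) (n : nat) : 'rV[int]_d -> R :=
  if n is m.+1 then fun i => Num.max (avg p (wall p e m) i + e n%:Z i) 0
  else fun=> 0.

(* The wall process is nonnegative, so this expectation always makes sense as
   an element of [0, +oo]. *)
Definition wall_mean (R : realType) (d : nat) (p : 'rV[int]_d -> R)
    (dT : measure_display) (T : measurableType dT) (P : probability T R)
    (eps : int -> 'rV[int]_d -> {RV P >-> R}) (n : nat) : \bar R :=
  'E_P[fun w => wall p (fun m i => eps m i w) n 0]%E.

Definition mutually_independent (R : realType) (dT : measure_display)
    (T : measurableType dT) (P : probability T R) (I : choiceType)
    (X : I -> {RV P >-> R}) : Prop :=
  forall (J : {fset I}) (A : I -> set R), (forall i, measurable (A i)) ->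
    P (\bigcap_(i in [set` J]) (X i @^-1` A i)) =
    (\prod_(i <- J) P (X i @^-1` A i))%E.

Definition has_law (R : realType) (dT : measure_display)
    (T : measurableType dT) (P : probability T R)
    (F : probability (measurableTypeR R) R) (X : {RV P >-> R}) : Prop :=
  forall A : set R, measurable A -> distribution P X A = F A.

Definition integrable_law (R : realType)
    (F : probability (measurableTypeR R) R) : Prop :=
  F.-integrable [set: R] (fun x => x%:E).

Definition symmetric_law (R : realType)
    (F : probability (measurableTypeR R) R) : Prop :=
  forall A : set R, measurable A -> F ((fun x => - x) @^-1` A) = F A.

Definition tail (R : realType) (F : probability (measurableTypeR R) R)
    (x : R) : \bar R := F [set y | x < y].

Definition tail_class_minus (R : realType) (alpha : R)
    (F : probability (measurableTypeR R) R) : Prop :=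
  exists c c' : R, [/\ 0 < c, 0 < c' & forall x : R, 0 < x ->
    (tail F x <= (c * expR (- (c' * x `^ alpha)))%:E)%E].

Definition tail_class_plus (R : realType) (alpha : R)
    (F : probability (measurableTypeR R) R) : Prop :=
  exists c c' : R, [/\ 0 < c, 0 < c' & forall x : R, 0 < x ->
    ((c * expR (- (c' * x `^ alpha)))%:E <= tail F x)%E].

Definition tail_class (R : realType) (alpha : R)
    (F : probability (measurableTypeR R) R) : Prop :=
  tail_class_minus alpha F /\ tail_class_plus alpha F.

(* Main.v *)
Require Import Defs.
From HB Require Import structures.
From mathcomp Require Import all_boot all_order all_algebra finmap.
From mathcomp Require Import all_classical all_reals all_analysis.
From mathcomp Require Import measurable_realfun zify ring lra.
Import Order.TTheory GRing.Theory Num.Theory.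
Import numFieldNormedType.Exports.
Local Open Scope classical_set_scope.
Local Open Scope ring_scope.

(* Let H_n = P H_(n-1) + eps_n be the free process and D_n = W_n - H_n, so that
   D_n = max (P D_(n-1), - H_n). Convexity of exp gives
   E exp(l D_n) <= 1 + n sup_m E exp(- l H_m), hence
   mu_n <= C (Lambda(l) + ln n) / l, where Lambda(l), a bound on the log of
   E exp(+- l H_m) for m <= n, is a sum over k < n and over sites j of the log of the
   moment generating function of eps at l p_k(j). The estimate
   sup_j p_k(j) <= B (k+1)^(-d/2) controls it, and optimizing over l yields the upper bounds.
   For the lower bounds, W_n >= H_n^+ gives mu_n >= c (sum_(k<n) sum_j p_k(j)^2)^(1/2), and
   max (x + e, 0) >= x 1(e >= -L) + L 1(e > L) + e 1(|e| <= L), whose last term has mean 0,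
   gives mu_n >= L (1 - P(eps <= L)^n), used with L of order (ln n)^(1/alpha). *)

(** * The free and the reflected walk *)

(** The threshold [alpha = 1 + d/2] arises as follows. By Young's inequality, tails of order
    [alpha > 1] bound the log moment generating function at [s >= 1] by [C * s ^ (1 + gam)] with
    [gam = 1 / (alpha - 1)]; for [s <= 1] symmetry makes it quadratic. Since [p_k] has mass 1 and
    maximum of order [k ^ (- d/2)], time lag [k] contributes about [lam * (lam * k ^ (- d/2)) ^ gam]
    to Lambda, which is summable exactly when [gam > 2/d]. Then Lambda is of order
    [lam ^ (1 + gam)]. Otherwise, for [d >= 3], the lags up to [lam ^ (2/d)], where [lam * p_k]
    falls to 1, dominate: Lambda is of order [lam ^ (1 + 2/d)], with an extra logarithm at equality.

    The free process is accessible only through exponential moments, which are products by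
    independence. Hence the variance lower bound compares E exp(l H) with E exp(2 l H) instead of
    using a central limit theorem. The heat kernel estimates avoid Fourier analysis, so periodicity
    of the walk causes no trouble. Inequalities between expectations are arranged so that only
    nonnegative functions are integrated. *)

Section Walk.
Context {R : realType} {G : zmodType}.
Variables (S : seq G) (p : G -> R).
Hypothesis p_ge0 : forall s, 0 <= p s.
Hypothesis p_mass : \sum_(s <- S) p s = 1.

Definition step (f : G -> R) (i : G) : R := \sum_(s <- S) p s * f (i + s).

(** The adjoint of [step]: it transports densities of the walk, whereas [step] acts on functions.
    Hence [heat k] below is the law of the walk started at 0 after [k] steps. *)
Definition back (f : G -> R) (j : G) : R := \sum_(s <- S) p s * f (j - s).

Definition heat (k : nat) : G -> R := iter k back (fun j => (j == 0)%:R).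

(** A duplicate-free list containing the support of [heat k], which keeps every sum over sites
    finite. *)
Fixpoint reach (k : nat) : seq G :=
  if k is k'.+1 then undup [seq a + s | a <- reach k', s <- S] else [:: 0].

Lemma reach_uniq k : uniq (reach k).
Proof. by case: k => //= k; exact: undup_uniq. Qed.

Lemma mem_reachS k a s : a \in reach k -> s \in S -> a + s \in reach k.+1.
Proof. by move=> ak sS; rewrite /= mem_undup; apply/allpairsP; exists (a, s). Qed.

Lemma heat_ge0 k j : 0 <= heat k j.
Proof.
elim: k j => [|k IH] j; first exact: ler0n.
by apply: sumr_ge0 => s _; rewrite mulr_ge0// IH.
Qed.

Lemma heat_out k j : j \notin reach k -> heat k j = 0.
Proof.
elim: k j => [|k IH] j; first by rewrite inE /heat /= => /negPf->.
move=> jk; apply: big1_seq => s /andP[_ sS].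
rewrite [X in _ * X]IH ?mulr0//.
by apply: contra jk => jk; rewrite -(subrK s j); exact: mem_reachS.
Qed.

Lemma big_uniq_image (I J : eqType) (h : I -> J) (r1 : seq I) (r2 : seq J)
    (F : J -> R) : uniq r1 -> uniq r2 -> injective h ->
  {in r1, forall i, h i \in r2} ->
  (forall j, j \notin map h r1 -> F j = 0) ->
  \sum_(j <- r2) F j = \sum_(i <- r1) F (h i).
Proof.
move=> u1 u2 inj sub F0.
rewrite (bigID (mem (map h r1))) /= [X in _ + X]big1 ?addr0//.
rewrite -big_filter -(big_map h xpredT); apply: perm_big; apply: uniq_perm.
- exact: filter_uniq.
- by rewrite map_inj_uniq.
- move=> j; rewrite mem_filter; apply: andb_idr => /mapP[i ir ->].
  exact: sub.
Qed.

(** Taking one step and then [k] more amounts to taking [k.+1] steps. For each [s] the shift by [s]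
    embeds [reach k] into [reach k.+1], and the summand vanishes off its image. *)
Lemma step_heat k f :
  \sum_(s <- S) p s * (\sum_(j <- reach k) heat k j * f (s + j)) =
  \sum_(j <- reach k.+1) heat k.+1 j * f j.
Proof.
transitivity
  (\sum_(j <- reach k.+1) \sum_(s <- S) p s * (heat k (j - s) * f j)).
  rewrite exchange_big /= big_seq [RHS]big_seq; apply: eq_bigr => s sS.
  rewrite -mulr_sumr; congr (_ * _); apply/esym.
  rewrite (@big_uniq_image _ _ (fun j => j + s) (reach k)).
  - by apply: eq_bigr => j _; rewrite addrK addrC.
  - exact: reach_uniq.
  - exact: (reach_uniq k.+1).
  - exact: addIr.
  - by move=> j jk; exact: mem_reachS.
  - move=> j jr; rewrite heat_out ?mul0r//; apply: contra jr => jr.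
    by apply/mapP; exists (j - s); rewrite ?subrK.
apply: eq_bigr => j _; rewrite [heat _ _]/(back (heat k) j) /back mulr_suml.
by apply: eq_bigr => s _; rewrite mulrA.
Qed.

Lemma heat_mass k : \sum_(j <- reach k) heat k j = 1.
Proof.
elim: k => [|k IH]; first by rewrite big_seq1 /heat /= eqxx.
have := step_heat k (fun=> 1); under [RHS]eq_bigr do rewrite mulr1.
move=> <-; rewrite -[RHS]p_mass; apply: eq_bigr => s _.
by under eq_bigr do rewrite mulr1; rewrite IH mulr1.
Qed.

Lemma heat_le1 k j : heat k j <= 1.
Proof.
have [jk|/heat_out->//] := boolP (j \in reach k).
rewrite -(heat_mass k) (bigD1_seq j) ?reach_uniq//= lerDl.
by apply: sumr_ge0 => i _; exact: heat_ge0.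
Qed.

Lemma step_le f g i : (forall j, f j <= g j) -> step f i <= step g i.
Proof. by move=> fg; apply: ler_sum => s _; rewrite ler_wpM2l. Qed.

Lemma step_ge0 f i : (forall j, 0 <= f j) -> 0 <= step f i.
Proof. by move=> f0; apply: sumr_ge0 => s _; rewrite mulr_ge0. Qed.

Lemma stepB f g i : step (fun j => f j - g j) i = step f i - step g i.
Proof. by rewrite -sumrB; apply: eq_bigr => s _; rewrite mulrBr. Qed.

Lemma expR_step (f : G -> R) i : expR (step f i) <= step (fun j => expR (f j)) i.
Proof.
set m := step f i.
have tangent j : expR m * (1 + (f j - m)) <= expR (f j).
  by rewrite -[in leRHS](subrKC m (f j)) expRD ler_wpM2l ?expR_ge0// expR_ge1Dx.
apply: le_trans (step_le _ _ i tangent).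
rewrite le_eqVlt; apply/orP; left; apply/eqP.
transitivity (expR m * (\sum_(s <- S) p s + (m - m * \sum_(s <- S) p s))).
  by rewrite p_mass; ring.
rewrite {2}/m /step mulr_sumr -sumrB -big_split /= mulr_sumr.
by apply: eq_bigr => s _; ring.
Qed.

Section Noise.
Variable e : nat -> G -> R.

Fixpoint reflected (n : nat) : G -> R :=
  if n is m.+1 then fun i => Num.max (step (reflected m) i + e n i) 0
  else fun=> 0.

Fixpoint free (n : nat) : G -> R :=
  if n is m.+1 then fun i => step (free m) i + e n i else fun=> 0.

Lemma reflected_ge0 n i : 0 <= reflected n i.
Proof. by case: n => //= n; rewrite le_max lexx orbT. Qed.

Lemma free_le_reflected n i : free n i <= reflected n i.
Proof.
by elim: n i => //= n IH i; rewrite le_max lerD2r step_le.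
Qed.

(** The linear recursion unrolled: [k] is the age of the noise, and noise of age [k] has been spread
    by [k] steps of the walk. *)
Lemma freeE n i :
  free n i = \sum_(k < n) \sum_(j <- reach k) heat k j * e (n - k) (i + j).
Proof.
elim: n i => [|n IH] i; first by rewrite big_ord0.
rewrite big_ord_recl /= subn0 addrC; congr (_ + _).
  by rewrite big_seq1 /heat /= eqxx mul1r addr0.
under [LHS]eq_bigr do rewrite IH mulr_sumr.
rewrite exchange_big /=; apply: eq_bigr => k _; rewrite /bump /= add1n subSS.
rewrite -(step_heat k (fun j => e (n - k)%N (i + j))).
by apply: eq_bigr => s _; under eq_bigr do rewrite -addrA.
Qed.

(** The maximum in the recursion for the exponential of reflected minus free is replaced by a sum,
    which can be integrated term by term. *)
Fixpoint dominating (lam : R) (n : nat) : G -> R :=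
  if n is m.+1 then
    fun i => step (dominating lam m) i + expR (- (lam * free n i))
  else fun=> 1.

Lemma dominating_ge0 lam n i : 0 <= dominating lam n i.
Proof.
elim: n i => //= n IH i; rewrite addr_ge0 ?expR_ge0//.
exact: step_ge0.
Qed.

(* The difference D = reflected - free satisfies
   D (n+1) = max (step (D n)) (- free (n+1)), and expR is convex. *)
Lemma expR_reflected lam n i : 0 <= lam ->
  expR (lam * (reflected n i - free n i)) <= dominating lam n i.
Proof.
move=> lam0; elim: n i => [|n IH] i; first by rewrite /= subrr mulr0 expR0.
have [le0|ge0] := leP (step (reflected n) i + e n.+1 i) 0.
  rewrite [reflected _ _]/= (max_r le0) sub0r mulrN.
  by rewrite [leRHS]/= lerDr step_ge0// => j; exact: dominating_ge0.
have -> : lam * (reflected n.+1 i - free n.+1 i) =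
    step (fun j => lam * (reflected n j - free n j)) i.
  rewrite [reflected _ _]/= (max_l (ltW ge0)) [free _ _]/=.
  rewrite opprD addrACA subrr addr0 -stepB /step mulr_sumr.
  by apply: eq_bigr => s _; rewrite mulrCA.
rewrite [leRHS]/=; apply: (le_trans (expR_step _ _)).
rewrite -[leLHS]addr0 lerD ?expR_ge0//; exact: step_le.
Qed.

(** The tangent bound [x <= L + expR (- L) * expR x] is applied to [lam * free] and to
    [lam * (reflected - free)]. With [L] later taken near the logarithm of the exponential moments,
    it does the work of Jensen's inequality for the logarithm. *)
Lemma reflected_le lam L n i : 0 < lam ->
  reflected n i <=
  lam^-1 * (2 * L + expR (- L) *
    (expR (lam * free n i) + dominating lam n i)).
Proof.
move=> lam0; rewrite -(ler_pM2l lam0) mulrA divff ?gt_eqF// mul1r.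
have tangent x : x <= L + expR (- L) * expR x.
  by rewrite -expRD; have := expR_ge1Dx (- L + x); lra.
have := tangent (lam * (reflected n i - free n i)).
have := tangent (lam * free n i).
have := expR_reflected lam n i (ltW lam0).
have := expR_gt0 (- L); nra.
Qed.

(** A lower bound for the positive part by exponentials alone. With [x = expR u] the left side
    contains [(x - 1) * (1 - eta * (x + 1))], which is nonpositive for [u <= 0] and again once
    [eta * (x + 1) >= 1]; in between [x - 1 <= u * x] and [eta * x <= 1] suffice. *)
Lemma reflected_ge lam eta n i : 0 < lam -> 0 < eta <= 2^-1 ->
  eta / lam * ((expR (lam * free n i) - 1)
    - eta * (expR (2 * lam * free n i) - 1)) <= reflected n i.
Proof.
move=> lam0 /andP[eta0 eta2]; set u := lam * free n i.
rewrite -(mulrA 2) -/u (mulr_natl u 2) mulr2n expRD.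
set x := expR u; rewrite -(ler_pM2l lam0) [eta / lam]mulrC !mulrA.
rewrite divff ?gt_eqF// mul1r.
have x0 : 0 < x := expR_gt0 u.
have -> : x - 1 - eta * (x * x - 1) = (x - 1) * (1 - eta * (x + 1)) by ring.
have W0 := reflected_ge0 n i; have HW := free_le_reflected n i.
have [u0|u0] := leP u 0.
  have x1 : x <= 1 by rewrite -expR0 ler_expR.
  have : (x - 1) * (1 - eta * (x + 1)) <= 0.
    rewrite mulr_le0_ge0//; first by rewrite subr_le0.
    have : eta * (x + 1) <= 2^-1 * 2 by apply: ler_pM; lra.
    lra.
  have := mulr_ge0 (ltW lam0) W0.
  move=> h1 h2; have : eta * ((x - 1) * (1 - eta * (x + 1))) <= 0.
    by rewrite mulr_ge0_le0// ltW.
  lra.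
have x1 : 1 <= x by rewrite -expR0 ler_expR ltW.
have uW : u <= lam * reflected n i by rewrite ler_wpM2l// ltW.
have [big|small] := leP 1 (eta * (x + 1)).
  have : eta * ((x - 1) * (1 - eta * (x + 1))) <= 0.
    apply: mulr_ge0_le0; first exact: ltW.
    by apply: mulr_ge0_le0; lra.
  by have := mulr_ge0 (ltW lam0) W0; lra.
have xu : x - 1 <= u * x.
  have := expR_ge1Dx (- u); rewrite expRN -/x => h.
  have : x * (1 + - u) <= x * x^-1 by rewrite ler_wpM2l// ltW.
  by rewrite divff ?gt_eqF//; lra.
apply: le_trans uW.
have ex : eta * x <= 1 by nra.
apply: (@le_trans _ _ (eta * (x - 1))).
  rewrite ler_wpM2l ?(ltW eta0)// ler_piMr ?subr_ge0//.
  by have := mulr_ge0 (ltW eta0) (ltW x0); nra.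
apply: (@le_trans _ _ (eta * (u * x))); first by rewrite ler_wpM2l// ltW.
by rewrite mulrCA ler_piMr// ltW.
Qed.

End Noise.
End Walk.

(** * Heat kernel bounds *)

Lemma bin_le_central n a : ('C(n.*2, a) <= 'C(n.*2, n))%N.
Proof.
have low j : (j <= n)%N -> ('C(n.*2, n - j) <= 'C(n.*2, n))%N.
  elim: j => [|j IH] jn; first by rewrite subn0.
  apply: leq_trans (IH (ltnW jn)).
  have -> : (n - j = (n - j.+1).+1)%N by lia.
  have := mul_bin_left n.*2 (n - j.+1); set b := binomial _ _; set b' := binomial _ _.
  move=> e; have : ((n - j.+1).+1 * b' <= (n - j.+1).+1 * b)%N.
    by rewrite e leq_mul2r; apply/orP; right; lia.
  by rewrite leq_pmul2l.
have [an|na] := leqP a n; first by rewrite -(subKn an) low// leq_subr.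
have [a2|a2] := leqP a n.*2; last by rewrite bin_small.
by rewrite -bin_sub// -(subKn (_ : n.*2 - a <= n)%N) ?low//; lia.
Qed.

(** The factor [n.*2.+1] makes the induction close, because [(2n+1)(2n+3) <= (2n+2)^2]. *)
Lemma bin_central_le n : ('C(n.*2, n) ^ 2 * n.*2.+1 <= 16 ^ n)%N.
Proof.
elim: n => // n IH.
have e : (n.+1 * 'C(n.+1.*2, n.+1) = 2 * n.*2.+1 * 'C(n.*2, n))%N.
  have := mul_bin_down n.*2.+1 n; have := mul_bin_diag n.*2.+2 n.
  by rewrite doubleS /= (_ : n.*2.+1 - n = n.+1)%N; lia.
rewrite -(@leq_pmul2l (n.+1 ^ 2))// mulnA -expnMn e !expnMn.
apply: (@leq_trans (n.+1 ^ 2 * 16 * ('C(n.*2, n) ^ 2 * n.*2.+1))).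
  by rewrite -!mulnA; nia.
by rewrite [(16 ^ n.+1)%N]expnS [(_ * (16 * _))%N]mulnA leq_mul2l IH orbT.
Qed.

Section Coin.
Context {R : realType}.

(* The symmetric binomial law, at real arguments because the coordinates [h j l] below
   need not be integers. *)
Fixpoint coin (n : nat) (t : R) : R :=
  if n is m.+1 then (coin m t + coin m (t - 1)) / 2 else (t == 0)%:R.

Lemma coin_ge0 n t : 0 <= coin n t.
Proof.
by elim: n t => [|n IH] t /=; rewrite ?ler0n// divr_ge0// addr_ge0.
Qed.

Lemma coin_natE n :
  (forall a : nat, coin n a%:R = 'C(n, a)%:R / 2 ^+ n) /\
  (forall t, (forall a : nat, t != a%:R) -> coin n t = 0).
Proof.
elim: n => [|n [IH1 IH2]].
  split=> [a|t /(_ 0)/negPf/= ->//].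
  by rewrite /= expr0 divr1 bin0n pnatr_eq0.
split=> [[|a]|t ta].
- rewrite /= IH1 IH2; last first.
    move=> a; apply/eqP => h; have : 0 <= a%:R :> R by [].
    by rewrite -h; lra.
  by rewrite addr0 !bin0 exprS invfM !mul1r mulrC.
- rewrite [LHS]/= -[a.+1%:R - 1]/(_ - _) -(natr1 a) addrK natr1 !IH1 binS natrD.
  by rewrite -mulrDl exprS invfM mulrA mulrAC.
- rewrite /= !IH2 ?addr0 ?mul0r// => a.
  by rewrite subr_eq natr1 ta.
Qed.

(** Even rows are bounded by the central binomial coefficient. An odd row averages two entries of
    the preceding even row, and this shift of the index costs the factor [Num.sqrt 2]. *)
Lemma coin_le n t : coin n t <= Num.sqrt 2 / Num.sqrt n.+1%:R.
Proof.
have even m u : coin m.*2 u <= (Num.sqrt m.*2.+1%:R)^-1.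
  have [[a ->]|h] := pselect (exists a : nat, u = a%:R); last first.
    rewrite (coin_natE _).2 ?invr_ge0// => a.
    by apply/eqP => ua; apply: h; exists a.
  rewrite (coin_natE _).1 ler_pdivrMr ?exprn_gt0//.
  rewrite ler_pdivlMl ?sqrtr_gt0//.
  rewrite -(ler_pXn2r (_ : 0 < 2)%N) ?nnegrE ?mulr_ge0 ?exprn_ge0//.
  rewrite exprMn sqr_sqrtr// -exprM -!natrX -natrM ler_nat.
  have := leq_trans _ (bin_central_le m); move=> /(_ (m.*2.+1 * 'C(m.*2, a) ^ 2)%N).
  rewrite muln2 -[(16 ^ m)%N]/((2 ^ 4) ^ m)%N -expnM.
  have -> : (2 ^ (4 * m) = 2 ^ m.*2.*2)%N by congr (_ ^ _)%N; lia.
  by apply; rewrite mulnC leq_mul2r leq_exp2r// bin_le_central orbT.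
have sup_le m B u : (forall v, coin m v <= B) -> coin m.+1 u <= B.
  by move=> h; rewrite /=; have := h u; have := h (u - 1); lra.
have s2 : 1 <= Num.sqrt 2 :> R by rewrite -[leLHS]sqrtr1 ler_sqrt; lra.
rewrite -(odd_double_half n); case: (odd n) => /=; set m := n./2.
  rewrite add1n; apply: sup_le => v; apply: le_trans (even m v) _.
  rewrite -sqrtrV// -sqrtrV// -sqrtrM// ler_sqrt//.
  rewrite -[leLHS]mul1r ler_pdivrMr// mulrAC ler_pdivlMr// mul1r.
  by rewrite -natrM ler_nat; lia.
rewrite add0n; apply: le_trans (even m t) _.
by rewrite ler_peMl// invr_ge0.
Qed.

End Coin.

(** Weierstrass' product inequality. *)
Lemma prodB_ge (R : realType) (I : Type) (r : seq I) (f : I -> R) :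
  (forall i, 0 <= f i <= 1) ->
  1 - \sum_(i <- r) f i <= \prod_(i <- r) (1 - f i) <= 1.
Proof.
move=> f01; elim: r => [|i r IH]; first by rewrite !big_nil subr0 lexx.
rewrite !big_cons; have := f01 i; set s := \sum_(j <- r) _ in IH *.
have : 0 <= s by apply: sumr_ge0 => j _; case/andP: (f01 j).
set q := \prod_(j <- r) _ in IH *.
have : 0 <= q by apply: prodr_ge0 => j _; have := f01 j; lra.
nra.
Qed.

(* A step of the walk contains, with weight [2 * delta] for each [l], a fair choice between
   [x l] and [y]. If [N l] such choices have been made in each direction [l], the walk has
   law [q m N] after [m] further steps, and conditioning on one more step shows that it
   stays below the supersolution [f N m]. *)
Section HeatBound.
Context {R : realType} {d : nat}.
Variables (S : seq 'rV[int]_d) (p : 'rV[int]_d -> R).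
Hypothesis p_ge0 : forall s, 0 <= p s.
Hypothesis p_mass : \sum_(s <- S) p s = 1.
Variables (x : 'I_d -> 'rV[int]_d) (y : 'rV[int]_d).
Variables (delta : R) (r : 'rV[int]_d -> R).
Hypothesis delta01 : 0 < delta <= 1.
Hypothesis r_ge0 : forall s, 0 <= r s.
Hypothesis p_split : forall f : 'rV[int]_d -> R,
  \sum_(s <- S) p s * f s =
  delta * (\sum_l (f (x l) + f y)) + \sum_(s <- S) r s * f s.
Variable h : 'rV[int]_d -> 'I_d -> R.
Hypothesis hB : forall i j l, h (i - j) l = h i l - h j l.
Hypothesis h_inj : forall j, (forall l, h j l = 0) -> j = 0.
Hypothesis h_x : forall l l', h (x l - y) l' = (l == l')%:R.

Local Notation box N := (fun j => \prod_l coin (N l) (h j l)).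
Local Notation incr N l := (fun l' : 'I_d => N l' + (l' == l))%N.
Local Notation q m N := (iter m (back S p) (box N)).

(** A shift by [x l - y] changes only the coordinate [l], by 1, so for [m = 0] this is the recursion
    of [coin]. Further steps of the walk are linear and commute with shifts. *)
Lemma q_incr m N l j :
  q m (incr N l) j = (q m N j + q m N (j - (x l - y))) / 2.
Proof.
elim: m j => [|m IH] j.
  rewrite /= (bigD1 l)//= [in RHS](bigD1 l)//= (bigD1 l (P := predT))//=.
  rewrite eqxx addn1 /= hB h_x eqxx -mulrA mulrC -mulrA.
  set A1 := \prod_(i | i != l) _; set A2 := \prod_(i | i != l) _.
  set A3 := \prod_(i | i != l) _.
  have -> : A2 = A1.
    by apply: eq_bigr => l' /negPf l'l; rewrite l'l addn0.
  have -> : A3 = A1.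
    apply: eq_bigr => l' /negPf l'l.
    by rewrite l'l addn0 hB h_x eq_sym l'l subr0.
  by ring.
rewrite !iterS; set u := iter m _ _ in IH *; set v := iter m _ _ in IH *.
rewrite /back -big_split /= mulr_suml; apply: eq_bigr => s _.
by rewrite IH [j - _ - s]addrAC mulrA mulrDr.
Qed.

Local Notation slope := (delta / 2).
Local Notation f N m :=
  (\prod_l (Num.sqrt 2 / Num.sqrt ((N l)%:R + 1 + slope * m%:R))).

(** One more choice in direction [l], which has weight [2 * delta], multiplies [f] by
    [sqrt (a / (a + 1)) <= 1 - 1 / (4 * a)]. The total relative loss is at least the sum of
    [slope / a l], and this is why [slope] is [delta / 2]. The right side loses no more, by
    [1 - slope / a <= a / (a + slope)] and the product inequality. *)
Lemma f_super N m :
  2 * delta * (\sum_l f (incr N l) m) + (1 - 2 * d%:R * delta) * f N m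
  <= f N m.+1.
Proof.
case/andP: delta01 => d0 d1.
pose a l : R := (N l)%:R + 1 + slope * m%:R.
have a1 l : 1 <= a l by rewrite /a -addrA addrCA lerDl addr_ge0// mulr_ge0// ltW// divr_gt0.
have a0 l : 0 < a l by apply: lt_le_trans (a1 l).
have sq t : 0 < t -> t <= 1 -> t <= Num.sqrt t :> R.
  move=> t0 t1; have := sqr_sqrtr (ltW t0); have := sqrtr_ge0 t.
  by have : Num.sqrt t <= 1 by [rewrite -sqrtr1 ler_sqrt]; nra.
have s20 : 0 < Num.sqrt 2 :> R by rewrite sqrtr_gt0.
have ratio u v : 0 < u -> 0 < v ->
    Num.sqrt 2 / Num.sqrt v = Num.sqrt 2 / Num.sqrt u * Num.sqrt (u / v) :> R.
  move=> u0 v0; rewrite sqrtrM ?ltW// sqrtrV ?ltW// -mulrA mulKf//.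
  by rewrite gt_eqF ?sqrtr_gt0.
have E1 l : f (incr N l) m = f N m * Num.sqrt (a l / (a l + 1)).
  rewrite (bigD1 l)//= [in RHS](bigD1 l)//= eqxx [RHS]mulrAC; congr (_ * _).
    have -> : (N l + true)%:R + 1 + slope * m%:R = a l + 1.
      by rewrite /a addn1 -natr1; ring.
    exact: ratio (a0 l) (addr_gt0 (a0 l) ltr01).
  by apply: eq_bigr => i /negPf il; rewrite il addn0.
have E2 : f N m.+1 = f N m * \prod_l Num.sqrt (a l / (a l + slope)).
  rewrite -big_split /=; apply: eq_bigr => l _.
  have -> : (N l)%:R + 1 + slope * m.+1%:R = a l + slope.
    by rewrite /a -natr1; ring.
  by apply: ratio (a0 l) _; rewrite addr_gt0 ?a0 ?divr_gt0.
rewrite (eq_bigr _ (fun l _ => E1 l)).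
rewrite E2 -mulr_sumr mulrCA [X in _ + X]mulrC -mulrDr.
rewrite ler_wpM2l//; first by apply: prodr_ge0 => l _; rewrite divr_ge0// ltW.
pose b l := slope / a l.
have b0 l : 0 <= b l <= 1.
  have al := a1 l; rewrite /b ler_pdivrMr ?a0// mul1r.
  by apply/andP; split; [apply: divr_ge0|]; lra.
apply: (@le_trans _ _ (1 - \sum_l b l)).
  have : \sum_l Num.sqrt (a l / (a l + 1)) <= \sum_(l < d) (1 - (4 * a l)^-1).
    apply: ler_sum => l _; set z := a l.
    have z1 : 1 <= z := a1 l.
    have /andP[z'0 z'1] : 0 <= z / (z + 1) <= 1.
      by rewrite divr_ge0 ?ler_pdivrMr; lra.
    have : Num.sqrt (z / (z + 1)) <= (1 + z / (z + 1)) / 2.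
      have := sqr_sqrtr z'0; have := sqrtr_ge0 (z / (z + 1)); nra.
    suff : (4 * z)^-1 <= (1 - z / (z + 1)) / 2 by lra.
    have -> : 1 - z / (z + 1) = (z + 1)^-1 by field; lra.
    by rewrite -invfM lef_pV2 ?posrE; lra.
  rewrite sumrB sumr_const card_ord => hs.
  have -> : \sum_l b l = 2 * delta * \sum_(l < d) (4 * a l)^-1.
    rewrite mulr_sumr; apply: eq_bigr => l _; rewrite /b.
    by field; rewrite gt_eqF.
  set s1 := \sum_(l < d) Num.sqrt _ in hs *; set s2 := \sum_(l < d) _ in hs *.
  have : 2 * delta * s1 <= 2 * delta * (d%:R - s2) by rewrite ler_pM2l; lra.
  lra.
have /andP[h1 _] := prodB_ge _ _ (index_enum _) _ b0.
apply: le_trans h1 _; apply: ler_prod => l _.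
have /andP[b1 b2] := b0 l; apply/andP; split; first lra.
have s0 : 0 < a l + slope by rewrite addr_gt0// divr_gt0.
apply: (@le_trans _ _ (a l / (a l + slope))); last first.
  by apply: sq; rewrite ?divr_gt0// ler_pdivrMr// mul1r lerDl ltW// divr_gt0.
rewrite ler_pdivlMr// /b mulrBl mul1r mulrDr divfK ?gt_eqF//.
have : 0 <= slope / a l * slope by rewrite mulr_ge0// ltW// divr_gt0.
lra.
Qed.

(** In [p_split] the terms for [x l] and [y] combine, by [q_incr] at the site [j - y], into
    [2 * delta] times the law with one more choice; the rest of the step keeps [N]. Then [f_super]
    applies. *)
Lemma q_le m N j : q m N j <= f N m.
Proof.
elim: m N j => [|m IH] N j.
  rewrite /=; apply: ler_prod => l _; rewrite coin_ge0 /=.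
  by rewrite mulr0 addr0 natr1 coin_le.
apply: le_trans (f_super N m).
rewrite iterS /back (p_split (fun s => q m N (j - s))).
have d0 : 0 < delta by case/andP: delta01.
apply: lerD.
  rewrite [2 * _]mulrC -[leRHS]mulrA; apply: ler_wpM2l; first exact: ltW.
  rewrite mulr_sumr; apply: ler_sum => l _.
  apply: le_trans (ler_wpM2l _ (IH (incr N l) (j - y))) => //.
  rewrite q_incr mulrCA mulfV// mulr1 addrC.
  by rewrite opprB addrA subrK.
(* Testing [p_split] on the constant 1 yields the mass of [r]. *)
have -> : 1 - 2 * d%:R * delta = \sum_(s <- S) r s.
  have := p_split (fun=> 1); rewrite sumr_const card_ord.
  under eq_bigr do rewrite mulr1; under [in RHS]eq_bigr do rewrite mulr1.
  by rewrite p_mass -mulr_natl; lra.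
by rewrite mulr_suml; apply: ler_sum => s _; rewrite ler_wpM2l.
Qed.

(** The case of no initial choices: the box is then the point mass at 0 since [h] separates points.
    The constant comes from [1 + slope * k >= slope * k.+1]. *)
Lemma heat_le_of_split : exists2 B : R, 0 < B &
  forall k j, heat S p k j <= B / Num.sqrt k.+1%:R ^+ d.
Proof.
have /andP[d0 d1] := delta01.
exists ((Num.sqrt 2 / Num.sqrt slope) ^+ d).
  by rewrite exprn_gt0// divr_gt0// sqrtr_gt0// divr_gt0.
move=> k j; rewrite -expr_div_n.
have -> : heat S p k j = q k (fun=> 0%N) j.
  rewrite /heat; congr (iter k _ _ j); apply/funext => i /=.
  case: (eqVneq i 0) => [->|i0].
    rewrite big1// => l _; have := hB 0 0 l; rewrite subrr => ->.
    by rewrite subrr eqxx.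
  have [l hl] : exists l, h i l != 0.
    apply/not_existsP => hl; move/eqP: i0; apply; apply: h_inj => l.
    by apply/eqP/negPn/negP; exact: hl.
  by rewrite (bigD1 l)//= (negPf hl) mul0r.
apply: le_trans (q_le _ _ _) _; rewrite prodr_const card_ord.
have slope0 : 0 < slope by rewrite divr_gt0.
rewrite lerXn2r ?nnegrE ?divr_ge0 ?sqrtr_ge0//.
rewrite -[leRHS]mulrA; apply: ler_wpM2l; first exact: sqrtr_ge0.
rewrite -invfM -sqrtrM ?(ltW slope0)// add0r.
have k0 : 0 <= slope * k%:R by rewrite mulr_ge0// ltW.
have e : slope * k.+1%:R = slope * k%:R + slope by rewrite -natr1; ring.
by rewrite e lef_pV2 ?posrE ?sqrtr_gt0 ?ler_sqrt; lra.
Qed.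

End HeatBound.

(** * Centred step laws on the lattice *)

Definition cube (d m : nat) : seq 'rV[int]_d :=
  [seq \row_k ((f k)%:Z - m%:Z) | f : {ffun 'I_d -> 'I_m.*2.+1}].

Lemma size_cube d m : size (cube d m) = (m.*2.+1 ^ d)%N.
Proof. by rewrite size_map -cardE card_ffun !card_ord. Qed.

Lemma mem_cube d m (j : 'rV[int]_d) :
  (forall k, `|j 0 k| <= m%:Z) -> j \in cube d m.
Proof.
move=> jm; apply/mapP; exists [ffun k => inord (absz (j 0 k + m%:Z)) : 'I_m.*2.+1].
  by rewrite mem_enum.
apply/rowP => k; rewrite mxE ffunE; move: (jm k); move: (j 0 k) => z zm.
have zE : Posz (absz (z + Posz m)) = z + Posz m by apply: gez0_abs; lia.
by rewrite inordK ?zE ?addrK// ltnS -lez_nat zE; lia.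
Qed.

Section StepDistribution.
Context {R : realType} {d : nat}.
Variable p : 'rV[int]_d -> R.
Hypothesis hp : step_distribution p.

Lemma step_distribution_ge0 s : 0 <= p s.
Proof. by have /andP[] := step_range hp s. Qed.

Lemma step_distribution_le1 s : p s <= 1.
Proof. by have /andP[] := step_range hp s. Qed.

Lemma step_distribution_support :
  exists S : seq 'rV[int]_d, uniq S /\ forall s, (s \in S) = (p s != 0).
Proof.
have [v pv] := step_bounded hp.
exists (undup [seq s <- cube d v | p s != 0]); split; first exact: undup_uniq.
move=> s; rewrite mem_undup mem_filter andb_idr// => ps.
apply: mem_cube => k; rewrite leNgt; apply/negP => h.
by move/eqP: ps; apply; apply: pv; exists k.
Qed.

Variable S : seq 'rV[int]_d.
Hypothesis S_uniq : uniq S.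
Hypothesis S_supp : forall s, (s \in S) = (p s != 0).

Lemma fsum_support (f : 'rV[int]_d -> R) :
  (forall s, p s = 0 -> f s = 0) ->
  \sum_(s \in [set: 'rV[int]_d]) f s = \sum_(s <- S) f s.
Proof.
move=> f0; rewrite (fsbigE S)//; first by apply: eq_bigl => s; rewrite in_setT.
by move=> s _; rewrite S_supp negbK => /eqP/f0.
Qed.

Lemma step_distribution_mass : \sum_(s <- S) p s = 1.
Proof. by rewrite -fsum_support ?step_mass. Qed.

Lemma step_distribution_mean k : \sum_(s <- S) p s * (s 0 k)%:~R = 0.
Proof.
rewrite -[RHS](step_centered hp k) fsum_support.
  by apply: eq_bigr => s _; rewrite mulrC.
by move=> s ->; rewrite mulr0.
Qed.

Lemma avgE f i : avg p f i = step S p f i.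
Proof.
rewrite /avg (fsbigE [seq s + i | s <- S]) ?map_inj_uniq//; last 2 first.
  exact: addIr.
  move=> j _ jS; suff -> : p (j - i) = 0 by rewrite mul0r.
  apply/eqP; rewrite -[_ == _]negbK -S_supp; apply: contra jS => jS.
  by apply/mapP; exists (j - i); rewrite ?subrK.
rewrite big_map; under eq_bigl do rewrite in_setT.
by apply: eq_bigr => s _; rewrite addrK addrC.
Qed.

(** A functional constant on the support has constant value 0, because the step is centred. Its zero
    set is then a subgroup containing the support, hence everything. *)
Lemma support_nondegenerate (u : 'I_d -> R) (c : R) :
  (forall s, s \in S -> \sum_k u k * (s 0 k)%:~R = c) -> forall k, u k = 0.
Proof.
move=> uc.
have c0 : c = 0.
  transitivity (\sum_(s <- S) p s * \sum_k u k * (s 0 k)%:~R).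
    rewrite (eq_big_seq (fun s => p s * c)) => [|s sS]; last by rewrite uc.
    by rewrite -mulr_suml step_distribution_mass mul1r.
  under eq_bigr do rewrite mulr_sumr.
  rewrite exchange_big big1//= => k _.
  under eq_bigr do rewrite mulrCA.
  by rewrite -mulr_sumr step_distribution_mean mulr0.
pose G : {pred 'rV[int]_d} := fun s => \sum_k u k * (s 0 k)%:~R == 0.
have Gz : zmod_closed G.
  split=> [|s t]; rewrite !unfold_in.
    by rewrite big1// => k _; rewrite mxE mulr0.
  move=> /eqP s0 /eqP t0.
  under eq_bigr do rewrite !mxE intrD rmorphN mulrDr mulrN.
  by rewrite big_split /= sumrN s0 t0 subrr.
have GS s : p s != 0 -> s \in G.
  by rewrite -S_supp => sS; rewrite unfold_in uc// c0.
move=> k; have := step_generates hp Gz GS (delta_mx 0 k).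
rewrite unfold_in (bigD1 k)//= big1 ?addr0.
  by rewrite mxE !eqxx mulr1 => /eqP.
by move=> i /negPf ik; rewrite mxE ik andbF mulr0.
Qed.

Lemma support_basis (y : 'rV[int]_d) : y \in S ->
  exists2 x : 'I_d -> 'rV[int]_d, forall l, x l \in S &
  exists h : 'rV[int]_d -> 'I_d -> R,
  [/\ forall i j l, h (i - j) l = h i l - h j l,
      forall j, (forall l, h j l = 0) -> j = 0 &
      forall l l', h (x l - y) l' = (l == l')%:R].
Proof.
move=> yS; pose emb (s : 'rV[int]_d) : 'rV[R]_d := map_mx intr s.
pose M : 'M[R]_(size S, d) := \matrix_(a < size S) emb (nth 0 S a - y).
have ME a b : M a b = (nth 0 S a 0 b - y 0 b)%:~R by rewrite /M !mxE.
have Mfull : row_full M.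
  rewrite -cokermx_eq0; apply/eqP/matrixP => k l; rewrite [RHS]mxE.
  pose u i := cokermx M i l.
  apply: (support_nondegenerate u (\sum_i u i * (y 0 i)%:~R)) => s sS.
  have iS : (index s S < size S)%N by rewrite index_mem.
  have /matrixP/(_ (Ordinal iS) l) := mulmx_coker M; rewrite !mxE => e.
  apply/eqP; rewrite -subr_eq0 -sumrB -[X in _ == X]e; apply/eqP/eq_bigr => i _.
  by rewrite ME /= nth_index// -mulrBr mulrC rmorphB.
pose V : 'M[R]_d := rowsub (fullrankfun Mfull) M.
have Vu : V \in unitmx by rewrite -row_full_unit fullrowsub_full.
exists (fun l => nth 0 S (fullrankfun Mfull l)); first by move=> l; rewrite mem_nth.
exists (fun j l => (emb j *m invmx V) 0 l); split.
- move=> i j l; rewrite /emb.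
  have -> : map_mx intr (i - j) = map_mx intr i - map_mx intr j :> 'rV[R]_d.
    by apply/rowP => k; rewrite !mxE intrD rmorphN.
  by rewrite mulmxBl !mxE.
- move=> j hj; have : emb j *m invmx V = 0 by apply/rowP => l; rewrite hj mxE.
  move/(congr1 (mulmx^~ V)); rewrite mulmxKV// mul0mx => /rowP e.
  apply/rowP => k; have := e k; rewrite !mxE => /eqP.
  by rewrite intr_eq0 => /eqP.
- move=> l l'; have -> : emb (nth 0 S (fullrankfun Mfull l) - y) = row l V.
    by rewrite row_rowsub rowK.
  by rewrite -row_mul mulmxV// rowE mulmx1 mxE eqxx /= eq_sym.
Qed.

(** It remains to split off fair choices between [x l] and [y] from the step without making the
    remaining weights negative. *)
Lemma heat_le : exists2 B : R, 0 < B &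
  forall k j, heat S p k j <= B / Num.sqrt k.+1%:R ^+ d.
Proof.
have [y yS] : exists y, y \in S.
  case: S step_distribution_mass => [|y S' _]; last by exists y; rewrite inE eqxx.
  by rewrite big_nil => /esym/eqP; rewrite oner_eq0.
have [x xS [h [hB h_inj h_x]]] := support_basis y yS.
have pS s : s \in S -> 0 < p s <= 1.
  by rewrite S_supp lt_neqAle eq_sym => ->; rewrite step_distribution_ge0 step_distribution_le1.
(* A product of weights at most 1 lies below each of them, so it replaces their minimum. *)
pose m := p y * \prod_l p (x l).
have prod01 (r : seq 'I_d) : 0 < \prod_(l <- r) p (x l) <= 1.
  elim: r => [|l r /andP[r0 r1]]; first by rewrite big_nil ltr01 lexx.
  have /andP[l0 l1] := pS _ (xS l).
  by rewrite big_cons mulr_gt0//= mulr_ile1// ltW.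
have /andP[py0 py1] := pS y yS.
have m0 : 0 < m by rewrite mulr_gt0//; have /andP[] := prod01 (index_enum _).
have my : m <= p y.
  by rewrite ler_piMr ?(ltW py0)//; have /andP[] := prod01 (index_enum _).
have mx l : m <= p (x l).
  have /andP[l0 l1] := pS _ (xS l).
  apply: (@le_trans _ _ (\prod_i p (x i))).
    by rewrite ler_piMl// ltW//; have /andP[] := prod01 (index_enum _).
  rewrite (bigD1 l)//= ler_piMr ?(ltW l0)// -big_filter.
  by have /andP[] := prod01 [seq i <- index_enum _ | i != l].
(* The function [hit] below is at most [2 * d], hence [delta * hit s <= m <= p s] wherever [hit s]
   is nonzero. *)
pose delta := m / (2 * d.+1%:R).
have d1 : 1 <= d.+1%:R :> R by rewrite ler1n.
have delta0 : 0 < delta by rewrite divr_gt0// mulr_gt0.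
have delta1 : delta <= 1.
  by rewrite ler_pdivrMr ?mulr_gt0//; lra.
pose hit s : R := \sum_l ((s == x l)%:R + (s == y)%:R).
pose r s := p s - delta * hit s.
have r_ge0 s : 0 <= r s.
  rewrite subr_ge0.
  have [sxy|] := boolP ((s == y) || [exists l, s == x l]).
    have ms : m <= p s.
      by case/orP: sxy => [/eqP->//|/existsP[l /eqP->]].
    apply: le_trans ms; rewrite /delta mulrAC ler_pdivrMr ?mulr_gt0//.
    rewrite ler_pM2l//; apply: (@le_trans _ _ (\sum_(l < d) 2)).
      by apply: ler_sum => l _; rewrite -natrD ler_nat; do 2!case: (_ == _).
    by rewrite sumr_const card_ord -[2 *+ d]mulr_natr -natr1; lra.
  rewrite negb_or => /andP[/negPf sy /existsPn sx].
  by rewrite /hit big1 ?mulr0 ?step_distribution_ge0// => l _; rewrite sy (negPf (sx l)) addr0.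
apply: (@heat_le_of_split R d S p step_distribution_mass x y delta r _ r_ge0 _ h hB h_inj h_x).
  by rewrite delta0.
move=> f.
have pick z : z \in S -> \sum_(s <- S) (s == z)%:R * f s = f z.
  move=> zS; rewrite (bigD1_seq z)//= eqxx mul1r big1 ?addr0// => s /negPf->.
  by rewrite mul0r.
have -> : delta * \sum_l (f (x l) + f y) = \sum_(s <- S) delta * hit s * f s.
  under [RHS]eq_bigr do rewrite -mulrA.
  rewrite -mulr_sumr; congr (_ * _).
  under [RHS]eq_bigr do rewrite /hit mulr_suml.
  rewrite exchange_big /=; apply: eq_bigr => l _.
  under [RHS]eq_bigr do rewrite mulrDl.
  by rewrite big_split /= !pick.
by rewrite -big_split /=; apply: eq_bigr => s _; rewrite -mulrDl addrC subrK.
Qed.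

(** Second moments add up along the walk, as the cross term vanishes for a centred step. *)
Lemma heat_second_moment : exists2 A : R, 0 <= A & forall k,
  \sum_(j <- reach S k) heat S p k j * (\sum_l (j 0 l)%:~R ^+ 2) = k%:R * A.
Proof.
pose Q (j : 'rV[int]_d) : R := \sum_l (j 0 l)%:~R ^+ 2.
exists (\sum_(s <- S) p s * Q s).
  apply: sumr_ge0 => s _; rewrite mulr_ge0 ?step_distribution_ge0//.
  by apply: sumr_ge0 => l _; rewrite sqr_ge0.
elim=> [|k IH].
  rewrite /= big_seq1 mul0r big1 ?mulr0// => l _.
  by rewrite mxE expr0n.
rewrite -(step_heat S p k).
have QD s j : Q (s + j) = Q s + \sum_l (s 0 l)%:~R * (2 * (j 0 l)%:~R) + Q j.
  rewrite -!big_split /=; apply: eq_bigr => l _; rewrite mxE intrD; ring.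
pose c l : R := \sum_(j <- reach S k) heat S p k j * (2 * (j 0 l)%:~R).
have split s : \sum_(j <- reach S k) heat S p k j * Q (s + j) =
    Q s + \sum_l (s 0 l)%:~R * c l + k%:R * \sum_(s <- S) p s * Q s.
  under eq_bigr do rewrite QD !mulrDr.
  rewrite !big_split /= -mulr_suml (heat_mass S p step_distribution_mass) mul1r.
  rewrite -IH; congr (_ + _ + _).
  under eq_bigr do rewrite mulr_sumr.
  rewrite exchange_big; apply: eq_bigr => l _; rewrite mulr_sumr.
  by apply: eq_bigr => j _; rewrite mulrCA.
under eq_bigr do rewrite split !mulrDr.
rewrite !big_split /= -mulr_suml step_distribution_mass mul1r.
rewrite [X in _ + X + _]big_seq [X in _ + X + _](_ : _ = 0).
  by rewrite addr0 -natr1 mulrDl mul1r addrC.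
rewrite -big_seq; under eq_bigr do rewrite mulr_sumr.
rewrite exchange_big big1//= => l _.
under eq_bigr do rewrite mulrA.
by rewrite -mulr_suml step_distribution_mean mul0r.
Qed.

(** By Chebyshev half of the mass lies in a cube of radius of order [sqrt k]. By Cauchy-Schwarz,
    mass 1/2 spread over [N] sites has sum of squares at least [1 / (4 * N)]. *)
Lemma heat_sq_ge : exists2 c : R, 0 < c & forall k,
  c / Num.sqrt k.+1%:R ^+ d <= \sum_(j <- reach S k) heat S p k j ^+ 2.
Proof.
have [A A0 hA] := heat_second_moment.
(* Chosen so that the side [2 * m + 1] of the cube is at most [D * sqrt (k + 1)]. *)
pose D : R := 2 * Num.sqrt (2 * A) + 1.
have D1 : 1 <= D by rewrite lerDr mulr_ge0// sqrtr_ge0.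
have D0 : 0 < D by lra.
exists (4 * D ^+ d)^-1; first by rewrite invr_gt0 mulr_gt0 ?exprn_gt0.
move=> k; pose x := Num.sqrt (2 * A * k%:R).
have x0 : 0 <= x := sqrtr_ge0 _.
have xx : x ^+ 2 = 2 * A * k%:R by rewrite sqr_sqrtr// !mulr_ge0.
pose m := Num.truncn x.
have /andP[mx xm] : m%:R <= x < m.+1%:R := truncn_itv x0.
pose h j := heat S p k j.
have h0 j : 0 <= h j by apply: heat_ge0; exact: step_distribution_ge0.
pose Q (j : 'rV[int]_d) : R := \sum_l (j 0 l)%:~R ^+ 2.
have inside : 2^-1 <= \sum_(j <- reach S k | j \in cube d m) h j.
  have := heat_mass S p step_distribution_mass k.
  rewrite (bigID (mem (cube d m))) /= => e.
  suff : \sum_(j <- reach S k | j \notin cube d m) h j <= 2^-1.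
    by rewrite /h; lra.
  have m0 : 0 < m.+1%:R ^+ 2 :> R by rewrite exprn_gt0.
  rewrite -(ler_pM2r m0) mulr_suml.
  apply: (@le_trans _ _ (\sum_(j <- reach S k) h j * Q j)).
    rewrite [leRHS](bigID (mem (cube d m))) /= -[leLHS]add0r lerD//.
      by apply: sumr_ge0 => j _; rewrite mulr_ge0// sumr_ge0// => l _; rewrite sqr_ge0.
    apply: ler_sum => j jm; rewrite ler_wpM2l//.
    have [l hl] : exists l, m%:Z < `|j 0 l|.
      apply/not_existsP => hl; move/negP: jm; apply; apply: mem_cube => l.
      by rewrite leNgt; apply/negP; exact: hl.
    rewrite /Q (bigD1 l)//= -[leLHS]addr0 lerD//; last first.
      by apply: sumr_ge0 => i _; rewrite sqr_ge0.
    rewrite -[leRHS]real_normK ?num_real// lerXn2r ?nnegrE//.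
    by rewrite -intr_norm -[m.+1%:R]/(m.+1%:Z%:~R) ler_int; lia.
  rewrite hA; have : x ^+ 2 <= m.+1%:R ^+ 2 by rewrite lerXn2r ?nnegrE// ltW.
  by rewrite xx; lra.
pose N : R := (m.*2.+1 ^ d)%:R.
have N0 : 0 < N by rewrite ltr0n expn_gt0.
(* Cauchy-Schwarz in linear form: [h <= 1 / (4 * N) + N * h ^ 2], summed over at most [N] sites. *)
have amgm : \sum_(j <- reach S k | j \in cube d m) h j <=
    4^-1 + N * \sum_(j <- reach S k) h j ^+ 2.
  apply: (@le_trans _ _ (\sum_(j <- reach S k | j \in cube d m)
      ((4 * N)^-1 + N * h j ^+ 2))).
    apply: ler_sum => j _.
    have -> : (4 * N)^-1 + N * h j ^+ 2 = N * (h j - (2 * N)^-1) ^+ 2 + h j.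
      by field; rewrite gt_eqF.
    by rewrite lerDr mulr_ge0 ?sqr_ge0// ltW.
  rewrite big_split /= lerD//.
    rewrite -big_filter big_const_seq iter_addr_0 count_predT -[_ *+ size _]mulr_natl.
    rewrite invfM mulrCA -[leRHS]mulr1 ler_pM2l// ler_pdivrMr// mul1r ler_nat.
    rewrite -(size_cube d m); apply: uniq_leq_size.
      by rewrite filter_uniq// reach_uniq.
    by move=> j; rewrite mem_filter => /andP[].
  rewrite -mulr_sumr ler_wpM2l ?(ltW N0)// big_mkcond; apply: ler_sum => j _.
  by case: ifP => // _; exact: sqr_ge0.
have NS : 4^-1 <= N * \sum_(j <- reach S k) h j ^+ 2 by lra.
have ND : N <= D ^+ d * Num.sqrt k.+1%:R ^+ d.
  rewrite /N natrX -exprMn lerXn2r ?nnegrE ?mulr_ge0 ?sqrtr_ge0 ?(ltW D0)//.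
  have k1 : 1 <= Num.sqrt k.+1%:R :> R by rewrite -[leLHS]sqrtr1 ler_sqrt// ler1n.
  have : x <= Num.sqrt (2 * A) * Num.sqrt k.+1%:R.
    by rewrite -sqrtrM ?mulr_ge0// ler_sqrt ?mulr_ge0// ler_wpM2l ?mulr_ge0// ler_nat.
  rewrite -[m.*2.+1%:R]natr1 -mul2n natrM /D; lra.
rewrite invfM -mulrA -invfM ler_pdivrMr ?mulr_gt0 ?exprn_gt0 ?sqrtr_gt0//.
apply: le_trans NS _; rewrite mulrC ler_wpM2l//.
by apply: sumr_ge0 => j _; exact: sqr_ge0.
Qed.

End StepDistribution.

(** * Independence and exponential moments *)

Section Independence.
Context {R : realType} {dT : measure_display} {T : measurableType dT}.
Variable P : probability T R.

Lemma integral_cst_prob (r : R) : (\int[P]_w r%:E = r%:E)%E.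
Proof. by rewrite integral_cst//= probability_setT mule1. Qed.

Lemma integral_indicT (B : set T) : measurable B ->
  (\int[P]_w (\1_B w)%:E = P B)%E.
Proof. by move=> mB; rewrite integral_indic// setIT. Qed.

Lemma measurable_preimage (Y : {RV P >-> R}) (B : set R) :
  measurable B -> measurable (Y @^-1` B).
Proof.
by move=> mB; rewrite -[X in measurable X]setTI; exact: (measurable_funP Y).
Qed.

Section IndicatorsSuffice.
Variables (Y : {RV P >-> R}) (G : T -> R).
Hypotheses (mG : measurable_fun [set: T] G) (G_ge0 : forall w, 0 <= G w).
Hypothesis G_fin : (\int[P]_w (G w)%:E)%E \is a fin_num.
Hypothesis YG : forall B : set R, measurable B ->
  (\int[P]_w (\1_B (Y w) * G w)%:E =
   P (Y @^-1` B) * \int[P]_w (G w)%:E)%E.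

Import HBNNSimple.

Lemma integral_mul_nnsfun (g : {nnsfun R >-> R}) :
  (\int[P]_w (g (Y w) * G w)%:E =
   \int[P]_w (g (Y w))%:E * \int[P]_w (G w)%:E)%E.
Proof.
pose s := fset_set (range g).
have gE x : g x = \sum_(v <- s) `|v| * \1_(g @^-1` [set v]) x.
  rewrite fimfunE fsbig_finite//; apply: eq_big_seq => v.
  rewrite in_fset_set// inE => -[y _ <-].
  by rewrite ger0_norm.
have mpre v : measurable (g @^-1` [set v]) by [].
have mY v : measurable_fun [set: T] (fun w => \1_(g @^-1` [set v]) (Y w) : R).
  exact: (measurableT_comp (measurable_indic (mpre v))).
have -> : (\int[P]_w (g (Y w) * G w)%:E =
    \sum_(v <- s) `|v|%:E * \int[P]_w (\1_(g @^-1` [set v]) (Y w) * G w)%:E)%E.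
  under eq_integral => w _ do
    (rewrite gE mulr_suml -sumEFin; under eq_bigr do rewrite -mulrA EFinM).
  rewrite ge0_integral_sum//.
  - apply: eq_bigr => v _; rewrite ge0_integralZl//.
    + by apply/measurable_EFinP; exact: measurable_funM.
    + by move=> w _; rewrite lee_fin mulr_ge0// indicE.
  - move=> v; apply/measurable_EFinP; apply: measurable_funM => //.
    exact: measurable_funM.
  - by move=> v w _; rewrite -EFinM lee_fin !mulr_ge0// indicE.
have -> : (\int[P]_w (g (Y w))%:E =
    \sum_(v <- s) `|v|%:E * P (Y @^-1` (g @^-1` [set v])))%E.
  under eq_integral => w _ do
    (rewrite gE -sumEFin; under eq_bigr do rewrite EFinM).
  rewrite ge0_integral_sum//.
  - apply: eq_bigr => v _; rewrite ge0_integralZl//; last first.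
      exact/measurable_EFinP.
    by rewrite -integral_indicT//; exact: measurable_preimage.
  - move=> v; apply/measurable_EFinP; exact: measurable_funM.
rewrite ge0_sume_distrl.
  by apply: eq_bigr => v _; rewrite -muleA YG.
by move=> v _; rewrite mule_ge0.
Qed.

(** Simple functions, then monotone convergence. Finiteness of the integral of [G] allows
    multiplying the limit by it. *)
Lemma integral_mul_indic (f : R -> R) :
  measurable_fun [set: R] f -> (forall x, 0 <= f x) ->
  (\int[P]_w (f (Y w) * G w)%:E =
   \int[P]_w (f (Y w))%:E * \int[P]_w (G w)%:E)%E.
Proof.
move=> mf f_ge0; have mEf : measurable_fun [set: R] (EFin \o f).
  exact/measurable_EFinP.
pose g := nnsfun_approx measurableT mEf.
have g_cvg x : (g n x)%:E @[n --> \oo] --> (f x)%:E.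
  by apply: (cvg_nnsfun_approx measurableT mEf) => // y _; rewrite lee_fin.
have g_nd x m n : (m <= n)%N -> g m x <= g n x.
  by move=> mn; exact/lefP/nd_nnsfun_approx.
have mgY n : measurable_fun [set: T] (fun w => g n (Y w)).
  exact: measurableT_comp.
have cvg1 : (\int[P]_w (g n (Y w))%:E @[n --> \oo] -->
    \int[P]_w (f (Y w))%:E)%E.
  have -> : (\int[P]_w (f (Y w))%:E =
      \int[P]_w limn (fun n => (g n (Y w))%:E))%E.
    by apply: eq_integral => w _; apply/esym/cvg_lim.
  apply: cvg_monotone_convergence => //.
  - by move=> n; apply/measurable_EFinP.
  - by move=> n w _; rewrite lee_fin.
  - by move=> w _ m n mn; rewrite lee_fin; exact: g_nd.
have cvg2 : (\int[P]_w (g n (Y w) * G w)%:E @[n --> \oo] -->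
    \int[P]_w (f (Y w) * G w)%:E)%E.
  have -> : (\int[P]_w (f (Y w) * G w)%:E =
      \int[P]_w limn (fun n => (g n (Y w) * G w)%:E))%E.
    apply: eq_integral => w _; apply/esym/cvg_lim => //.
    rewrite EFinM; under eq_fun do rewrite EFinM.
    by apply: cvgeZr.
  apply: cvg_monotone_convergence => //.
  - by move=> n; apply/measurable_EFinP; exact: measurable_funM.
  - by move=> n w _; rewrite lee_fin mulr_ge0.
  - by move=> w _ m n mn; rewrite lee_fin ler_wpM2r//; exact: g_nd.
have cvg2' : (\int[P]_w (g n (Y w))%:E * \int[P]_w (G w)%:E @[n --> \oo] -->
    \int[P]_w (f (Y w) * G w)%:E)%E.
  by under eq_fun do rewrite -integral_mul_nnsfun.
by apply: (cvg_unique _ cvg2') => //; apply: cvgeZr.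
Qed.

End IndicatorsSuffice.

Context {I : choiceType}.
Variable X : I -> {RV P >-> R}.
Hypothesis X_indep : mutually_independent X.

Lemma integral_prod_indep (K : eqType) (idx : K -> I) (f : K -> R -> R)
    (s : seq K) :
  (forall l, measurable_fun [set: R] (f l)) -> (forall l x, 0 <= f l x) ->
  (forall l, (\int[P]_w (f l (X (idx l) w))%:E)%E \is a fin_num) ->
  uniq (map idx s) ->
  (\int[P]_w (\prod_(l <- s) f l (X (idx l) w))%:E =
   \prod_(l <- s) \int[P]_w (f l (X (idx l) w))%:E)%E.
Proof.
move=> mf f_ge0 f_fin.
pose ind (A : I -> set R) i w : R := \1_(A i) (X i w).
have mind A i : measurable (A i) -> measurable_fun [set: T] (ind A i).
  by move=> mA; exact: (measurableT_comp (measurable_indic mA)).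
have mfX l : measurable_fun [set: T] (fun w => f l (X (idx l) w)).
  exact: measurableT_comp.
(* The induction carries indicators at further indices [J], so that functions are released from
   indicators one at a time; the base case is the definition of independence. *)
suff claim (J : {fset I}) (A : I -> set R) : (forall i, measurable (A i)) ->
    {in s, forall l, idx l \notin J} -> uniq (map idx s) ->
    (\int[P]_w (\prod_(l <- s) f l (X (idx l) w) *
       \prod_(i <- J) ind A i w)%:E =
     (\prod_(l <- s) \int[P]_w (f l (X (idx l) w))%:E) *
     \prod_(i <- J) P (X i @^-1` A i))%E.
  move=> us; have := claim fset0 (fun=> setT) (fun=> measurableT).
  rewrite !big_seq_fset0 mule1 => <-//.
  by under [RHS]eq_integral do rewrite big_seq_fset0 mulr1.
elim: s J A => [|l s IH] J A mA sJ us.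
  rewrite big_nil mul1e -X_indep//; under eq_integral do rewrite big_nil mul1r.
  rewrite -integral_indicT//; last first.
    apply: fin_bigcap_measurable; first exact: finite_fset.
    by move=> i _; exact: measurable_preimage.
  apply: eq_integral => w _; congr EFin.
  rewrite indicE; case: (boolP (w \in _)) => [|] wA.
    rewrite big1_seq// => i /andP[_ iJ].
    by rewrite /ind indicE mem_set//; move/set_mem: wA; exact.
  have [i iJ wi] : exists2 i, i \in J & ~ A i (X i w).
    apply/not_exists2P => h; move/negP: wA; apply; rewrite inE => i iJ /=.
    by have [//|/contrapT] := h i.
  rewrite (big_fsetD1 i)//= /ind indicE memNset// mul0r//.
rewrite big_cons; pose G w := \prod_(l <- s) f l (X (idx l) w) *
  \prod_(i <- J) ind A i w.
have mG : measurable_fun [set: T] G.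
  apply: measurable_funM; apply: measurable_prod => // i _; exact: mind.
have G_ge0 w : 0 <= G w.
  by rewrite mulr_ge0// prodr_ge0// => i _; rewrite /ind indicE.
have /= /andP[ls us'] := us.
have sJ' : {in s, forall l, idx l \notin J}.
  by move=> k ks; apply: sJ; rewrite inE ks orbT.
under eq_integral do rewrite big_cons -mulrA -/(G _).
rewrite integral_mul_indic//; first by rewrite -muleA /G IH.
  rewrite /G IH// fin_numM//; first by rewrite prode_fin_num.
  by rewrite prode_fin_num// => i _; apply: fin_num_measure; exact: measurable_preimage.
(* The indicator of [B] at [idx l] joins [J], and the induction hypothesis applies once more. *)
move=> B mB; rewrite /G IH//.
pose A' i := if i == idx l then B else A i.
have mA' i : measurable (A' i) by rewrite /A'; case: ifP.
have lJ : idx l \notin J by apply: sJ; rewrite inE eqxx.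
have := IH (idx l |` J)%fset A' mA' _ us'.
rewrite !big_fsetU1//= {2}/A' eqxx => IH'.
transitivity (\int[P]_w (\prod_(l0 <- s) f l0 (X (idx l0) w) *
       \prod_(i <- (idx l |` J)%fset) ind A' i w)%:E)%E.
  apply: eq_integral => w _; rewrite /ind big_fsetU1//= [A' (idx l)]/A' eqxx mulrCA.
  congr (_ * (_ * _))%:E; apply: eq_big_seq => i iJ; rewrite /A'.
  by case: eqP => // il; move: lJ; rewrite -il iJ.
rewrite IH'; last first.
  move=> k ks; rewrite in_fset1U negb_or sJ'// andbT.
  by apply: contraNneq ls => <-; exact: map_f.
rewrite muleCA; congr (_ * (_ * _))%E; apply: eq_big_seq => i iJ.
by rewrite /A'; case: eqP => // il; move: lJ; rewrite -il iJ.
Qed.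

End Independence.

(** Both sides are integrals of [f] against the same image measure. *)
Lemma eq_integral_law (R : realType) (d1 d2 : measure_display)
    (U1 : measurableType d1) (U2 : measurableType d2)
    (Q1 : probability U1 R) (Q2 : probability U2 R)
    (Y1 : U1 -> R) (Y2 : U2 -> R) (f : R -> R) :
  measurable_fun [set: U1] Y1 -> measurable_fun [set: U2] Y2 ->
  (forall B : set R, measurable B -> Q1 (Y1 @^-1` B) = Q2 (Y2 @^-1` B)) ->
  measurable_fun [set: R] f -> (forall x, 0 <= f x) ->
  (\int[Q1]_w (f (Y1 w))%:E = \int[Q2]_w (f (Y2 w))%:E)%E.
Proof.
move=> m1 m2 eqY mf f_ge0.
pose X1 : {mfun U1 >-> R} := HB.pack Y1 (isMeasurableFun.Build _ _ _ _ _ m1).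
pose X2 : {mfun U2 >-> R} := HB.pack Y2 (isMeasurableFun.Build _ _ _ _ _ m2).
have mEf : measurable_fun [set: R] (EFin \o f) by exact/measurable_EFinP.
have Ef_ge0 x : (0 <= (EFin \o f) x)%E by rewrite lee_fin.
have /= <- := ge0_integral_distribution (X1 : {RV Q1 >-> R}) mEf Ef_ge0.
have /= <- := ge0_integral_distribution (X2 : {RV Q2 >-> R}) mEf Ef_ge0.
by apply: eq_measure_integral => B mB _; exact: eqY.
Qed.

Section Law.
Context {R : realType}.
Variable F : probability (measurableTypeR R) R.

Definition mgf (s : R) : \bar R := (\int[F]_x (expR (s * x))%:E)%E.

Hypothesis F_sym : symmetric_law F.

Lemma measurable_typeR (h : R -> R) : measurable_fun [set: R] h ->
  @measurable_fun _ _ (measurableTypeR R) R setT h.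
Proof. by move=> mh _ B mB; exact: (mh measurableT B mB). Qed.

Lemma symmetric_integral (f : R -> R) :
  measurable_fun [set: R] f -> (forall x, 0 <= f x) ->
  (\int[F]_x (f (- x))%:E = \int[F]_x (f x)%:E)%E.
Proof.
apply: (@eq_integral_law R _ _ _ _ F F -%R id).
- by apply: measurable_typeR; exact: oppr_measurable.
- exact: measurable_typeR.
- by move=> B mB; exact: F_sym.
Qed.

Lemma measurable_expRM (s : R) : measurable_fun [set: R] (fun x : R => expR (s * x)).
Proof. by apply: measurableT_comp => //; exact: measurable_funM. Qed.

Lemma mgfN s : mgf (- s) = mgf s.
Proof.
rewrite /mgf -[RHS]symmetric_integral//; last exact: measurable_expRM.
by apply: eq_integral => x _; rewrite mulrN mulNr.
Qed.

End Law.

(** * Expectations of the free and the reflected process *)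

Section Process.
Context {R : realType} {G : zmodType}.
Variables (S : seq G) (p : G -> R).
Hypothesis p_ge0 : forall s, 0 <= p s.
Hypothesis p_mass : \sum_(s <- S) p s = 1.
Variable F : probability (measurableTypeR R) R.
Hypothesis F_sym : symmetric_law F.
Context {dT : measure_display} {T : measurableType dT}.
Variables (P : probability T R) (eps : int -> G -> {RV P >-> R}).
Hypothesis eps_law : forall n i, has_law F (eps n i).
Hypothesis eps_indep : mutually_independent (fun ni : int * G => eps ni.1 ni.2).

Definition noise (w : T) (n : nat) (i : G) : R := eps n%:Z i w.

Lemma integral_law n i (f : R -> R) :
  measurable_fun [set: R] f -> (forall x, 0 <= f x) ->
  (\int[P]_w (f (eps n i w))%:E = \int[F]_x (f x)%:E)%E.
Proof.
apply: (@eq_integral_law R _ _ _ _ P F (eps n i) id).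
- exact: measurable_funP.
- exact: measurable_typeR.
- by move=> B mB; exact: eps_law.
Qed.

Lemma measurable_noise n i : measurable_fun [set: T] (fun w => noise w n i).
Proof. exact: measurable_funP. Qed.

Lemma measurable_step (f : T -> G -> R) i :
  (forall j, measurable_fun [set: T] (fun w => f w j)) ->
  measurable_fun [set: T] (fun w => step S p (f w) i).
Proof. by move=> mf; apply: measurable_sum => s; exact: measurable_funM. Qed.

Lemma measurable_reflected n i :
  measurable_fun [set: T] (fun w => reflected S p (noise w) n i).
Proof.
elim: n i => [|n IH] i //=; apply: measurable_maxr => //.
apply: measurable_funD; last exact: measurable_noise.
exact: measurable_step.
Qed.

Lemma measurable_free n i :
  measurable_fun [set: T] (fun w => free S p (noise w) n i).
Proof.
elim: n i => [|n IH] i //=.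
apply: measurable_funD; last exact: measurable_noise.
exact: measurable_step.
Qed.

Lemma measurable_expR_free lam n i :
  measurable_fun [set: T] (fun w => expR (lam * free S p (noise w) n i)).
Proof.
apply: measurableT_comp => //; apply: measurable_funM => //.
exact: measurable_free.
Qed.

Lemma measurable_dominating lam n i :
  measurable_fun [set: T] (fun w => dominating S p (noise w) lam n i).
Proof.
elim: n i => [|n IH] i //=; apply: measurable_funD; first exact: measurable_step.
by under eq_fun do rewrite -mulNr; exact: (measurable_expR_free (- lam) n.+1).
Qed.

Lemma integral_step (f : T -> G -> R) i :
  (forall j, measurable_fun [set: T] (fun w => f w j)) ->
  (forall w j, 0 <= f w j) ->
  (\int[P]_w (step S p (f w) i)%:E =
   \sum_(s <- S) (p s)%:E * \int[P]_w (f w (i + s))%:E)%E.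
Proof.
move=> mf f_ge0.
under eq_integral => w _ do (rewrite -sumEFin; under eq_bigr do rewrite EFinM).
rewrite ge0_integral_sum//.
- apply: eq_bigr => s _; rewrite ge0_integralZl//.
  + exact/measurable_EFinP.
  + by move=> w _; rewrite lee_fin.
  + by rewrite lee_fin.
- by move=> s; apply/measurable_EFinP; exact: measurable_funM.
- by move=> s w _; rewrite -EFinM lee_fin mulr_ge0.
Qed.

(** By [freeE] the exponential is a product of functions of noise variables at distinct space-time
    points. *)
Lemma integral_expR_free lam n i :
  (forall k j, mgf F (lam * heat S p k j) \is a fin_num) ->
  (\int[P]_w (expR (lam * free S p (noise w) n i))%:E =
   \prod_(k < n) \prod_(j <- reach S k) mgf F (lam * heat S p k j))%E.
Proof.
move=> fin.
pose L := [seq (k, j) | k <- index_iota 0 n, j <- reach S k].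
pose idx (l : nat * G) : int * G := ((n - l.1)%N%:Z, i + l.2).
pose f (l : nat * G) (x : R) := expR (lam * heat S p l.1 l.2 * x).
have fE l : (\int[P]_w (f l (eps (idx l).1 (idx l).2 w))%:E =
    mgf F (lam * heat S p l.1 l.2))%E.
  rewrite integral_law//; first exact: measurable_expRM.
  by move=> x; exact: expR_ge0.
have := @integral_prod_indep R dT T P _ _ eps_indep _ idx f L.
rewrite big_allpairs_dep => indep.
rewrite -(big_mkord xpredT (fun k => \prod_(j <- reach S k) mgf F (lam * heat S p k j)))%E.
under [RHS]eq_bigr do under eq_bigr do rewrite -[mgf _ _](fE (_, _)).
rewrite -indep.
- apply: eq_integral => w _; rewrite freeE big_allpairs_dep mulr_sumr expR_sum.
  rewrite big_mkord; congr EFin.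
  apply: eq_bigr => k _; rewrite mulr_sumr expR_sum; apply: eq_bigr => j _.
  by rewrite /f mulrA.
- by move=> l; exact: measurable_expRM.
- by move=> l x; exact: expR_ge0.
- by move=> l; rewrite fE.
- have uL : uniq L.
    apply: (@allpairs_uniq_dep _ (fun=> G)); first exact: iota_uniq.
      by move=> k _; exact: reach_uniq.
    by move=> [k j] [k' j'] _ _ /= [-> ->].
  (* The truncated subtraction [n - k] is injective here only because [k < n]. *)
  rewrite map_inj_in_uniq// => -[k j] [k' j'].
  move=> /allpairsPdep[? [? [kn _ [-> ->]]]] /allpairsPdep[? [? [kn' _ [-> ->]]]].
  move: kn kn'; rewrite !mem_index_iota /= => kn kn' [kk' /addrI ->].
  by congr pair; rewrite -(subKn (ltnW kn)) kk' subKn// ltnW.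
Qed.

Lemma integral_dominating_le lam E n i :
  (forall m j, (m <= n)%N ->
    \int[P]_w (expR (- (lam * free S p (noise w) m j)))%:E <= E%:E)%E ->
  (\int[P]_w (dominating S p (noise w) lam n i)%:E <= (1 + n%:R * E)%:E)%E.
Proof.
elim: n i => [|n IH] i hE.
  by rewrite /= mul0r addr0 (integral_cst_prob P).
have m1 := measurable_step _ i (measurable_dominating lam n).
have m2 : measurable_fun [set: T] (fun w => expR (- (lam * free S p (noise w) n.+1 i))).
  by under eq_fun do rewrite -mulNr; exact: measurable_expR_free.
under eq_integral do rewrite [dominating _ _ _ _ _ _]/= EFinD.
rewrite ge0_integralD//; last 3 first.
- by move=> w _; rewrite lee_fin step_ge0// => j; exact: dominating_ge0.
- exact/measurable_EFinP.
- exact/measurable_EFinP.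
have -> : 1 + n.+1%:R * E = (1 + n%:R * E) + E by rewrite -natr1; ring.
set B := 1 + n%:R * E; rewrite EFinD; apply: leeD; last exact: (hE n.+1 i).
rewrite integral_step//.
- rewrite -[B%:E]mul1e -p_mass -sumEFin ge0_sume_distrl.
    apply: lee_sum => s _; apply: lee_wpmul2l; first by rewrite lee_fin.
    by apply: IH => m j mn; apply: hE; exact: leqW.
  by move=> s _; rewrite lee_fin.
- exact: measurable_dominating.
- by move=> w j; exact: dominating_ge0.
Qed.

Lemma integral_reflected_le lam Lam n i : 0 < lam ->
  (forall m j, (m <= n)%N ->
    \int[P]_w (expR (lam * free S p (noise w) m j))%:E <= (expR Lam)%:E)%E ->
  (forall m j, (m <= n)%N ->
    \int[P]_w (expR (- (lam * free S p (noise w) m j)))%:E <= (expR Lam)%:E)%E ->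
  (\int[P]_w (reflected S p (noise w) n i)%:E <=
   (lam^-1 * (2 * (Lam + ln n.+2%:R) + 1))%:E)%E.
Proof.
(* With this [L] the exponential terms, at most [expR Lam + 1 + n * expR Lam] in mean, are reduced
   to at most 1. *)
move=> lam0 h1 h2; set L := Lam + ln _.
have mR := measurable_reflected n i; have mD := measurable_dominating lam n i.
have mH := measurable_expR_free lam n i.
(* At time 0 the free process is 0, and its exponential moment 1 forces [Lam >= 0]. *)
have [Lam0|Lam0] := leP 0 Lam; last first.
  have := h1 0%N i isT; rewrite /= mulr0 expR0 (integral_cst_prob P).
  by rewrite lee_fin leNgt -{1}expR0 ltr_expR Lam0.
have L0 : 0 <= L by rewrite addr_ge0// ln_ge0// ler1n.
apply: (@le_trans _ _ (\int[P]_w ((lam^-1)%:E * ((2 * L)%:E + (expR (- L))%:E *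
    ((expR (lam * free S p (noise w) n i))%:E +
     (dominating S p (noise w) lam n i)%:E)))%E)%E).
  apply: ge0_le_integral => //.
  - by move=> w _; rewrite lee_fin reflected_ge0.
  - exact/measurable_EFinP.
  - apply: measurable_funeM; apply: emeasurable_funD => //.
    apply: measurable_funeM; apply: emeasurable_funD; exact/measurable_EFinP.
  - by move=> w _; rewrite -!(EFinD, EFinM) lee_fin; exact: reflected_le.
have dom0 w : (0 <= (dominating S p (noise w) lam n i)%:E)%E.
  by rewrite lee_fin dominating_ge0.
have exp0 w : (0 <= (expR (lam * free S p (noise w) n i))%:E)%E.
  by rewrite lee_fin expR_ge0.
rewrite ge0_integralZl//; last 3 first.
- apply: emeasurable_funD => //.
  by apply: measurable_funeM; apply: emeasurable_funD; exact/measurable_EFinP.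
- move=> w _; rewrite adde_ge0 ?mule_ge0 ?adde_ge0 ?lee_fin ?mulr_ge0 ?expR_ge0//.
  by rewrite dominating_ge0.
- by rewrite lee_fin invr_ge0 ltW.
rewrite [leRHS]EFinM; apply: lee_wpmul2l; first by rewrite lee_fin invr_ge0 ltW.
rewrite ge0_integralD//; last 3 first.
- by move=> w _; rewrite lee_fin mulr_ge0.
- by move=> w _; rewrite mule_ge0 ?adde_ge0 ?lee_fin ?expR_ge0 ?dominating_ge0.
- by apply: measurable_funeM; apply: emeasurable_funD; exact/measurable_EFinP.
rewrite (integral_cst_prob P) EFinD leeD2l//.
rewrite ge0_integralZl//; last 2 first.
- by apply: emeasurable_funD; exact/measurable_EFinP.
- by move=> w _; rewrite adde_ge0.
rewrite ge0_integralD//; last 2 first.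
- exact/measurable_EFinP.
- exact/measurable_EFinP.
apply: (@le_trans _ _ ((expR (- L))%:E * ((expR Lam)%:E + (1 + n%:R * expR Lam)%:E))%E).
  rewrite lee_wpmul2l ?lee_fin ?expR_ge0// leeD ?h1//.
  exact: integral_dominating_le.
rewrite -EFinD -EFinM lee_fin /L opprD expRD expRN (expRN (ln _)) lnK ?posrE//.
have e1 : 1 <= expR Lam by rewrite -expR0 ler_expR.
have e0 : 0 < expR Lam by exact: expR_gt0.
rewrite -mulrA mulrCA mulrC ler_pdivrMr// mul1r mulrC ler_pdivrMr//.
by rewrite -!natr1; nra.
Qed.

(** The expectation of [reflected_ge], first with all subtracted terms moved to the other side,
    since the mean of [reflected] could be infinite here. *)
Lemma integral_reflected_ge lam eta a b n i : 0 < lam -> 0 < eta <= 2^-1 ->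
  (a%:E <= \int[P]_w (expR (lam * free S p (noise w) n i))%:E)%E ->
  (\int[P]_w (expR (2 * lam * free S p (noise w) n i))%:E <= b%:E)%E ->
  ((eta / lam * ((a - 1) - eta * (b - 1)))%:E <=
   \int[P]_w (reflected S p (noise w) n i)%:E)%E.
Proof.
move=> lam0 eta02 ha hb; have /andP[eta0 eta2] := eta02.
pose c := eta / lam; have c0 : 0 < c by rewrite divr_gt0.
have mR := measurable_reflected n i.
have m1 := measurable_expR_free lam n i; have m2 := measurable_expR_free (2 * lam) n i.
have key : (c%:E * \int[P]_w (expR (lam * free S p (noise w) n i))%:E <=
    \int[P]_w (reflected S p (noise w) n i)%:E +
    (c * eta)%:E * \int[P]_w (expR (2 * lam * free S p (noise w) n i))%:E +
    (c * (1 - eta))%:E)%E.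
  have ce0 : (0 <= (c * eta)%:E)%E by rewrite lee_fin mulr_ge0// ltW.
  have ce1 : (0 <= (c * (1 - eta))%:E)%E by rewrite lee_fin; apply: mulr_ge0; lra.
  have ce2 : (0 <= c%:E)%E by rewrite lee_fin ltW.
  have x0 (s : R) w : (0 <= (expR (s * free S p (noise w) n i))%:E)%E.
    by rewrite lee_fin expR_ge0.
  have r0 w : (0 <= (reflected S p (noise w) n i)%:E)%E.
    by rewrite lee_fin reflected_ge0.
  have M1 := (measurable_EFinP _ _).2 m1; have M2 := (measurable_EFinP _ _).2 m2.
  have MR := (measurable_EFinP _ _).2 mR.
  have M3 := measurable_funeM (c * eta)%:E M2.
  rewrite -[X in (_ <= _ + X)%E](integral_cst_prob P) -!ge0_integralZl//.
  rewrite -ge0_integralD//; last by move=> w _; rewrite mule_ge0.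
  rewrite -ge0_integralD//; last 2 first.
  - by move=> w _; rewrite adde_ge0 ?mule_ge0.
  - exact: emeasurable_funD.
  apply: ge0_le_integral => //.
  - by move=> w _; rewrite mule_ge0.
  - exact: measurable_funeM.
  - by apply: emeasurable_funD => //; exact: emeasurable_funD.
  - move=> w _; rewrite -!(EFinD, EFinM) lee_fin.
    have := reflected_ge S p p_ge0 (noise w) lam eta n i lam0 eta02.
    by rewrite -/c; lra.
have {key} : ((c * a)%:E <= \int[P]_w (reflected S p (noise w) n i)%:E +
    (c * eta * b)%:E + (c * (1 - eta))%:E)%E.
  apply: (le_trans _ (le_trans key _)).
    by rewrite EFinM lee_wpmul2l// lee_fin ltW.
  apply/leeD2r/leeD2l; rewrite [leRHS]EFinM; apply: lee_wpmul2l => //.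
  by rewrite lee_fin; apply: mulr_ge0; exact: ltW.
rewrite -/c; case: (\int[P]_w _)%E => [r| |]; rewrite ?leey//.
by rewrite -!EFinD !lee_fin; lra.
Qed.

Lemma prode_EFin_le (I : Type) (r : seq I) (Q : pred I) (x : I -> \bar R) (y : I -> R) :
  (forall i, (0 <= x i <= (y i)%:E)%E) ->
  (0 <= \prod_(i <- r | Q i) x i <= (\prod_(i <- r | Q i) y i)%:E)%E.
Proof.
move=> xy; elim: r => [|i r IH]; first by rewrite !big_nil lee01 lexx.
rewrite !big_cons; case: ifP => // _; have /andP[h1 h2] := xy i; have /andP[h3 h4] := IH.
by rewrite mule_ge0//= EFinM lee_pmul.
Qed.

Lemma prode_EFin_ge (I : Type) (r : seq I) (Q : pred I) (x : I -> \bar R) (y : I -> R) :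
  (forall i, 0 <= y i) -> (forall i, ((y i)%:E <= x i)%E) ->
  ((\prod_(i <- r | Q i) y i)%:E <= \prod_(i <- r | Q i) x i)%E.
Proof.
move=> y0 xy; elim: r => [|i r IH]; first by rewrite !big_nil lexx.
rewrite !big_cons; case: ifP => // _; rewrite EFinM lee_pmul ?lee_fin//.
exact: prodr_ge0.
Qed.

Lemma mgf_ge0 s : (0 <= mgf F s)%E.
Proof. by apply: integral_ge0 => x _; rewrite lee_fin expR_ge0. Qed.

Lemma integral_expR_free_le lam (psi : nat -> G -> R) n i :
  (forall k j, (mgf F (lam * heat S p k j) <= (expR (psi k j))%:E)%E) ->
  (\int[P]_w (expR (lam * free S p (noise w) n i))%:E <=
   (expR (\sum_(k < n) \sum_(j <- reach S k) psi k j))%:E)%E.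
Proof.
move=> h; rewrite integral_expR_free => [|k j]; last first.
  by rewrite ge0_fin_numE ?mgf_ge0// (le_lt_trans (h k j))// ltry.
rewrite expR_sum.
have := prode_EFin_le _ (index_enum 'I_n) xpredT
  (fun k => \prod_(j <- reach S k) mgf F (lam * heat S p k j))%E
  (fun k => expR (\sum_(j <- reach S k) psi k j)).
move=> /(_ _)/andP[]// k; rewrite expR_sum; apply: prode_EFin_le => j.
by rewrite mgf_ge0 h.
Qed.

Lemma integral_expR_free_ge lam (psi : nat -> G -> R) n i :
  (forall k j, mgf F (lam * heat S p k j) \is a fin_num) ->
  (forall k j, ((expR (psi k j))%:E <= mgf F (lam * heat S p k j))%E) ->
  ((expR (\sum_(k < n) \sum_(j <- reach S k) psi k j))%:E <=
   \int[P]_w (expR (lam * free S p (noise w) n i))%:E)%E.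
Proof.
move=> fin h; rewrite integral_expR_free// expR_sum.
apply: prode_EFin_ge => [k|k]; first exact: expR_ge0.
by rewrite expR_sum; apply: prode_EFin_ge => j; first exact: expR_ge0.
Qed.

(** * Lower bound from exceptionally large noise *)

Section LargeNoise.
Variable L : R.
Hypothesis L_gt0 : 0 < L.

Let kept : R -> R := \1_(`[(- L), +oo[%classic : set R).
Let large : R -> R := \1_(`]L, +oo[%classic : set R).
(** The difference [gain e - gain (- e)] is [e] cut off to [|e| <= L]. *)
Let gain (e : R) : R := e * \1_(`[0, L]%classic : set R) e.

Let mkept : measurable_fun [set: R] kept.
Proof. exact: measurable_indic (measurable_itv _). Qed.

Let mlarge : measurable_fun [set: R] large.
Proof. exact: measurable_indic (measurable_itv _). Qed.

Let mgain : measurable_fun [set: R] gain.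
Proof. by apply: measurable_funM => //; exact: measurable_indic (measurable_itv _). Qed.

Let gain_ge0 e : 0 <= gain e.
Proof.
rewrite /gain indicE mem_setE in_itv /=.
by case: (leP 0 e) => /= e0; rewrite ?mulr0// mulr_ge0.
Qed.

(* [gain] enters on both sides because its two terms have the same, finite, integral by
   symmetry; this avoids integrals of signed functions. *)
Let reflection_ge (x e : R) : 0 <= x ->
  x * kept e + L * large e + gain e <= Num.max (x + e) 0 + gain (- e).
Proof.
move=> x0; have := L_gt0.
rewrite /gain /kept /large !indicE !mem_setE !in_itv /= !andbT.
have M1 : x + e <= Num.max (x + e) 0 by rewrite le_max lexx.
have M2 : 0 <= Num.max (x + e) 0 by rewrite le_max lexx orbT.
move: (Num.max _ _) M1 M2 => M M1 M2.
case: (leP (- L) e); case: (ltP L e); case: (leP 0 e); case: (leP 0 (- e));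
  rewrite /=; try lra; case: (leP e L); case: (leP (- e) L); rewrite /=; lra.
Qed.

Lemma integral_indep_cons (h : R -> R) (A : int * G -> set R)
    (x0 : int * G) (s : seq (int * G)) :
  measurable_fun [set: R] h -> (forall x, 0 <= h x) ->
  (\int[F]_x (h x)%:E)%E \is a fin_num ->
  (forall x, measurable (A x)) -> uniq (x0 :: s) ->
  (\int[P]_w (h (eps x0.1 x0.2 w) *
     \prod_(x <- s) \1_(A x) (eps x.1 x.2 w))%:E =
   (\int[F]_x (h x)%:E) * \prod_(x <- s) F (A x))%E.
Proof.
move=> mh h0 hfin mA us; have /andP[x0s us'] := us.
pose f (x : int * G) : R -> R := if x == x0 then h else \1_(A x).
have mf x : measurable_fun [set: R] (f x).
  by rewrite /f; case: eqP => // _; exact: measurable_indic.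
have f0 x y : 0 <= f x y by rewrite /f; case: eqP => // _; rewrite indicE.
have fE x : (\int[P]_w (f x (eps x.1 x.2 w))%:E = \int[F]_y (f x y)%:E)%E.
  exact: integral_law.
have indF x : (\int[F]_y (\1_(A x) y)%:E = F (A x))%E.
  by rewrite integral_indic ?setIT//; exact: mA.
have hE : (\int[F]_y (f x0 y)%:E = \int[F]_y (h y)%:E)%E.
  by apply: eq_integral => y _; rewrite /f eqxx.
have sE x : x \in s -> f x = \1_(A x).
  by move=> xs; rewrite /f; case: eqP => // xx0; move: x0s; rewrite -xx0 xs.
have fin x : (\int[P]_w (f x (eps x.1 x.2 w))%:E)%E \is a fin_num.
  rewrite fE; have [->|xx0] := eqVneq x x0; first by rewrite hE.
  have -> : f x = \1_(A x) by rewrite /f (negPf xx0).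
  by rewrite indF; apply: fin_num_measure; exact: mA.
have := @integral_prod_indep R dT T P _ _ eps_indep _ id f (x0 :: s) mf f0 fin.
rewrite map_id => /(_ us); rewrite big_cons fE hE => indep.
transitivity (\int[P]_w (\prod_(x <- x0 :: s) f x (eps x.1 x.2 w))%:E)%E.
  apply: eq_integral => w _; rewrite big_cons {1}/f eqxx; congr (_ * _)%:E.
  by apply: eq_big_seq => x xs; rewrite sE.
by rewrite indep; congr (_ * _)%E; apply: eq_big_seq => x xs; rewrite fE sE.
Qed.

Let q : R := fine (tail F L).

Let qE : F (`]L, +oo[%classic : set R) = q%:E.
Proof.
rewrite /q /tail set_itvoy fineK//; apply: fin_num_measure.
by rewrite -set_itvoy; exact: (measurable_itv `]L, +oo[).
Qed.

(** By symmetry the excluded event [e < - L] has probability [q]. *)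
Let keptE : F (`[(- L), +oo[%classic : set R) = (1 - q)%:E.
Proof.
have mI : measurable (`]-oo, (- L)[%classic : set R) by exact: measurable_itv.
have -> : `[(- L), +oo[%classic = ~` (`]-oo, (- L)[%classic : set R).
  by rewrite setCitvl.
rewrite probability_setC; last exact: mI.
rewrite -(F_sym _ mI) EFinB -qE; congr (_ - F _)%E.
by apply/seteqP; split=> x /=; rewrite !in_itv /= andbT ltrN2.
Qed.

Let gain_fin : (\int[F]_x (gain x)%:E)%E \is a fin_num.
Proof.
rewrite ge0_fin_numE; last by apply: integral_ge0 => x _; rewrite lee_fin.
apply: (@le_lt_trans _ _ (\int[F]_x (cst L%:E x))%E); last first.
  by rewrite integral_cst//= probability_setT mule1 ltry.
apply: ge0_le_integral => //.
- by move=> x _; rewrite lee_fin.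
- by apply/measurable_EFinP; exact: measurable_typeR.
- move=> x _; rewrite lee_fin /gain indicE mem_setE in_itv /=.
  by case: (boolP (0 <= x <= L)) => [/andP[_ xL]|_]; rewrite ?mulr1// mulr0 ltW.
Qed.

(** The solution of [z (m + 1) = (1 - q) * z m + L * q] with [z 0 = 0]: either the height survives
    the step, or it is replenished by [L]. *)
Let z (m : nat) : R := L * (1 - (1 - q) ^+ m).

(* The indicators of later noise variables make the induction go through: the factor
   [kept] of one step becomes an additional indicator for the previous one. *)
Let reflected_indep_ge m i (s : seq (int * G)) (A : int * G -> set R) :
  (forall x, measurable (A x)) -> uniq s ->
  (forall x, x \in s -> m%:Z < x.1) ->
  ((z m)%:E * \prod_(x <- s) F (A x) <=
   \int[P]_w (reflected S p (noise w) m i *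
     \prod_(x <- s) \1_(A x) (eps x.1 x.2 w))%:E)%E.
Proof.
elim: m i s A => [|m IH] i s A mA us ts.
  rewrite /z expr0 subrr mulr0 mul0e; apply: integral_ge0 => w _.
  by rewrite lee_fin mulr_ge0// prodr_ge0// => x _; rewrite indicE.
pose x0 : int * G := (m.+1%:Z, i).
have us0 : uniq (x0 :: s).
  by rewrite /= us andbT; apply/negP => /ts; rewrite ltxx.
pose I w : R := \prod_(x <- s) \1_(A x) (eps x.1 x.2 w).
have I0 w : 0 <= I w by rewrite prodr_ge0// => x _; rewrite indicE.
have mI : measurable_fun [set: T] I.
  apply: measurable_prod => x _.
  exact: (measurableT_comp (measurable_indic (mA x)) (measurable_funP (eps x.1 x.2))).
pose g := (\prod_(x <- s) F (A x))%E.
have g0 : (0 <= g)%E by apply: prode_ge0.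
have gfin : g \is a fin_num.
  by apply: prode_fin_num => x _; apply: fin_num_measure; exact: mA.
pose e w := noise w m.+1 i.
pose st w := step S p (reflected S p (noise w) m) i.
have st0 w : 0 <= st w by apply: step_ge0 => // j; exact: reflected_ge0.
have me : measurable_fun [set: T] e by exact: measurable_noise.
have mst : measurable_fun [set: T] st.
  by apply: measurable_step => j; exact: measurable_reflected.
have mcomp (h : R -> R) : measurable_fun [set: R] h -> measurable_fun [set: T] (fun w => h (e w)).
  by move=> mh; exact: measurableT_comp mh me.
have mgainN : measurable_fun [set: R] (fun x => gain (- x)).
  by apply: measurableT_comp => //; exact: oppr_measurable.
have gainN : (\int[F]_x (gain (- x))%:E = \int[F]_x (gain x)%:E)%E.
  exact: symmetric_integral.
set N := (\int[F]_x (gain x)%:E)%E in gainN.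
have E1 : (\int[P]_w (gain (- e w) * I w)%:E = N * g)%E.
  rewrite -gainN; apply: (integral_indep_cons (fun x => gain (- x)) A x0) => //.
  by rewrite gainN.
have E2 : (\int[P]_w (gain (e w) * I w)%:E = N * g)%E.
  exact: (integral_indep_cons gain A x0).
have indF (B : set R) : measurable B -> (\int[F]_y (\1_B y)%:E = F B)%E.
  by move=> mB; rewrite integral_indic ?setIT.
have E3 : (\int[P]_w (large (e w) * I w)%:E = q%:E * g)%E.
  rewrite -qE -indF; last exact: measurable_itv.
  apply: (integral_indep_cons large A x0) => //.
  by rewrite indF ?qE//; exact: measurable_itv.
(* The induction hypothesis is used at every site [j], with [kept] as the indicator at the new point
   [x0]. *)
have E4 : ((z m * (1 - q))%:E * g <= \int[P]_w (st w * (kept (e w) * I w))%:E)%E.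
  pose A' x := if x == x0 then `[(- L), +oo[%classic : set R else A x.
  have mA' x : measurable (A' x).
    by rewrite /A'; case: eqP => // _; exact: measurable_itv.
  have sA' x : x \in s -> A' x = A x.
    move=> xs; rewrite /A'; case: eqP => // xx0.
    by move: us0; rewrite /= -xx0 xs.
  have step1 j : ((z m)%:E * ((1 - q)%:E * g) <=
      \int[P]_w (reflected S p (noise w) m j * (kept (e w) * I w))%:E)%E.
    have ts' x : x \in x0 :: s -> m%:Z < x.1.
      rewrite inE => /orP[/eqP->|/ts]; first by rewrite ltz_nat.
      by apply: lt_trans; rewrite ltz_nat.
    have := IH j (x0 :: s) A' mA' us0 ts'.
    rewrite big_cons {1}/A' eqxx keptE (eq_big_seq (fun x => F (A x))); last first.
      by move=> x xs; rewrite sA'.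
    move=> h; apply: le_trans h _; rewrite le_eqVlt; apply/orP; left; apply/eqP.
    apply: eq_integral => w _; rewrite big_cons {1}/A' eqxx.
    congr (_ * (_ * _))%:E; apply: eq_big_seq => x xs; by rewrite sA'.
  have -> : (\int[P]_w (st w * (kept (e w) * I w))%:E =
      \int[P]_w (step S p (fun j => reflected S p (noise w) m j * (kept (e w) * I w)) i)%:E)%E.
    apply: eq_integral => w _; rewrite /st /step mulr_suml.
    by congr EFin; apply: eq_bigr => s' _; rewrite -mulrA.
  rewrite integral_step; last 2 first.
  - move=> j; apply: measurable_funM; first exact: measurable_reflected.
    by apply: measurable_funM => //; exact: mcomp.
  - by move=> w j; rewrite !mulr_ge0 ?reflected_ge0// /kept indicE.
  rewrite EFinM -muleA -[leLHS]mul1e -[1%E in leLHS]/(1%:E) -{1}p_mass -sumEFin.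
  rewrite ge0_sume_distrl; last by move=> s' _; rewrite lee_fin.
  by apply: lee_sum => s' _; apply: lee_wpmul2l; rewrite ?lee_fin.
have kept0 w : 0 <= kept (e w) by rewrite /kept indicE.
have large0 w : 0 <= large (e w) by rewrite /large indicE.
have key : (\int[P]_w (st w * (kept (e w) * I w))%:E +
    L%:E * \int[P]_w (large (e w) * I w)%:E + \int[P]_w (gain (e w) * I w)%:E <=
    \int[P]_w (reflected S p (noise w) m.+1 i * I w)%:E +
    \int[P]_w (gain (- e w) * I w)%:E)%E.
  have a1 w : (0 <= (st w * (kept (e w) * I w))%:E)%E by rewrite lee_fin !mulr_ge0.
  have a2 w : (0 <= (large (e w) * I w)%:E)%E by rewrite lee_fin !mulr_ge0.
  have a3 (x : R) w : (0 <= (gain x * I w)%:E)%E.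
    by rewrite lee_fin; apply: mulr_ge0.
  have a4 w : (0 <= (reflected S p (noise w) m.+1 i * I w)%:E)%E.
    by rewrite lee_fin mulr_ge0// reflected_ge0.
  have L0 : (0 <= L%:E)%E by rewrite lee_fin ltW.
  have b1 : measurable_fun [set: T] (fun w => (st w * (kept (e w) * I w))%:E).
    apply/measurable_EFinP; apply: measurable_funM => //.
    by apply: measurable_funM => //; exact: mcomp.
  have b2 : measurable_fun [set: T] (fun w => (large (e w) * I w)%:E).
    by apply/measurable_EFinP; apply: measurable_funM => //; exact: mcomp.
  have b3 : measurable_fun [set: T] (fun w => (gain (e w) * I w)%:E).
    by apply/measurable_EFinP; apply: measurable_funM => //; exact: mcomp.
  have b4 : measurable_fun [set: T] (fun w => (gain (- e w) * I w)%:E).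
    apply/measurable_EFinP; apply: measurable_funM => //.
    exact: (mcomp (fun x => gain (- x))).
  have b5 : measurable_fun [set: T] (fun w => (reflected S p (noise w) m.+1 i * I w)%:E).
    by apply/measurable_EFinP; apply: measurable_funM => //; exact: measurable_reflected.
  have b6 := measurable_funeM L%:E b2.
  rewrite -ge0_integralZl// -ge0_integralD//; last by move=> w _; rewrite mule_ge0.
  rewrite -ge0_integralD//; last 2 first.
  - by move=> w _; rewrite adde_ge0// mule_ge0.
  - exact: emeasurable_funD.
  rewrite -ge0_integralD//; apply: ge0_le_integral => //.
  - by move=> w _; rewrite !adde_ge0// mule_ge0.
  - by apply: emeasurable_funD => //; exact: emeasurable_funD.
  - exact: emeasurable_funD.
  - move=> w _; rewrite -!(EFinD, EFinM) lee_fin.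
    have := ler_wpM2r (I0 w) (reflection_ge (st w) (e w) (st0 w)).
    by rewrite [reflected _ _ _ _ _]/= -/(st w) -/(e w); lra.
(* The gain terms on both sides have the same finite mean and cancel, which leaves the recursion of
   [z]. *)
have Nfin : (N * g)%E \is a fin_num by rewrite fin_numM.
rewrite -/g -(leeD2rE _ _ Nfin) -{2}E1; apply: le_trans key.
rewrite E2 E3 leeD2r//.
have -> : ((z m.+1)%:E * g = (z m * (1 - q))%:E * g + L%:E * (q%:E * g))%E.
  by rewrite -(fineK gfin) -!EFinM -EFinD; congr EFin; rewrite /z exprS; ring.
exact: leeD2r.
Qed.

Lemma integral_reflected_ge_large m i :
  ((L * (1 - (1 - fine (tail F L)) ^+ m))%:E <=
   \int[P]_w (reflected S p (noise w) m i)%:E)%E.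
Proof.
have := reflected_indep_ge m i [::] (fun=> setT) (fun=> measurableT) isT.
move=> /(_ (fun x xs => False_ind _ (notF xs))); rewrite big_nil mule1 => h.
apply: le_trans h _; rewrite le_eqVlt; apply/orP; left; apply/eqP.
by apply: eq_integral => w _; rewrite big_nil mulr1.
Qed.

End LargeNoise.

End Process.

(** * Moment generating function of the noise *)

Section TailMoment.
Context {R : realType}.
Variable F : probability (measurableTypeR R) R.

Lemma typeR_EFin (f : R -> R) : measurable_fun [set: R] f ->
  measurable_fun [set: measurableTypeR R] (fun x : measurableTypeR R => (f x)%:E).
Proof. by move=> mf; apply/measurable_EFinP; exact: measurable_typeR. Qed.

Lemma ge0_integral_le (f g : R -> R) :
  measurable_fun [set: R] f -> measurable_fun [set: R] g ->
  (forall x, 0 <= f x <= g x) ->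
  (\int[F]_x (f x)%:E <= \int[F]_x (g x)%:E)%E.
Proof.
move=> mf mg fg; apply: ge0_le_integral => //.
- by move=> x _; rewrite lee_fin; case/andP: (fg x).
- exact: typeR_EFin.
- exact: typeR_EFin.
- by move=> x _; rewrite lee_fin; case/andP: (fg x).
Qed.

Lemma measurable_affine (a b : R) (f : R -> R) : measurable_fun [set: R] f ->
  measurable_fun [set: R] (fun x => a + b * f x).
Proof.
move=> mf; apply: measurable_funD; first exact: measurable_cst.
by apply: measurable_funM mf; exact: measurable_cst.
Qed.

Lemma integral_affine (a b : R) (f : R -> R) :
  measurable_fun [set: R] f -> (forall x, 0 <= f x) -> 0 <= a -> 0 <= b ->
  (\int[F]_x (a + b * f x)%:E = a%:E + b%:E * \int[F]_x (f x)%:E)%E.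
Proof.
move=> mf f0 a0 b0; rewrite -[X in _ = (X + _)%E](integral_cst_prob F).
rewrite -ge0_integralZl//; first last.
- by move=> x _; rewrite lee_fin.
- exact: typeR_EFin.
rewrite -ge0_integralD//; last 2 first.
- by move=> x _; rewrite -EFinM lee_fin mulr_ge0.
- by apply: measurable_funeM; exact: typeR_EFin.
Qed.

(** Pointwise, [Y] is at most the number of naturals [m] with [m <= Y]. *)
Lemma integral_le_level_series (Y : R -> R) :
  measurable_fun [set: R] Y -> (forall x, 0 <= Y x) ->
  (\int[F]_x (Y x)%:E <= \sum_(m <oo) F [set x | m%:R <= Y x]%R)%E.
Proof.
move=> mY Y0.
have mL (m : nat) : measurable ([set x | m%:R <= Y x] : set R).
  rewrite -[X in measurable X]setTI; have := mY measurableT `[m%:R, +oo[%classic.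
  move=> /(_ (measurable_itv _)); congr (measurable (_ `&` _)).
  by apply/seteqP; split=> x /=; rewrite in_itv /= andbT.
have -> : (\sum_(m <oo) F [set x | m%:R <= Y x]%R =
    \int[F]_x \sum_(m <oo) (\1_([set x | m%:R <= Y x] : set R) x)%:E)%E.
  have m1 (m : nat) : measurable_fun [set: measurableTypeR R]
      (fun x : measurableTypeR R => (\1_([set x | m%:R <= Y x] : set R) x : R)%:E).
    by apply: typeR_EFin; exact: measurable_indic.
  rewrite integral_nneseries//.
  by apply: eq_eseriesr => m _; rewrite integral_indic ?setIT//; exact: mL.
apply: ge0_le_integral => //.
- by move=> x _; rewrite lee_fin.
- exact: typeR_EFin.
- apply: ge0_emeasurable_sum => m *; first by rewrite lee_fin indicE.
  by apply: typeR_EFin; exact: measurable_indic.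
move=> x _; apply: le_trans (nneseries_lim_ge (Num.truncn (Y x)).+1 _); last first.
  by move=> m _ _; rewrite lee_fin indicE.
have /andP[t1 t2] := truncn_itv (Y0 x).
rewrite sumEFin lee_fin; apply/ltW/(lt_le_trans t2).
set N := (Num.truncn (Y x)).+1 in t2 *.
have -> : N%:R = \sum_(0 <= i < N) 1 :> R by rewrite sumr_const_nat subn0.
apply: ler_sum_nat => m /andP[_ mt]; rewrite indicE mem_set//=.
by apply: le_trans t1; rewrite ler_nat -ltnS.
Qed.

Hypothesis F_sym : symmetric_law F.

Lemma two_sided_tail (t : R) : (F [set x | t < `|x|]%R <= tail F t + tail F t)%E.
Proof.
have mA : measurable ([set x | t < x] : set R).
  by rewrite -set_itvoy; exact: (measurable_itv `]t, +oo[).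
have mA' : measurable ((fun x : R => - x) @^-1` ([set x | t < x] : set R)).
  have := @oppr_measurable R setT measurableT _ mA; by rewrite setTI.
have e : [set x : R | t < `|x|] =
    [set x | t < x] `|` (fun x : R => - x) @^-1` [set x | t < x].
  apply/seteqP; split=> x /=; rewrite ltr_normr.
    by case/orP => ?; [left|right].
  by case=> ->; rewrite ?orbT.
rewrite e; apply: le_trans (measureU2 _ _ _) _; [exact: mA|exact: mA'|].
apply: leeD; first exact: lexx.
by rewrite /tail -(F_sym _ mA); exact: lexx.
Qed.

Lemma tail_moment alpha : 0 < alpha -> tail_class_minus alpha F ->
  exists delta K : R, [/\ 0 < delta, 1 <= K &
    (\int[F]_x (expR (delta * `|x| `^ alpha))%:E <= K%:E)%E].
Proof.
move=> alpha0 [c [c' [c0 c'0 hc]]].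
pose delta := c' / 2; have delta0 : 0 < delta by rewrite divr_gt0.
(* Level [m] will be bounded by [K / ((m + 1) * (m + 2))], whose series telescopes. The 12 serves
   the levels below 3, where the probability is bounded by 1; [24 * c] serves the others, through
   [8 * c / m ^ 2] and [(m + 1) * (m + 2) <= 3 * m ^ 2]. *)
pose K : R := 24 * c + 12.
exists delta, K; split => //; first by rewrite /K; lra.
have mY : measurable_fun [set: R] (fun x : R => expR (delta * `|x| `^ alpha)).
  apply: measurableT_comp => //; apply: measurable_funM => //.
  by apply: (measurableT_comp (measurable_powR alpha)); exact: normr_measurable.
apply: le_trans (integral_le_level_series _ mY _) _; first by move=> x; exact: expR_ge0.
pose B (m : nat) := [set x : R | m%:R <= expR (delta * `|x| `^ alpha)].
have mB m : measurable (B m).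
  rewrite -[X in measurable X]setTI; have := mY measurableT `[m%:R, +oo[%classic.
  move=> /(_ (measurable_itv _)); congr (measurable (_ `&` _)).
  by apply/seteqP; split=> x /=; rewrite in_itv /= andbT.
have FB m : (F (B m) <= (K * (m.+1%:R^-1 - m.+2%:R^-1))%:E)%E.
  have mE : m.+1%:R^-1 - m.+2%:R^-1 = (m.+1%:R * m.+2%:R)^-1 :> R.
    have -> : m.+2%:R = m.+1%:R + 1 :> R by rewrite natr1.
    by have := ltr0Sn R m; move: (m.+1%:R) => M M0; field; lra.
  have mm0 : 0 < m.+1%:R * m.+2%:R :> R by rewrite mulr_gt0.
  rewrite mE; have [m3|m3] := ltnP m 3.
    have F1 : (F (B m) <= 1)%E by apply: probability_le1; exact: mB.
    apply: le_trans F1 _.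
    rewrite lee_fin ler_pdivlMr// mul1r /K.
    suff : m.+1%:R * m.+2%:R <= 12 :> R by lra.
    by rewrite -natrM ler_nat; move: m m3 {mE mm0} => [|[|[|]]].
  have m3' : 3 <= m%:R :> R by rewrite ler_nat.
  (* Here [expR (delta * t ^ alpha) = m / 2 < m], so level [m] forces [|x| > t] strictly. As
     [delta = c' / 2], the tail at [t] is of order [(m / 2) ^ (-2)]. *)
  pose t := (ln (m%:R / 2) / delta) `^ alpha^-1.
  have ln0 : 0 < ln (m%:R / 2 : R) by rewrite ln_gt0//; lra.
  have u0 : 0 < ln (m%:R / 2) / delta by rewrite divr_gt0.
  have t0 : 0 < t by exact: powR_gt0.
  have tE : t `^ alpha = ln (m%:R / 2) / delta.
    by rewrite /t -powRrM mulVf ?gt_eqF// powRr1// ltW.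
  apply: (@le_trans _ _ (tail F t + tail F t)%E).
    apply: le_trans (two_sided_tail t); apply: le_measure; rewrite ?inE.
    - exact: mB.
    - rewrite -[X in measurable X]setTI.
      have := @normr_measurable R setT measurableT `]t, +oo[%classic (measurable_itv _).
      by congr (measurable (_ `&` _)); apply/seteqP; split=> x /=; rewrite in_itv /= andbT.
    - move=> x /= Bx; rewrite ltNge; apply/negP => xt.
      have : `|x| `^ alpha <= t `^ alpha.
        by apply: ge0_ler_powR; rewrite ?nnegrE ?(ltW alpha0) ?(ltW t0).
      rewrite tE ler_pdivlMr// mulrC -ler_expR lnK ?posrE; last lra.
      by move=> h; have := le_trans Bx h; lra.
  apply: (le_trans (leeD (hc _ t0) (hc _ t0))).
  rewrite -EFinD lee_fin tE.
  have -> : c' * (ln (m%:R / 2) / delta) = ln (m%:R / 2) *+ 2.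
    by rewrite /delta; field; lra.
  rewrite expRN -lnXn; last lra.
  rewrite lnK ?posrE ?exprn_gt0//; last lra.
  have -> : m.+1%:R = m%:R + 1 :> R by rewrite natr1.
  have -> : m.+2%:R = m%:R + 2 :> R by rewrite -!natr1; ring.
  rewrite /K; move: m3'; move: (m%:R) => M M3.
  have -> : c / (M / 2) ^+ 2 + c / (M / 2) ^+ 2 = 8 * c / M ^+ 2 by field; lra.
  rewrite ler_pdivlMr; last by apply: mulr_gt0; lra.
  rewrite mulrAC ler_pdivrMr; last by apply: exprn_gt0; lra.
  have : (M + 1) * (M + 2) <= 3 * M ^+ 2 by nra.
  have : 0 <= M ^+ 2 by apply: sqr_ge0.
  move: ((M + 1) * (M + 2)) (M ^+ 2) => u v v0 uv.
  have : c * u <= c * (3 * v) by rewrite ler_pM2l.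
  lra.
apply: lime_le.
  by apply: is_cvg_nneseries => m _ _; exact: measure_ge0.
apply: nearW => n.
apply: (@le_trans _ _ (\sum_(0 <= m < n) (K * (m.+1%:R^-1 - m.+2%:R^-1))%:E)%E).
  by apply: lee_sum => m _; exact: FB.
rewrite sumEFin lee_fin -mulr_sumr.
rewrite (telescope_sumr_eq (fun m : nat => - m.+1%:R^-1)) //.
  rewrite invr1 opprK addrC mulrBr mulr1 lerBlDr lerDl mulr_ge0// /K; lra.
by move=> m _; rewrite opprK addrC.
Qed.

(** For [u >= 0] the middle term is [expR (- u) * (expR u - 1) ^ 2], and
    [u <= expR u - 1 <= u * expR u]. *)
Lemma cosh_bounds (u : R) :
  u ^+ 2 * expR (- `|u|) <= expR u + expR (- u) - 2 <= u ^+ 2 * expR `|u|.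
Proof.
wlog u0 : u / 0 <= u.
  move=> h; have [/h//|/ltW u0] := leP 0 u.
  by have := h (- u); rewrite oppr_ge0 normrN sqrrN opprK [expR (- u) + _]addrC; apply.
rewrite ger0_norm//.
have e1 : u <= expR u - 1 by have := expR_ge1Dx u; lra.
have e2 : expR u - 1 <= u * expR u.
  have := expR_ge1Dx (- u); rewrite expRN => h.
  have : expR u * (1 - u) <= expR u * (expR u)^-1 by rewrite ler_wpM2l// expR_ge0.
  by rewrite divff ?gt_eqF ?expR_gt0//; lra.
have -> : expR u + expR (- u) - 2 = expR (- u) * (expR u - 1) ^+ 2.
  by rewrite expRN; field; rewrite gt_eqF ?expR_gt0.
rewrite mulrC ler_wpM2l ?expR_ge0 ?lerXn2r ?nnegrE//=; last by lra.
have -> : u ^+ 2 * expR u = expR (- u) * (u * expR u) ^+ 2.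
  by rewrite expRN; field; rewrite gt_eqF ?expR_gt0.
by rewrite ler_wpM2l ?expR_ge0// lerXn2r ?nnegrE ?mulr_ge0 ?expR_ge0//; lra.
Qed.

(** Symmetrizing removes the odd part of the exponential, so the first correction to 2 is quadratic
    in [s]. *)
Lemma mgf_sum s : (mgf F s + mgf F s =
  \int[F]_x (expR (s * x) + expR (- (s * x)))%:E)%E.
Proof.
transitivity (mgf F s + mgf F (- s))%E; first by rewrite mgfN.
have m t := typeR_EFin _ (@measurable_expRM R t).
have e0 (t : R) (x : measurableTypeR R) : (0 <= (expR (t * x))%:E)%E.
  by rewrite lee_fin expR_ge0.
rewrite /mgf -(ge0_integralD F measurableT (fun x _ => e0 s x) (m s)
  (fun x _ => e0 (- s) x) (m (- s))).
by apply: eq_integral => x _; rewrite mulNr EFinD.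
Qed.

(** With [v = delta * |x| / 2 >= |s * x|], [cosh_bounds] and [v ^ 2 <= 4 * expR v] bound the
    quadratic correction by a multiple of [s ^ 2 * expR (2 * v)], whose exponential has mean at most
    [K]. *)
Lemma mgf_le_quadratic (delta K : R) : 0 < delta -> 0 < K ->
  (\int[F]_x (expR (delta * `|x|))%:E <= K%:E)%E ->
  exists2 C : R, 0 < C & forall s, `|s| <= delta / 2 ->
    (mgf F s <= (expR (C * s ^+ 2))%:E)%E.
Proof.
move=> delta0 K0 hK; exists (8 * K / delta ^+ 2).
  by rewrite divr_gt0 ?mulr_gt0 ?exprn_gt0.
move=> s hs; pose b := 16 / delta ^+ 2 * s ^+ 2.
have b0 : 0 <= b by rewrite mulr_ge0 ?sqr_ge0// divr_ge0 ?sqr_ge0.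
have mabs : measurable_fun [set: R] (fun x : R => expR (delta * `|x|)).
  by apply: measurableT_comp => //; apply: measurable_funM => //; exact: normr_measurable.
have : (mgf F s + mgf F s <= (2 + b * K)%:E)%E.
  rewrite mgf_sum; apply: (@le_trans _ _ (\int[F]_x (2 + b * expR (delta * `|x|))%:E)%E).
    apply: ge0_integral_le.
    - apply: measurable_funD; first exact: measurable_expRM.
      by under eq_fun do rewrite -mulNr; exact: measurable_expRM.
    - exact: measurable_affine.
    - move=> x; rewrite addr_ge0 ?expR_ge0//=.
      have /andP[_ h] := cosh_bounds (s * x).
      suff : (s * x) ^+ 2 * expR `|s * x| <= b * expR (delta * `|x|) by lra.
      pose v := delta / 2 * `|x|.
      have v0 : 0 <= v by rewrite mulr_ge0// divr_ge0// ltW.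
      have h1 : `|s * x| <= v by rewrite normrM ler_wpM2r.
      have h2 : v ^+ 2 <= 4 * expR v.
        have -> : v = v / 2 + v / 2 by lra.
        rewrite expRD; have := expR_ge1Dx (v / 2) => h'.
        have h3 : (1 + v / 2) * (1 + v / 2) <= expR (v / 2) * expR (v / 2).
          by apply: ler_pM; lra.
        by nra.
      have -> : (s * x) ^+ 2 = s ^+ 2 * (4 / delta ^+ 2) * v ^+ 2.
        have xx : `|x| ^+ 2 = x ^+ 2 by rewrite real_normK ?num_real.
        by rewrite /v [(_ * `|x|) ^+ 2]exprMn xx; field; lra.
      have -> : b * expR (delta * `|x|) = s ^+ 2 * (4 / delta ^+ 2) * (4 * expR v * expR v).
        by rewrite (_ : delta * `|x| = v + v) ?expRD /b; [ring|rewrite /v; lra].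
      rewrite -mulrA ler_wpM2l//.
        by rewrite mulr_ge0 ?sqr_ge0// divr_ge0 ?sqr_ge0.
      apply: ler_pM => //; rewrite ?sqr_ge0 ?expR_ge0//.
      by rewrite ler_expR.
  rewrite integral_affine//.
  by rewrite [leRHS]EFinD [(b * K)%:E]EFinM leeD2l// lee_wpmul2l// lee_fin.
have := mgf_ge0 F s; case: (mgf F s) => [r| |]//=; rewrite -EFinD !lee_fin => _ hr.
apply: le_trans (expR_ge1Dx _); move: hr; rewrite /b.
have -> : 8 * K / delta ^+ 2 * s ^+ 2 = (16 / delta ^+ 2 * s ^+ 2 * K) / 2 by field; lra.
lra.
Qed.

(** For [s <= 1] the correction in [cosh_bounds] is at least [s ^ 2 * f x] with [f] bounded, and [f]
    has positive mean because it vanishes only at 0. *)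
Lemma mgf_ge_quadratic : F [set 0] != 1%E ->
  exists2 c : R, 0 < c & forall s, 0 <= s <= 1 ->
    ((expR (c * s ^+ 2))%:E <= mgf F s)%E.
Proof.
move=> F0; pose f (x : R) := x ^+ 2 * expR (- `|x|).
have f0 x : 0 <= f x by rewrite mulr_ge0 ?sqr_ge0 ?expR_ge0.
have mf : measurable_fun [set: R] f.
  apply: measurable_funM; first exact: exprn_measurable.
  by apply: measurableT_comp => //; apply: measurableT_comp => //; exact: normr_measurable.
have f4 x : f x <= 4.
  rewrite /f expRN ler_pdivrMr ?expR_gt0// -real_normK ?num_real//.
  have := normr_ge0 x; set v := `|x| => v0.
  rewrite [X in expR X](_ : v = v / 2 + v / 2); last by lra.
  rewrite expRD; have := expR_ge1Dx (v / 2) => h'.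
  have h3 : (1 + v / 2) * (1 + v / 2) <= expR (v / 2) * expR (v / 2).
    by apply: ler_pM; lra.
  by nra.
have I4 : (\int[F]_x (f x)%:E <= 4%:E)%E.
  rewrite -[leRHS](integral_cst_prob F); apply: ge0_integral_le => // x.
  by rewrite f0 f4.
have I0 : (0 <= \int[F]_x (f x)%:E)%E.
  by apply: integral_ge0 => x _; rewrite lee_fin.
have IN0 : (\int[F]_x (f x)%:E != 0)%E.
  apply/negP => /eqP int0; move/negP: F0; apply; apply/eqP.
  have := (ae_eq_integral_abs F measurableT (typeR_EFin _ mf)).1.
  under eq_integral do rewrite gee0_abs ?lee_fin//.
  move=> /(_ int0)[A [mA FA sub]].
  pose Z : set R := [set 0]; have mZ : measurable Z by exact: measurable_set1.
  have : (F (~` Z) <= F A)%E.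
    apply: le_measure; rewrite ?inE//; first by apply: measurableC; exact: mZ.
    apply: subset_trans sub => x /= x0 h; apply: x0; move: (h I) => /eqP.
    by rewrite eqe mulf_eq0 sqrf_eq0 expR_eq0 orbF => /eqP.
  rewrite FA probability_setC; last exact: mZ.
  have ZF : F Z \is a fin_num by apply: fin_num_measure; exact: mZ.
  have Z1 : (F Z <= 1)%E by apply: probability_le1; exact: mZ.
  rewrite leeBlDr// add0e => Z1'.
  by apply/eqP; rewrite eq_le Z1 Z1'.
pose r := fine (\int[F]_x (f x)%:E)%E.
have rE : (\int[F]_x (f x)%:E = r%:E)%E.
  by rewrite /r fineK// ge0_fin_numE// (le_lt_trans I4)// ltry.
have r0 : 0 < r by rewrite -lte_fin -rE lt_neqAle eq_sym IN0 I0.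
(* From [1 + y >= expR (y / (1 + y))] with [y = s ^ 2 * r / 2 <= r / 2]. *)
exists (r / 2 / (1 + r / 2)); first by rewrite divr_gt0//; lra.
move=> s /andP[s0 s1].
have key : ((2 + s ^+ 2 * r)%:E <= mgf F s + mgf F s)%E.
  rewrite EFinD EFinM -rE -integral_affine ?sqr_ge0// mgf_sum.
  apply: ge0_integral_le.
  - exact: measurable_affine.
  - apply: measurable_funD; first exact: measurable_expRM.
    by under eq_fun do rewrite -mulNr; exact: measurable_expRM.
  - move=> x; rewrite (addr_ge0 _ (mulr_ge0 (sqr_ge0 s) (f0 x)))//=.
    have /andP[h _] := cosh_bounds (s * x).
    suff : s ^+ 2 * f x <= (s * x) ^+ 2 * expR (- `|s * x|) by lra.
    rewrite /f mulrA -exprMn ler_wpM2l ?sqr_ge0// ler_expR lerN2.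
    by rewrite normrM (ger0_norm s0) ler_piMl.
set y := s ^+ 2 * (r / 2).
have y0 : 0 <= y by rewrite mulr_ge0 ?sqr_ge0//; lra.
have ys : y <= r / 2 by rewrite ler_piMl ?expr_le1//; lra.
have le1y : expR (r / 2 / (1 + r / 2) * s ^+ 2) <= 1 + y.
  apply: (@le_trans _ _ (expR (y / (1 + y)))).
    rewrite ler_expR mulrAC [r / 2 * _]mulrC -/y ler_wpM2l// lef_pV2 ?posrE; lra.
  have := expR_ge1Dx (- (y / (1 + y))); rewrite expRN.
  have y1 : 0 < 1 + y by lra.
  rewrite -{1}(divff (lt0r_neq0 y1)) -mulrBl addrK div1r.
  by rewrite lef_pV2 ?posrE ?expR_gt0//; lra.
have key2 : ((1 + y)%:E <= mgf F s)%E.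
  move: key; rewrite /y; case: (mgf F s) => [t| |]//=; rewrite ?leey//.
  by rewrite -EFinD !lee_fin; lra.
by apply: le_trans key2; rewrite lee_fin.
Qed.

(** Because [|x| <= 1 + |x| ^ alpha] when [alpha >= 1]. *)
Lemma exp_moment alpha : 1 <= alpha -> tail_class_minus alpha F ->
  exists delta K : R, [/\ 0 < delta, 0 < K &
    (\int[F]_x (expR (delta * `|x|))%:E <= K%:E)%E].
Proof.
move=> alpha1 /(tail_moment _ (lt_le_trans ltr01 alpha1))[delta [K [d0 K1 hK]]].
exists delta, (expR delta * K); split=> //.
  by rewrite mulr_gt0 ?expR_gt0//; lra.
have mY : measurable_fun [set: R] (fun x : R => expR (delta * `|x| `^ alpha)).
  apply: measurableT_comp => //; apply: measurable_funM => //.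
  by apply: (measurableT_comp (measurable_powR alpha)); exact: normr_measurable.
apply: (@le_trans _ _ (\int[F]_x (0 + expR delta * expR (delta * `|x| `^ alpha))%:E)%E).
  apply: ge0_integral_le.
  - by apply: measurableT_comp => //; apply: measurable_funM => //; exact: normr_measurable.
  - exact: measurable_affine.
  - move=> x; rewrite expR_ge0/= add0r -expRD ler_expR -[X in _ <= X + _]mulr1 -mulrDr.
    rewrite ler_pM2l//; have [x1|x1] := leP 1 `|x|.
      by have := le1r_powR x1 alpha1; lra.
    by have := powR_ge0 `|x| alpha; lra.
rewrite integral_affine ?expR_ge0//.
by rewrite add0e EFinM lee_wpmul2l// lee_fin expR_ge0.
Qed.

(** Young's inequality with the exponent conjugate to [alpha] separates [s] from [|x|], and the
    remaining factor is the moment of [tail_moment]. *)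
Lemma mgf_le_power alpha : 1 < alpha -> tail_class_minus alpha F ->
  exists2 C : R, 0 < C &
    (forall s, 0 <= s <= 1 -> (mgf F s <= (expR (C * s ^+ 2))%:E)%E) /\
    (forall s, 1 <= s -> (mgf F s <= (expR (C * s `^ (alpha / (alpha - 1))))%:E)%E).
Proof.
move=> alpha1 tcm; have alpha0 : 0 < alpha by lra.
have [delta [K [d0 K1 hK]]] := tail_moment _ alpha0 tcm.
have mY : measurable_fun [set: R] (fun x : R => expR (delta * `|x| `^ alpha)).
  apply: measurableT_comp => //; apply: measurable_funM => //.
  by apply: (measurableT_comp (measurable_powR alpha)); exact: normr_measurable.
pose beta := alpha / (alpha - 1).
have beta0 : 0 < beta by rewrite divr_gt0; lra.
(* Scaling [|x|] by [kappa] turns its term in Young's inequality into exactly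
   [delta * |x| ^ alpha]. *)
pose kappa := (alpha * delta) `^ alpha^-1.
have ad0 : 0 < alpha * delta by rewrite mulr_gt0.
have kappa0 : 0 < kappa by exact: powR_gt0.
have kE : kappa `^ alpha = alpha * delta.
  by rewrite /kappa -powRrM mulVf ?gt_eqF// powRr1// ltW.
pose D := (kappa^-1) `^ beta / beta.
have D0 : 0 < D by rewrite divr_gt0// powR_gt0// invr_gt0.
have young s x : 0 <= s -> s * `|x| <= D * s `^ beta + delta * `|x| `^ alpha.
  move=> s0; have := @conjugate_powR R (s / kappa) (kappa * `|x|) beta alpha.
  have -> : s / kappa * (kappa * `|x|) = s * `|x| by field; rewrite gt_eqF.
  rewrite (powRM _ s0) ?invr_ge0 ?(ltW kappa0)// powRM ?(ltW kappa0)// kE.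
  have -> : s `^ beta * kappa^-1 `^ beta / beta + alpha * delta * `|x| `^ alpha / alpha
      = D * s `^ beta + delta * `|x| `^ alpha.
    by rewrite /D; field; rewrite !gt_eqF.
  apply=> //; rewrite ?mulr_ge0 ?invr_ge0 ?(ltW kappa0)//.
  by rewrite /beta; field; rewrite !gt_eqF//; lra.
have expo s : 0 <= s -> (\int[F]_x (expR (s * `|x|))%:E <= (expR (D * s `^ beta) * K)%:E)%E.
  move=> s0.
  apply: (@le_trans _ _ (\int[F]_x (0 + expR (D * s `^ beta) * expR (delta * `|x| `^ alpha))%:E)%E).
    apply: ge0_integral_le.
    - by apply: measurableT_comp => //; apply: measurable_funM => //; exact: normr_measurable.
    - exact: measurable_affine.
    - by move=> x; rewrite expR_ge0/= add0r -expRD ler_expR young.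
  rewrite integral_affine ?expR_ge0//.
  by rewrite add0e EFinM lee_wpmul2l// lee_fin expR_ge0.
have K'0 : 0 < expR (D * 2 `^ beta) * K by rewrite mulr_gt0 ?expR_gt0//; lra.
(* The parameter 2 makes the quadratic bound valid for [|s| <= 1]. *)
have [C1 C10 hC1] := mgf_le_quadratic _ _ (ltr0Sn R 1) K'0 (expo 2 (ltW (ltr0Sn R 1))).
pose C2 := D + ln K.
have lnK0 : 0 <= ln K by exact: ln_ge0.
exists (C1 + C2); first by rewrite /C2; lra.
split=> [s /andP[s0 s1]|s s1].
  apply: le_trans (hC1 s _) _; first by rewrite ger0_norm// divff.
  rewrite lee_fin ler_expR ler_wpM2r ?sqr_ge0//; rewrite /C2; lra.
have s0 : 0 <= s by lra.
apply: (@le_trans _ _ (\int[F]_x (expR (s * `|x|))%:E)%E).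
  apply: ge0_integral_le.
  - exact: measurable_expRM.
  - by apply: measurableT_comp => //; apply: measurable_funM => //; exact: normr_measurable.
  - by move=> x; rewrite expR_ge0/= ler_expR ler_wpM2l// ler_norm.
apply: le_trans (expo s s0) _; rewrite lee_fin -{1}[K]lnK ?posrE; last by lra.
rewrite -expRD ler_expR -/beta.
have sb : 1 <= s `^ beta by rewrite -(powRr0 s) ler_powR// ltW.
have : ln K * 1 <= ln K * s `^ beta by rewrite ler_wpM2l.
have : 0 <= C1 * s `^ beta by rewrite mulr_ge0 ?powR_ge0// ltW.
by rewrite /C2; lra.
Qed.

Lemma tail_plus_nondegenerate alpha : tail_class_plus alpha F -> F [set 0] != 1%E.
Proof.
move=> [c [c' [c0 c'0 h]]]; apply/negP => /eqP F1.
have := h 1 ltr01; rewrite /tail leNgt => /negP; apply.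
pose Z : set R := [set 0]; have mZ : measurable Z by exact: measurable_set1.
have mA : measurable ([set x | 1 < x] : set R).
  by rewrite -set_itvoy; exact: (measurable_itv `]1, +oo[).
apply: (@le_lt_trans _ _ (F (~` Z))).
  apply: le_measure; rewrite ?inE; [exact: mA|by apply: measurableC; exact: mZ|].
  by move=> x /= x1 x0; move: x1; rewrite x0; lra.
rewrite probability_setC; last exact: mZ.
by rewrite /Z F1 subee// lte_fin mulr_gt0 ?expR_gt0.
Qed.

(** The two tail bounds give [C' * x ^ beta <= c' * x ^ alpha] up to a constant for all [x > 0],
    impossible for large [x] if [beta > alpha]. *)
Lemma tail_class_le alpha beta : 0 < alpha -> 0 < beta ->
  tail_class_plus alpha F -> tail_class_minus beta F -> beta <= alpha.
Proof.
move=> alpha0 beta0 [c [c' [c0 c'0 h]]] [C [C' [C0 C'0 H]]].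
rewrite leNgt; apply/negP => ab.
have main x : 0 < x -> C' * x `^ beta <= c' * x `^ alpha + ln (C / c).
  move=> x0; have hx := le_trans (h x x0) (H x x0); rewrite lee_fin in hx.
  have : ln (c * expR (- (c' * x `^ alpha))) <= ln (C * expR (- (C' * x `^ beta))).
    by rewrite ler_ln ?posrE ?mulr_gt0 ?expR_gt0.
  have lnE (a t : R) : 0 < a -> ln (a * expR t) = ln a + t.
    by move=> a0; rewrite lnM ?posrE ?expR_gt0// expRK.
  by rewrite !lnE// ln_div ?posrE//; lra.
(* Then [x] is chosen with [x ^ (beta - alpha) = B], large enough to contradict [main]. *)
pose B := (c' + `|ln (C / c)| + 1) / C' + 1.
have B1 : 1 < B by rewrite ltrDr divr_gt0//; have := normr_ge0 (ln (C / c)); lra.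
pose x := B `^ (beta - alpha)^-1.
have x1 : 1 <= x.
  rewrite /x -(powRr0 B); apply: ler_powR; first exact: ltW.
  by rewrite invr_ge0; lra.
have x0 : 0 < x by lra.
have xE : x `^ beta = B * x `^ alpha.
  have -> : beta = (beta - alpha) + alpha by rewrite subrK.
  rewrite powRD; last by apply/implyP => _; rewrite gt_eqF.
  congr (_ * _); rewrite /x -powRrM mulVf ?powRr1; lra.
have xa : 1 <= x `^ alpha by rewrite -(powRr0 x) ler_powR// ltW.
have := main x x0; rewrite xE.
have -> : C' * (B * x `^ alpha) = (c' + `|ln (C / c)| + 1 + C') * x `^ alpha.
  by rewrite /B; field; rewrite gt_eqF.
have := ler_norm (ln (C / c)).
have : `|ln (C / c)| * 1 <= `|ln (C / c)| * x `^ alpha by rewrite ler_wpM2l.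
have : 0 < C' * x `^ alpha by rewrite mulr_gt0//; lra.
lra.
Qed.

End TailMoment.

(** * Sums of powers and harmonic sums *)

Section PowerSums.
Context {R : realType}.
Implicit Types (a b r x : R) (k n K : nat).

Lemma exprn_sqrt_powR x d : 0 <= x -> Num.sqrt x ^+ d = x `^ (d%:R / 2).
Proof.
move=> x0; rewrite -powR12_sqrt// -powR_mulrn ?powR_ge0// -powRrM.
by congr (_ `^ _); rewrite mulrC.
Qed.

Lemma ln_ratio_ge k : (0 < k)%N -> k.+1%:R^-1 <= ln (k.+1%:R / k%:R) :> R.
Proof.
move=> k0; have k0' : 0 < k%:R :> R by rewrite ltr0n.
have e : k%:R / k.+1%:R = 1 + - k.+1%:R^-1 :> R.
  by rewrite -natr1; field; lra.
have : ln (k%:R / k.+1%:R : R) <= - k.+1%:R^-1.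
  by rewrite e le_ln1Dx// ltrN2 invf_lt1// ltr1n.
have -> : ln (k.+1%:R / k%:R) = - ln (k%:R / k.+1%:R) :> R.
  by rewrite -lnV ?posrE ?divr_gt0// invf_div.
by rewrite lerNr.
Qed.

Lemma ln_ratio_le k : (0 < k)%N -> ln (k.+1%:R / k%:R) <= k%:R^-1 :> R.
Proof.
move=> k0; have k0' : 0 < k%:R :> R by rewrite ltr0n.
have -> : k.+1%:R / k%:R = 1 + k%:R^-1 :> R by rewrite -natr1; field; lra.
by apply: le_ln1Dx; apply: lt_trans (_ : 0 < _); rewrite ?invr_gt0//; lra.
Qed.

Lemma powR_expR x r : 0 < x -> x `^ r = expR (r * ln x).
Proof. by move=> x0; rewrite /powR gt_eqF. Qed.

(** Comparison with the integral in telescoping form; [expR z >= 1 + z] at a multiple of the log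
    ratio replaces the mean value theorem. *)
Lemma sum_powR_tail b K n : 1 < b -> (0 < K)%N ->
  \sum_(K <= k < K + n) k.+1%:R `^ (- b) <= K%:R `^ (1 - b) / (b - 1).
Proof.
move=> b1 K0.
have term k : (0 < k)%N ->
    k.+1%:R `^ (- b) <= (k%:R `^ (1 - b) - k.+1%:R `^ (1 - b)) / (b - 1).
  move=> k0; have k0' : 0 < k%:R :> R by rewrite ltr0n.
  rewrite ler_pdivlMr ?subr_gt0//.
  have -> : k.+1%:R `^ (- b) * (b - 1) = k.+1%:R `^ (1 - b) * ((b - 1) / k.+1%:R) :> R.
    rewrite powRD; last by apply/implyP => _; rewrite gt_eqF.
    by rewrite powRr1//; set N := k.+1%:R; field; rewrite gt_eqF.
  have -> : k%:R `^ (1 - b) = k.+1%:R `^ (1 - b) * expR ((b - 1) * ln (k.+1%:R / k%:R)) :> R.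
    rewrite !powR_expR// -expRD; congr expR; rewrite ln_div ?posrE//; ring.
  rewrite -[X in _ <= _ - X]mulr1 -mulrBr ler_wpM2l ?powR_ge0//.
  have := expR_ge1Dx ((b - 1) * ln (k.+1%:R / k%:R)).
  have : (b - 1) / k.+1%:R <= (b - 1) * ln (k.+1%:R / k%:R).
    by rewrite ler_wpM2l ?ln_ratio_ge//; lra.
  by move=> h1 h2; rewrite lerBrDl; apply: le_trans h2; rewrite lerD2l.
apply: (@le_trans _ _ (\sum_(K <= k < K + n)
    (k%:R `^ (1 - b) - k.+1%:R `^ (1 - b)) / (b - 1))).
  by apply: ler_sum_nat => k /andP[Kk _]; exact/term/(leq_trans K0).
rewrite -mulr_suml ler_wpM2r ?invr_ge0 ?subr_ge0 ?(ltW b1)//.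
rewrite (telescope_sumr_eq (fun k => - (k%:R `^ (1 - b)))) ?leq_addr//.
  by have := powR_ge0 ((K + n)%:R : R) (1 - b); lra.
by move=> k _; rewrite opprK addrC.
Qed.

Lemma sum_powR_lt b n : 1 < b ->
  \sum_(k < n) k.+1%:R `^ (- b) <= 1 + (b - 1)^-1.
Proof.
move=> b1; case: n => [|n].
  by rewrite big_ord0 addr_ge0// invr_ge0; lra.
rewrite -(big_mkord xpredT (fun k => k.+1%:R `^ (- b))) big_ltn// powR1 lerD2l.
by have := sum_powR_tail _ 1 n b1 isT; rewrite powR1 mul1r add1n.
Qed.

(** Telescoping as for the tail; the factor 2 pays for [1 - expR (- z) >= z / 2] on [[0, 1]]. *)
Lemma sum_powR_head a n : 0 <= a < 1 ->
  \sum_(k < n) k.+1%:R `^ (- a) <= 2 / (1 - a) * n%:R `^ (1 - a).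
Proof.
move=> /andP[a0 a1]; set r := 1 - a.
have r0 : 0 < r by rewrite subr_gt0.
have r1 : r <= 1 by rewrite /r; lra.
have term k : k.+1%:R `^ (- a) <= 2 / r * (k.+1%:R `^ r - k%:R `^ r).
  rewrite -ler_pdivrMl ?divr_gt0// invf_div.
  have -> : k.+1%:R `^ (- a) = k.+1%:R `^ r / k.+1%:R :> R.
    have -> : - a = r - 1 by rewrite /r; lra.
    rewrite powRD; last by apply/implyP => _; rewrite gt_eqF.
    by rewrite powRN powRr1.
  case: k => [|k]; first by rewrite powR1 powR0 ?gt_eqF//; lra.
  set N := k.+1; have N0 : 0 < N%:R :> R by rewrite ltr0n.
  have -> : N%:R `^ r = N.+1%:R `^ r * expR (- (r * ln (N.+1%:R / N%:R))) :> R.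
    rewrite !powR_expR// -expRD; congr expR; rewrite ln_div ?posrE//; ring.
  rewrite -[X in _ <= X - _]mulr1 -mulrBr mulrCA ler_wpM2l ?powR_ge0//.
  pose z := r / N.+1%:R.
  have z0 : 0 < z by rewrite divr_gt0.
  have z1 : z <= 1.
    rewrite ler_pdivrMr// mul1r; apply: le_trans r1 _; by rewrite ler1n.
  have zl : z <= r * ln (N.+1%:R / N%:R) by rewrite ler_wpM2l ?ln_ratio_ge// ltW.
  have h1 : expR (- (r * ln (N.+1%:R / N%:R))) <= expR (- z) by rewrite ler_expR lerN2.
  have h2 : expR (- z) <= (1 + z)^-1.
    by rewrite expRN lef_pV2 ?posrE ?expR_gt0 ?expR_ge1Dx//; lra.
  have h3 : (1 + z)^-1 <= 1 - z / 2.
    rewrite -[leLHS]mul1r ler_pdivrMr; nra.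
  have -> : r / 2 * N.+1%:R^-1 = z / 2 by rewrite /z; ring.
  lra.
apply: (@le_trans _ _ (\sum_(k < n) 2 / r * (k.+1%:R `^ r - k%:R `^ r))).
  by apply: ler_sum => k _; exact: term.
rewrite -mulr_sumr ler_wpM2l ?divr_ge0 ?(ltW r0)//.
rewrite -(big_mkord xpredT (fun k => k.+1%:R `^ r - k%:R `^ r)) telescope_sumr//.
by rewrite powR0 ?gt_eqF// subr0.
Qed.

Lemma sum_inv_le n : (0 < n)%N -> \sum_(k < n) k.+1%:R^-1 <= 1 + ln n%:R :> R.
Proof.
elim: n => // -[|n] IH _; first by rewrite big_ord1 invr1 ln1 addr0.
rewrite big_ord_recr /=; apply: le_trans (lerD (IH isT) (@ln_ratio_ge n.+1 isT)) _.
by rewrite ln_div ?posrE// -addrA [ln n.+1%:R + _]addrC subrK.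
Qed.

Lemma sum_inv_ge n : ln n.+1%:R <= \sum_(k < n) k.+1%:R^-1 :> R.
Proof.
elim: n => [|n IH]; first by rewrite big_ord0 ln1.
rewrite big_ord_recr /=; apply: le_trans (lerD IH (@ln_ratio_le n.+1 isT)).
by rewrite ln_div ?posrE// addrC subrK.
Qed.

(** Running the tail up to [K + n] avoids comparing [K] with [n]. *)
Lemma cut_sum_le (h : nat -> R) K n :
  (forall k, 0 <= h k) ->
  \sum_(k < n) h k <= \sum_(k < K) h k + \sum_(K <= k < K + n) h k.
Proof.
move=> h0; rewrite -(big_mkord xpredT h) -[X in _ <= X + _](big_mkord xpredT h).
rewrite -big_cat_nat ?leq_addr//= addnC (@big_cat_nat _ _ _ n 0 (n + K)) ?leq_addr//=.
by rewrite lerDl sumr_ge0.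
Qed.

End PowerSums.

(** * Bounds on the mean of the wall process *)

Section WallMean.
Context {R : realType} {d : nat}.
Hypothesis d_gt0 : (0 < d)%N.
Variable p : 'rV[int]_d -> R.
Hypothesis hp : step_distribution p.
Variable S : seq 'rV[int]_d.
Hypothesis S_uniq : uniq S.
Hypothesis S_supp : forall s, (s \in S) = (p s != 0).
Variable F : probability (measurableTypeR R) R.
Hypothesis F_sym : symmetric_law F.
Context {dT : measure_display} {T : measurableType dT}.
Variables (P : probability T R) (eps : int -> 'rV[int]_d -> {RV P >-> R}).
Hypothesis eps_law : forall n i, has_law F (eps n i).
Hypothesis eps_indep :
  mutually_independent (fun ni : int * 'rV[int]_d => eps ni.1 ni.2).

Local Notation mu := (wall_mean p eps).
Local Notation half := (d%:R / 2 : R).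

Let p_ge0 := step_distribution_ge0 p hp.
Let p_mass := step_distribution_mass p hp S S_uniq S_supp.

Lemma wall_meanE n :
  mu n = (\int[P]_w (reflected S p (noise P eps w) n 0)%:E)%E.
Proof.
rewrite /wall_mean expectation.unlock; apply: eq_integral => w _; congr EFin.
suff E m : wall p (fun m i => eps m i w) m = reflected S p (noise P eps w) m.
  by rewrite E.
elim: m => //= m IH; apply/funext => i.
by rewrite (avgE p S S_uniq S_supp) IH.
Qed.

Lemma free_expR_le lam n (psi : nat -> 'rV[int]_d -> R) i :
  (forall k j, (mgf F (lam * heat S p k j) <= (expR (psi k j))%:E)%E) ->
  (\int[P]_w (expR (- (lam * free S p (noise P eps w) n i)))%:E <=
   (expR (\sum_(k < n) \sum_(j <- reach S k) psi k j))%:E)%E.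
Proof.
move=> h; under eq_integral do rewrite -mulNr.
apply: (integral_expR_free_le S p F P eps eps_law eps_indep) => k j.
by rewrite mulNr mgfN.
Qed.

Section Upper.
Variable B : R.
Hypothesis B_ge1 : 1 <= B.
Hypothesis heat_bound : forall k j, heat S p k j <= B * k.+1%:R `^ (- half).

Let bd (k : nat) : R := B * k.+1%:R `^ (- half).

(* As [heat k] has mass 1, a bound [s * g k s] on the logarithm of the moment generating
   function, with [g k] monotone, reduces the sum over sites to its value at the maximum
   of [heat k]. *)
Definition level_sum (g : nat -> R -> R) (lam : R) (n : nat) : R :=
  \sum_(k < n) lam * g k (lam * bd k).

(** The dependence of [g] on [k] allows different bounds at early and late time lags. *)
Definition mgf_majorant (g : nat -> R -> R) (lam : R) : Prop :=
  [/\ forall k u, 0 <= u -> 0 <= g k u,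
      forall k u v, 0 <= u -> u <= v -> g k u <= g k v &
      forall k s, 0 <= s -> s <= lam -> (mgf F s <= (expR (s * g k s))%:E)%E].

Let B_gt0 : 0 < B.
Proof. exact: lt_le_trans ltr01 B_ge1. Qed.

(** For [n >= 2] one has [n + 2 <= n ^ 2] and [1 <= ln n / ln 2], so
    [2 * ln (n + 2) + 1 <= kappa * ln n]. *)
Let kappa : R := 4 + (ln 2)^-1.

Let ln2 : 0 < ln 2 :> R.
Proof. by rewrite ln_gt0// ltr1n. Qed.

Let kappa_gt0 : 0 < kappa.
Proof. by rewrite addr_gt0 ?invr_gt0. Qed.

Let ln_ge n : (2 <= n)%N -> ln 2 <= ln n%:R :> R.
Proof. by move=> n2; rewrite ler_ln ?posrE ?ltr0n ?ler_nat//; lia. Qed.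

Lemma mean_le_level g lam n : 0 < lam -> (2 <= n)%N -> mgf_majorant g lam ->
  (mu n <= (lam^-1 * (2 * level_sum g lam n + kappa * ln n%:R))%:E)%E.
Proof.
move=> lam0 n2 [g0 gm hg].
have bd0 k : 0 <= lam * bd k.
  by rewrite /bd !mulr_ge0 ?powR_ge0 ?(ltW lam0) ?(ltW B_gt0).
pose psi k j := lam * heat S p k j * g k (lam * bd k).
have h0 k j : 0 <= heat S p k j by exact: heat_ge0.
have hpsi k j : (mgf F (lam * heat S p k j) <= (expR (psi k j))%:E)%E.
  have s0 : 0 <= lam * heat S p k j by rewrite mulr_ge0// ltW.
  apply: le_trans (hg k _ s0 _) _.
    by rewrite ler_piMr ?(ltW lam0)// heat_le1.
  rewrite lee_fin ler_expR ler_wpM2l// gm// ler_wpM2l ?(ltW lam0)//.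
have sumE k : \sum_(j <- reach S k) psi k j = lam * g k (lam * bd k).
  by rewrite -mulr_suml -mulr_sumr heat_mass// mulr1.
have sum_le m : (m <= n)%N ->
    \sum_(k < m) \sum_(j <- reach S k) psi k j <= level_sum g lam n.
  move=> mn; rewrite /level_sum.
  under eq_bigr do rewrite sumE.
  rewrite -(big_mkord xpredT (fun k => lam * g k (lam * bd k))).
  rewrite -[leRHS](big_mkord xpredT (fun k => lam * g k (lam * bd k))).
  rewrite (@big_cat_nat _ _ _ m 0 n)//= lerDl sumr_ge0// => k _.
  by rewrite mulr_ge0 ?(ltW lam0)// g0.
rewrite wall_meanE.
apply: le_trans (integral_reflected_le S p p_ge0 p_mass P eps lam
  (level_sum g lam n) n 0 lam0 _ _) _.
- move=> m j mn.
  apply: le_trans (integral_expR_free_le S p F P eps eps_law eps_indep lam psi m j hpsi) _.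
  by rewrite lee_fin ler_expR sum_le.
- move=> m j mn; apply: le_trans (free_expR_le lam m psi j hpsi) _.
  by rewrite lee_fin ler_expR sum_le.
rewrite lee_fin ler_wpM2l ?invr_ge0 ?(ltW lam0)//.
have h1 : ln n.+2%:R <= 2 * ln n%:R :> R.
  rewrite mulr_natl -lnXn ?ltr0n; last by lia.
  by rewrite ler_ln ?posrE ?exprn_gt0 ?ltr0n -?natrX ?ler_nat//; nia.
have h2 : 1 <= (ln 2)^-1 * ln n%:R :> R by rewrite ler_pdivlMl// mulr1 ln_ge.
by rewrite /kappa; lra.
Qed.

(** The choice [lam = (ln n / ln 2) ^ theta] makes the level sum comparable with [ln n]; the
    division by [ln 2] ensures [lam >= 1] from [n = 2] on. *)
Lemma mean_le_power theta D : 0 < theta -> 0 < D ->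
  (forall lam n, 1 <= lam -> exists g, mgf_majorant g lam /\
     level_sum g lam n <= D * lam `^ theta^-1) ->
  exists2 C : R, 0 < C & forall n, (2 <= n)%N ->
    (mu n <= (C * ln n%:R `^ (1 - theta))%:E)%E.
Proof.
move=> th0 D0 H; pose l2 : R := ln 2.
exists ((2 * D / l2 + kappa) * l2 `^ theta).
  by rewrite mulr_gt0 ?powR_gt0// addr_gt0// divr_gt0// mulr_gt0.
move=> n n2; pose x : R := ln n%:R.
have x0 : 0 < x by apply: lt_le_trans ln2 (ln_ge _ n2).
pose lam := (x / l2) `^ theta.
have xl : 1 <= x / l2 by rewrite ler_pdivlMr// mul1r ln_ge.
have lam1 : 1 <= lam by rewrite /lam -(powRr0 (x / l2)) ler_powR// ltW.
have lam0 : 0 < lam by lra.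
have [g [gmaj gsum]] := H lam n lam1.
apply: le_trans (mean_le_level g lam n lam0 n2 gmaj) _; rewrite lee_fin.
have lamE : lam `^ theta^-1 = x / l2.
  by rewrite /lam -powRrM divff ?gt_eqF// powRr1//; lra.
rewrite lamE in gsum.
apply: (@le_trans _ _ (lam^-1 * ((2 * D / l2 + kappa) * x))).
  rewrite ler_wpM2l ?invr_ge0 ?(ltW lam0)// -/x [leRHS]mulrDl lerD2r.
  by move: gsum; rewrite -[2 * D / l2 * x]mulrA [l2^-1 * x]mulrC; lra.
rewrite mulrCA -[leRHS]mulrA ler_wpM2l//.
  by rewrite addr_ge0 ?(ltW kappa_gt0)// divr_ge0 ?(ltW ln2)// mulr_ge0// ltW.
rewrite le_eqVlt; apply/orP; left; apply/eqP.
rewrite powRB; last by apply/implyP => _; rewrite gt_eqF.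
rewrite powRr1 ?(ltW x0)// /lam powRM ?invr_ge0 ?(ltW x0) ?(ltW ln2)//.
have -> : l2^-1 `^ theta = (l2 `^ theta)^-1.
  by rewrite -powR_inv1 ?(ltW ln2)// -powRrM mulN1r powRN.
rewrite -/x; field; by rewrite !gt_eqF ?powR_gt0.
Qed.

Lemma quadratic_majorant C s0 : 0 <= C ->
  (forall s, `|s| <= s0 -> (mgf F s <= (expR (C * s ^+ 2))%:E)%E) ->
  forall lam, lam <= s0 -> mgf_majorant (fun _ u => C * u) lam.
Proof.
move=> C0 hC lam ls; split=> [k u u0|k u v u0 uv|k s s0' sl].
- exact: mulr_ge0.
- exact: ler_wpM2l.
- apply: le_trans (hC s _) _; first by rewrite ger0_norm//; lra.
  by rewrite lee_fin ler_expR expr2 mulrCA.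
Qed.

Lemma level_sum_quadratic C lam n :
  level_sum (fun _ u => C * u) lam n =
  C * B * lam ^+ 2 * \sum_(k < n) k.+1%:R `^ (- half).
Proof.
by rewrite /level_sum mulr_sumr; apply: eq_bigr => k _; rewrite /bd; ring.
Qed.

(** A fixed [lam] suffices: for [d >= 2] the level sum is at most a harmonic sum. *)
Lemma mean_le_ln alpha : 1 <= alpha -> tail_class_minus alpha F -> (2 <= d)%N ->
  exists2 C : R, 0 < C & forall n, (2 <= n)%N -> (mu n <= (C * ln n%:R)%:E)%E.
Proof.
move=> a1 tcm d2; have [delta [K [delta0 K0 hK]]] := exp_moment F F_sym alpha a1 tcm.
have [C C0 hC] := mgf_le_quadratic F F_sym delta K delta0 K0 hK.
pose lam := delta / 2; have lam0 : 0 < lam by rewrite divr_gt0.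
pose Q := C * B * lam ^+ 2.
have Q0 : 0 < Q by rewrite !mulr_gt0 ?exprn_gt0.
exists (lam^-1 * (2 * (Q * ((ln 2)^-1 + 1)) + kappa)).
  rewrite mulr_gt0 ?invr_gt0// addr_gt0// !mulr_gt0// addr_gt0// invr_gt0//.
move=> n n2.
have maj := quadratic_majorant C lam (ltW C0) hC lam (lexx _).
apply: le_trans (mean_le_level _ lam n lam0 n2 maj) _.
rewrite lee_fin -mulrA ler_wpM2l ?invr_ge0 ?(ltW lam0)// [leRHS]mulrDl lerD2r.
rewrite -mulrA ler_pM2l// level_sum_quadratic -/Q -mulrA ler_pM2l//.
apply: (@le_trans _ _ (1 + ln n%:R)).
  apply: le_trans (sum_inv_le n (ltnW n2)); apply: ler_sum => k _.
  rewrite -[leRHS]powR_inv1// ler_powR ?ler1n// lerN2 ler_pdivlMr// mul1r.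
  by rewrite ler_nat.
by rewrite mulrDl mul1r lerD2r ler_pdivlMl// mulr1 ln_ge.
Qed.

Lemma mean_le_quarter : d = 1%N -> tail_class_minus 1 F ->
  exists2 C : R, 0 < C & forall n, (2 <= n)%N ->
    (mu n <= (C * (n%:R `^ (1 / 4) * Num.sqrt (ln n%:R)))%:E)%E.
Proof.
move=> d1 tcm; have [delta [K [delta0 K0 hK]]] := exp_moment F F_sym 1 (lexx _) tcm.
have [C C0 hC] := mgf_le_quadratic F F_sym delta K delta0 K0 hK.
pose s0 := delta / 2; have s00 : 0 < s0 by rewrite divr_gt0.
exists (2 / s0 * (2 * (C * B * s0 ^+ 2) + kappa)).
  by rewrite mulr_gt0 ?divr_gt0// addr_gt0// !mulr_gt0 ?exprn_gt0.
move=> n n2; set r : R := n%:R `^ (1 / 4); set x : R := ln n%:R.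
have n0 : 0 < n%:R :> R by rewrite ltr0n ltnW.
have r0 : 0 < r by exact: powR_gt0.
have x0 : 0 < x by apply: lt_le_trans ln2 (ln_ge _ n2).
have sx0 : 0 < Num.sqrt x by rewrite sqrtr_gt0.
have xx : Num.sqrt x ^+ 2 = x by rewrite sqr_sqrtr// ltW.
have r2 : r ^+ 2 = n%:R `^ (1 / 2).
  rewrite -powR_mulrn ?powR_ge0// /r -powRrM; congr (_ `^ _); lra.
have xr : x <= 2 * r ^+ 2.
  have := ln_sublinear (_ : 0 < r ^+ 2); rewrite exprn_gt0// => /(_ isT).
  by rewrite {1}r2 ln_powR -/x; lra.
(* This balances [lam ^ 2 * sqrt n], the order of the level sum, with [ln n]; the factor [s0 / 2]
   keeps [lam] in the range of the quadratic bound. *)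
pose lam := s0 / 2 * (Num.sqrt x / r).
have lam0 : 0 < lam by rewrite !mulr_gt0 ?divr_gt0 ?invr_gt0.
have lams : lam <= s0.
  have : Num.sqrt x / r <= 2.
    rewrite ler_pdivrMr// -(ler_pXn2r (_ : 0 < 2)%N) ?nnegrE ?mulr_ge0 ?(ltW sx0) ?(ltW r0)//.
    rewrite xx exprMn; have := sqr_ge0 r; lra.
  by rewrite /lam; nra.
have maj := quadratic_majorant C s0 (ltW C0) hC lam lams.
apply: le_trans (mean_le_level _ lam n lam0 n2 maj) _; rewrite lee_fin -/x.
have lev : level_sum (fun _ u => C * u) lam n <= C * B * s0 ^+ 2 * x.
  rewrite level_sum_quadratic.
  have := @sum_powR_head R (1 / 2) n; rewrite d1 => h.
  have {}h : \sum_(k < n) k.+1%:R `^ (- (1 / 2)) <= 4 * r ^+ 2.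
    apply: le_trans (h _) _; first by apply/andP; split; lra.
    have -> : 1 - 1 / 2 = 1 / 2 :> R by lra.
    rewrite r2; apply: ler_wpM2r; [exact: powR_ge0|lra].
  have -> : C * B * s0 ^+ 2 * x = C * B * lam ^+ 2 * (4 * r ^+ 2).
    rewrite /lam -[in LHS]xx; field; exact: lt0r_neq0.
  apply: ler_wpM2l h; apply: mulr_ge0; last exact: sqr_ge0.
  by apply: mulr_ge0; exact: ltW.
have -> : 2 / s0 * (2 * (C * B * s0 ^+ 2) + kappa) * (r * Num.sqrt x) =
    lam^-1 * ((2 * (C * B * s0 ^+ 2) + kappa) * x).
  rewrite -[in RHS]xx /lam; move: (2 * _ + kappa) (Num.sqrt x) sx0 => Z y y0; field.
  by rewrite !lt0r_neq0.
rewrite ler_wpM2l ?invr_ge0 ?(ltW lam0)// [leRHS]mulrDl lerD2r -[leRHS]mulrA.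
by rewrite ler_pM2l.
Qed.

Section Power.
Hypothesis d_ge3 : (3 <= d)%N.
Variables (gam C : R).
Hypothesis gam_gt0 : 0 < gam.
Hypothesis C_gt0 : 0 < C.
Hypothesis mgf_small : forall s, 0 <= s <= 1 ->
  (mgf F s <= (expR (C * s ^+ 2))%:E)%E.
Hypothesis mgf_large : forall s, 1 <= s ->
  (mgf F s <= (expR (C * s `^ (1 + gam)))%:E)%E.

Let half_gt1 : 1 < half.
Proof. by rewrite ltr_pdivlMr// mul1r ltr_nat. Qed.

Let dR_gt0 : 0 < d%:R :> R.
Proof. by rewrite ltr0n. Qed.

Let powRS (s r : R) : 0 < s -> s * s `^ r = s `^ (1 + r).
Proof.
by move=> s0; rewrite powRD ?powRr1 ?(ltW s0)//; apply/implyP => _; rewrite gt_eqF.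
Qed.

Let bd_powR lam k r : 0 <= lam ->
  (lam * bd k) `^ r = (lam * B) `^ r * k.+1%:R `^ (- (half * r)).
Proof.
move=> lam0; rewrite /bd mulrA powRM ?powR_ge0 ?mulr_ge0 ?(ltW B_gt0)//.
by rewrite -powRrM mulNr.
Qed.

Lemma mean_le_heavy : 2 / d%:R < gam ->
  exists2 D : R, 0 < D & forall n, (2 <= n)%N ->
    (mu n <= (D * ln n%:R `^ (1 - (1 + gam)^-1))%:E)%E.
Proof.
(* The exponent [rho] covers small arguments: [rho <= 1] gives [s <= s ^ rho] on [[0, 1]], and
   [rho <= gam] gives [lam ^ rho <= lam ^ gam]. The series still converges, since
   [half * rho > 1]. *)
move=> hgam; pose rho := Num.min 1 gam.
have rho0 : 0 < rho by rewrite lt_min ltr01.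
have rho1 : rho <= 1 by rewrite ge_min lexx.
have rhog : rho <= gam by rewrite ge_min lexx orbT.
have hr : 1 < half * rho.
  rewrite /rho minEle; case: ifP => _; first by rewrite mulr1.
  by move: hgam; rewrite ltr_pdivrMr// => h; rewrite mulrAC ltr_pdivlMr// mul1r mulrC.
have hg : 1 < half * gam by apply: lt_le_trans hr _; rewrite ler_wpM2l// divr_ge0.
pose c r := 1 + (half * r - 1)^-1.
have c0 r : 1 < half * r -> 0 < c r.
  by move=> h; rewrite addr_gt0// invr_gt0 subr_gt0.
pose D := C * (B `^ rho * c rho + B `^ gam * c gam).
have D0 : 0 < D by rewrite mulr_gt0// addr_gt0// mulr_gt0 ?powR_gt0 ?c0.
apply: (mean_le_power (1 + gam)^-1 D) => //; first by rewrite invr_gt0 addr_gt0.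
move=> lam n lam1; have lam0 : 0 < lam by lra.
exists (fun _ u => C * (u `^ rho + u `^ gam)); split; first split.
- by move=> _ u u0; rewrite mulr_ge0 ?(ltW C_gt0)// addr_ge0 ?powR_ge0.
- move=> _ u v u0 uv; rewrite ler_wpM2l ?(ltW C_gt0)// lerD//.
    by apply: ge0_ler_powR; rewrite ?nnegrE ?(ltW rho0)//; lra.
  by apply: ge0_ler_powR; rewrite ?nnegrE ?(ltW gam_gt0)//; lra.
- move=> _ s s0 _; have [s1|/ltW s1] := leP s 1.
    apply: le_trans (mgf_small s _) _; first by rewrite s0.
    rewrite lee_fin ler_expR [leRHS]mulrCA ler_wpM2l ?(ltW C_gt0)// expr2 ler_wpM2l//.
    apply: le_trans (_ : s `^ rho <= _); last by rewrite lerDl powR_ge0.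
    have [->|sn0] := eqVneq s 0; first exact: powR_ge0.
    by apply: ger1_powR => //; rewrite lt_neqAle eq_sym sn0 s0 s1.
  apply: le_trans (mgf_large s s1) _.
  rewrite lee_fin ler_expR [leRHS]mulrCA ler_wpM2l ?(ltW C_gt0)//.
  by rewrite -powRS ?(lt_le_trans ltr01)// ler_wpM2l// lerDr powR_ge0.
rewrite invrK /level_sum.
have -> : \sum_(k < n) lam * (C * ((lam * bd k) `^ rho + (lam * bd k) `^ gam)) =
    lam * C * ((lam * B) `^ rho * (\sum_(k < n) k.+1%:R `^ (- (half * rho))) +
      (lam * B) `^ gam * (\sum_(k < n) k.+1%:R `^ (- (half * gam)))).
  rewrite !mulr_sumr -big_split /= mulr_sumr; apply: eq_bigr => k _.
  by rewrite !bd_powR ?(ltW lam0)// mulrA.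
rewrite -powRS// /D [leRHS](_ : _ = lam * C *
   (lam `^ gam * B `^ rho * c rho + lam `^ gam * B `^ gam * c gam)); last by ring.
rewrite ler_wpM2l ?mulr_ge0 ?(ltW lam0) ?(ltW C_gt0)// lerD//.
  rewrite ler_pM ?powR_ge0 ?sum_powR_lt//; last first.
    by rewrite powRM ?(ltW lam0) ?(ltW B_gt0)// ler_wpM2r ?powR_ge0// ler_powR.
  by rewrite sumr_ge0// => k _; rewrite powR_ge0.
by rewrite -powRM ?(ltW lam0) ?(ltW B_gt0)// ler_wpM2l ?powR_ge0 ?sum_powR_lt.
Qed.

(* The power bound is used up to the cut, of order [(lam * B) `^ (2 / d)], where
   [lam * bd k] drops to 1, and the quadratic one beyond it. *)
Let light_majorant K lam : gam <= 1 -> mgf_majorant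
  (fun k u => if (k < K)%N then C * u `^ gam else C * u) lam.
Proof.
move=> gam1; split.
- move=> k u u0; case: ifP => _; rewrite mulr_ge0 ?(ltW C_gt0)//; exact: powR_ge0.
- move=> k u v u0 uv; case: ifP => _; rewrite ler_wpM2l ?(ltW C_gt0)//.
  by apply: ge0_ler_powR; rewrite ?nnegrE ?(ltW gam_gt0)//; lra.
- move=> k s s0 _; have [s1|/ltW s1] := leP s 1.
    apply: le_trans (mgf_small s _) _; first by rewrite s0.
    rewrite lee_fin ler_expR expr2; case: ifP => _; last by rewrite mulrCA.
    rewrite mulrCA ler_wpM2l// ler_wpM2l ?(ltW C_gt0)//.
    have [->|sn0] := eqVneq s 0; first exact: powR_ge0.
    by apply: ger1_powR => //; rewrite lt_neqAle eq_sym sn0 s0 s1.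
  have s0' : 0 < s by lra.
  apply: le_trans (mgf_large s s1) _; rewrite lee_fin ler_expR -powRS//.
  case: ifP => _; first by rewrite mulrCA.
  by rewrite [leRHS]mulrCA ler_wpM2l ?(ltW C_gt0)// ler_wpM2l// ler1_powR.
Qed.

Let light_sum K lam n : (0 < K)%N -> 0 < lam ->
  level_sum (fun k u => if (k < K)%N then C * u `^ gam else C * u) lam n <=
  lam * C * ((lam * B) `^ gam * (\sum_(k < K) k.+1%:R `^ (- (half * gam))) +
    lam * B * (K%:R `^ (1 - half) / (half - 1))).
Proof.
move=> K0 lam0.
have t0 k : 0 <= lam * (if (k < K)%N then C * (lam * bd k) `^ gam else C * (lam * bd k)).
  rewrite mulr_ge0 ?(ltW lam0)//; case: ifP => _; rewrite mulr_ge0 ?(ltW C_gt0) ?powR_ge0//.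
  by rewrite /bd !mulr_ge0 ?powR_ge0 ?(ltW lam0) ?(ltW B_gt0).
apply: le_trans (cut_sum_le _ K n t0) _; rewrite mulrDr lerD//.
  rewrite le_eqVlt; apply/orP; left; apply/eqP; rewrite !mulr_sumr.
  by apply: eq_bigr => k _; rewrite ltn_ord bd_powR ?(ltW lam0)//; ring.
have -> : \sum_(K <= k < K + n) lam * (if (k < K)%N then C * (lam * bd k) `^ gam
      else C * (lam * bd k)) =
    lam * C * (lam * B) * \sum_(K <= k < K + n) k.+1%:R `^ (- half).
  rewrite mulr_sumr; apply: eq_big_nat => k /andP[Kk _].
  by rewrite ltnNge Kk /= /bd; ring.
rewrite [leRHS]mulrA ler_wpM2l ?mulr_ge0 ?(ltW lam0) ?(ltW C_gt0) ?(ltW B_gt0)//.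
exact: sum_powR_tail.
Qed.

Let cut (s : R) : nat := Num.truncn (s `^ half^-1).

(** Truncation loses at most a factor 2 of [t = s ^ (1 / half)], and [s = t * t ^ (half - 1)]; hence
    the quadratic tail beyond the cut is of order [t]. *)
Let cutP s : 1 <= s ->
  [/\ (0 < cut s)%N, (cut s)%:R <= s `^ half^-1 &
    s * (cut s)%:R `^ (1 - half) <= 2 `^ (half - 1) * s `^ half^-1].
Proof.
move=> s1; have s0 : 0 < s by lra.
have h1 := half_gt1; have e0 : 0 < half^-1 by rewrite invr_gt0; lra.
have t1 : 1 <= s `^ half^-1.
  by have := ler_powR s1 (ltW e0); rewrite powRr0.
have /andP[c1 c2] := truncn_itv (le_trans ler01 t1); rewrite -/(cut s) in c1 c2.
have c0 : (0 < cut s)%N by rewrite truncn_gt0.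
split=> //; have c0' : 1 <= (cut s)%:R :> R by rewrite ler1n.
pose t := s `^ half^-1; have t0 : 0 < t by exact: powR_gt0.
have tc : t / 2 <= (cut s)%:R.
  have c3 : t < (cut s)%:R + 1 by rewrite natr1.
  by move: c3 c0'; clearbody t; move: (cut s)%:R => u; lra.
have -> : 1 - half = - (half - 1) by lra.
rewrite powRN -/t.
have : (t / 2) `^ (half - 1) <= (cut s)%:R `^ (half - 1).
  by apply: ge0_ler_powR; rewrite ?nnegrE; lra.
rewrite powRM ?(ltW t0)// => h.
have sE : s = t * t `^ (half - 1).
  rewrite powRS// addrC subrK /t -powRrM mulVf ?powRr1 ?(ltW s0)//.
  by rewrite gt_eqF//; lra.
rewrite ler_pdivrMr ?powR_gt0//; last lra.
rewrite {1}sE.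
have i2 : 2^-1 `^ (half - 1) = (2 `^ (half - 1))^-1 :> R.
  by rewrite -powR_inv1// -powRrM mulN1r powRN.
rewrite i2 in h; have p2 : 0 < 2 `^ (half - 1) :> R by exact: powR_gt0.
rewrite ler_pdivrMr// in h.
by rewrite [2 `^ _ * t]mulrC -mulrA ler_pM2l// [leRHS]mulrC.
Qed.

(** Now [a = half * gam < 1], so the lags below the cut contribute [s ^ gam * (s ^ (1 / half)) ^ (1
    - a) = s ^ (1 / half)]. The exponent [gam] cancels, and the rate does not depend on [alpha]. *)
Lemma mean_le_light : gam < 2 / d%:R ->
  exists2 D : R, 0 < D & forall n, (2 <= n)%N ->
    (mu n <= (D * ln n%:R `^ (1 - (1 + half^-1)^-1))%:E)%E.
Proof.
move=> hgam; have h1 := half_gt1; have h0 : 0 < half^-1 by rewrite invr_gt0; lra.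
have hgam' : gam < half^-1 by rewrite invf_div.
have gam1 : gam <= 1.
  by apply/ltW/(lt_trans hgam'); rewrite invf_lt1; lra.
pose a := half * gam.
have a0 : 0 <= a by rewrite mulr_ge0 ?(ltW gam_gt0)//; lra.
have a1 : a < 1.
  by rewrite /a mulrC -ltr_pdivlMr ?mul1r//; lra.
pose D1 := 2 / (1 - a) + 2 `^ (half - 1) / (half - 1).
have D10 : 0 < D1 by rewrite addr_gt0// divr_gt0 ?powR_gt0//; lra.
pose D := C * (D1 * B `^ half^-1).
have D0 : 0 < D by rewrite !mulr_gt0 ?powR_gt0.
have th0 : 0 < (1 + half^-1)^-1 by rewrite invr_gt0; lra.
apply: (mean_le_power (1 + half^-1)^-1 D th0 D0).
move=> lam n lam1; have lam0 : 0 < lam by lra.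
pose s := lam * B.
have s1 : 1 <= s by rewrite /s -[1]mulr1 ler_pM.
have s0 : 0 < s by lra.
have [K0 K1 K2] := cutP s s1.
exists (fun k u => if (k < cut s)%N then C * u `^ gam else C * u).
split; first exact: light_majorant.
apply: le_trans (light_sum _ lam n K0 lam0) _; rewrite invrK -(powRS lam)// -/s -/a.
have -> : D * (lam * lam `^ half^-1) = lam * C * (D1 * s `^ half^-1).
  by rewrite /D /s powRM ?(ltW lam0) ?(ltW B_gt0)//; ring.
rewrite ler_wpM2l ?mulr_ge0 ?(ltW lam0) ?(ltW C_gt0)// mulrDl lerD//.
  apply: (@le_trans _ _ (s `^ gam * (2 / (1 - a) * (s `^ half^-1) `^ (1 - a)))).
    rewrite ler_wpM2l ?powR_ge0//; apply: le_trans (sum_powR_head _ _ _) _.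
      by rewrite a0.
    rewrite ler_wpM2l//; first by rewrite divr_ge0//; lra.
    by apply: ge0_ler_powR; rewrite ?nnegrE ?powR_ge0//; lra.
  rewrite mulrCA ler_wpM2l//; first by rewrite divr_ge0//; lra.
  rewrite -powRrM -powRD; last by apply/implyP => _; rewrite gt_eqF.
  rewrite le_eqVlt; apply/orP; left; apply/eqP; congr (_ `^ _).
  by rewrite /a mulrBr mulr1 mulrA mulVf ?mul1r ?gt_eqF//; lra.
rewrite mulrA ler_pdivrMr; last by lra.
by rewrite (mulrAC _ (_ `^ _)) divfK// gt_eqF//; lra.
Qed.

(** At [half * gam = 1] the lags below the cut form a harmonic sum, whose logarithm is the source of
    the iterated logarithm. *)
Lemma mean_le_critical : gam = 2 / d%:R ->
  exists2 D : R, 0 < D & forall n, (3 <= n)%N ->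
    (mu n <= (D * (ln n%:R `^ (1 - (1 + half^-1)^-1) *
                   ln (ln n%:R) `^ (1 + half^-1)^-1))%:E)%E.
Proof.
move=> hgam; have h1 := half_gt1.
pose h := half^-1; have h0 : 0 < h by rewrite invr_gt0; lra.
have gamE : gam = h by rewrite hgam /h invf_div.
pose th := (1 + h)^-1; have th0 : 0 < th by rewrite invr_gt0; lra.
have thE : h * th = 1 - th by rewrite /th; field; lra.
(* Because [ln (6/5) >= 1/6] and [(6/5) ^ 6 < 3]. Thus [ln (ln n) >= l0 > 0] for all [n >= 3]. *)
have ln3 : 1 < ln 3 :> R.
  have := @ln_ratio_ge R 5 isT => h5.
  apply: (@le_lt_trans _ _ (ln ((6 / 5) ^+ 6))).
    rewrite lnXn; last by lra.
    by rewrite -(mulr_natr (ln _)); lra.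
  by rewrite ltr_ln ?posrE ?exprn_gt0//; lra.
pose l0 : R := ln (ln 3); have l00 : 0 < l0 by rewrite ln_gt0.
pose A := 2 `^ (half - 1) / (half - 1).
have A0 : 0 <= A by rewrite divr_ge0 ?powR_ge0//; lra.
have lnB : 0 <= ln B by rewrite ln_ge0.
pose A' := 1 + h * ln B + A.
have A'0 : 0 <= A' by have := mulr_ge0 (ltW h0) lnB; move: A0; rewrite /A'; lra.
(* As [l >= l0], every constant is absorbed into the multiple [E] of [l]. *)
pose E := A' / l0 + 1 + `|ln l0| / l0.
have E0 : 0 < E.
  by rewrite ltr_wpDr ?divr_ge0 ?(ltW l00)// ltr_wpDl ?divr_ge0 ?(ltW l00).
pose Q := C * B `^ h * E.
have Q0 : 0 < Q by rewrite !mulr_gt0 ?powR_gt0.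
exists (2 * Q + kappa); first by rewrite addr_gt0// mulr_gt0.
move=> n n3; have n2 : (2 <= n)%N by exact: ltnW.
pose x : R := ln n%:R; pose l := ln x.
have x3 : ln 3 <= x.
  by rewrite ler_ln ?posrE ?ltr0n ?ler_nat// (ltn_trans _ n3).
have x0 : 0 < x by lra.
have ll : l0 <= l by rewrite ler_ln ?posrE//; lra.
have lp : 0 < l by lra.
pose y := x / l.
have y1 : 1 <= y by rewrite ler_pdivlMr// mul1r; apply: ltW; exact: ln_sublinear.
have y0 : 0 < y by lra.
(* Then [lam ^ (1 + h) = y], so the level sum is of order [y * l = ln n]. *)
pose lam := y `^ th.
have lam1 : 1 <= lam by have := ler_powR y1 (ltW th0); rewrite powRr0.
have lam0 : 0 < lam by lra.
pose s := lam * B.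
have s1 : 1 <= s by rewrite /s -[1]mulr1 ler_pM.
have s0 : 0 < s by lra.
have [K0 K1 K2] := cutP s s1; rewrite -/h in K1 K2.
have gam1 : gam <= 1 by rewrite gamE /h invf_le1; lra.
apply: le_trans (mean_le_level _ lam n lam0 n2 (light_majorant (cut s) lam gam1)) _.
have lev := light_sum (cut s) lam n K0 lam0.
have sumK : \sum_(k < cut s) k.+1%:R `^ (- (half * gam)) <= 1 + h * ln s.
  have -> : half * gam = 1 by rewrite gamE /h divff//; lra.
  rewrite (eq_bigr (fun k : 'I_(cut s) => k.+1%:R^-1)); last first.
    by move=> k _; rewrite powR_inv1.
  apply: le_trans (sum_inv_le _ K0) _; rewrite lerD2l -ln_powR.
  by rewrite ler_ln ?posrE ?powR_gt0 ?ltr0n.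
have lns : h * ln s <= l + `|ln l0| + h * ln B.
  rewrite /s lnM ?posrE// mulrDr lerD2r /lam ln_powR mulrA thE.
  have ylE : ln y = l - ln l by rewrite /y ln_div ?posrE.
  have ly : 0 <= ln y by rewrite ln_ge0.
  have lnl : ln l0 <= ln l by rewrite ler_ln ?posrE.
  have := ler_norm (- ln l0); rewrite normrN => nl.
  apply: (@le_trans _ _ (ln y)); last by lra.
  by rewrite ler_piMl//; lra.
have tailK : s * ((cut s)%:R `^ (1 - half) / (half - 1)) <= s `^ h * A.
  have i0 : 0 <= (half - 1)^-1 by rewrite invr_ge0; lra.
  by rewrite /A !mulrA; apply: ler_wpM2r; rewrite // [leRHS]mulrC.
have lev' : level_sum (fun k u => if (k < cut s)%N then C * u `^ gam else C * u) lam n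
    <= Q * x.
  apply: le_trans lev _; rewrite gamE -/s.
  apply: (@le_trans _ _ (lam * C * (s `^ h * (l * E)))).
    rewrite ler_wpM2l ?mulr_ge0 ?(ltW lam0) ?(ltW C_gt0)//.
    apply: le_trans (lerD (ler_wpM2l (powR_ge0 s h) _) tailK) _.
      by move: sumK; rewrite gamE; exact: id.
    rewrite -mulrDr ler_wpM2l ?powR_ge0//.
    have e1 : A' <= l * (A' / l0) by rewrite mulrCA ler_peMr// ler_pdivlMr ?mul1r.
    have e2 : `|ln l0| <= l * (`|ln l0| / l0).
      by rewrite mulrCA ler_peMr// ler_pdivlMr ?mul1r.
    by rewrite /E !mulrDr mulr1; move: e1; rewrite {1}/A'; lra.
  have yE : lam * lam `^ h = y.
    rewrite powRS// /lam -powRrM /th mulVf ?powRr1 ?(ltW y0)//.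
    by rewrite gt_eqF//; lra.
  have -> : Q * x = lam * lam `^ h * (C * B `^ h * E) * l.
    by rewrite yE /Q /y; field; lra.
  by rewrite /s powRM ?(ltW lam0) ?(ltW B_gt0)// le_eqVlt; apply/orP; left; apply/eqP; ring.
rewrite lee_fin -/x -/l -/h -/th.
apply: (@le_trans _ _ (lam^-1 * ((2 * Q + kappa) * x))).
  rewrite ler_wpM2l ?invr_ge0 ?(ltW lam0)// [leRHS]mulrDl lerD2r -[leRHS]mulrA.
  by rewrite ler_wpM2l.
have z0 : 0 <= 2 * Q + kappa by have := kappa_gt0; lra.
rewrite mulrCA; apply: ler_wpM2l => //.
rewrite le_eqVlt; apply/orP; left; apply/eqP.
rewrite powRB; last by apply/implyP => _; rewrite gt_eqF.
rewrite powRr1 ?(ltW x0)// /lam /y powRM ?invr_ge0 ?(ltW x0) ?(ltW lp)//.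
have -> : l^-1 `^ th = (l `^ th)^-1.
  by rewrite -powR_inv1 ?(ltW lp)// -powRrM mulN1r powRN.
by field; rewrite !gt_eqF ?powR_gt0.
Qed.

End Power.

(** At [alpha = 1] there is no finite conjugate exponent, so [mean_le_ln] is used; otherwise
    [gam = 1 / (alpha - 1)] lies above or below [2 / d] according to the side of [1 + d / 2] on
    which [alpha] lies. *)
Lemma mean_le_max alpha : (3 <= d)%N -> 1 <= alpha -> alpha != 1 + d%:R / 2 ->
  tail_class_minus alpha F ->
  exists2 D : R, 0 < D & forall n, (2 <= n)%N ->
    (mu n <= (D * ln n%:R `^ (Num.max (1 / alpha) (2 / (2 + d%:R))))%:E)%E.
Proof.
move=> d3 a1 anc tcm; have dR : 0 < d%:R :> R by rewrite ltr0n.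
have al0 : 0 < alpha by lra.
have [aE|an1] := eqVneq alpha 1.
  have [D D0 hD] := mean_le_ln alpha a1 tcm (ltnW d3).
  exists D => // n n2; have -> : Num.max (1 / alpha) (2 / (2 + d%:R)) = 1 :> R.
    by rewrite aE divr1; apply/max_idPl; rewrite ler_pdivrMr; lra.
  by rewrite powRr1 ?hD// (le_trans (ltW ln2) (ln_ge _ n2)).
have ag1 : 1 < alpha by rewrite lt_neqAle eq_sym an1.
have [C C0 [hs hl]] := mgf_le_power F F_sym alpha ag1 tcm.
pose gam := (alpha - 1)^-1; have g0 : 0 < gam by rewrite invr_gt0 subr_gt0.
have gE : alpha / (alpha - 1) = 1 + gam by rewrite /gam; field; lra.
rewrite gE in hl.
have [la|ga|aE] := ltgtP alpha (1 + d%:R / 2); last by rewrite aE eqxx in anc.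
  have hg : 2 / d%:R < gam.
    by rewrite ltr_pdivrMr// mulrC ltr_pdivlMr ?subr_gt0//; lra.
  have [D D0 hD] := mean_le_heavy d3 gam C g0 C0 hs hl hg.
  exists D => // n n2; have -> : Num.max (1 / alpha) (2 / (2 + d%:R)) =
      1 - (1 + gam)^-1; last exact: hD.
    have -> : 1 - (1 + gam)^-1 = 1 / alpha by rewrite /gam; field; lra.
    apply/max_idPl; rewrite ler_pdivrMr; last by lra.
    by rewrite mulrAC ler_pdivlMr//; lra.
have hg : gam < 2 / d%:R.
  by rewrite ltr_pdivlMr// mulrC ltr_pdivrMr ?subr_gt0//; lra.
have [D D0 hD] := mean_le_light d3 gam C g0 C0 hs hl hg.
exists D => // n n2; have -> : Num.max (1 / alpha) (2 / (2 + d%:R)) =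
    1 - (1 + half^-1)^-1; last exact: hD.
have -> : 1 - (1 + half^-1)^-1 = 2 / (2 + d%:R) :> R by field; lra.
apply/max_idPr; rewrite ler_pdivlMr; last by lra.
by rewrite mulrAC ler_pdivrMr//; lra.
Qed.

Lemma mean_le_loglog : (3 <= d)%N -> tail_class_minus (1 + d%:R / 2) F ->
  exists2 D : R, 0 < D & forall n, (3 <= n)%N ->
    (mu n <= (D * (ln n%:R `^ (2 / (2 + d%:R)) *
                   ln (ln n%:R) `^ (d%:R / (2 + d%:R))))%:E)%E.
Proof.
move=> d3; have dR : 0 < d%:R :> R by rewrite ltr0n.
set alpha := 1 + d%:R / 2 => tcm; have ag1 : 1 < alpha.
  by rewrite /alpha; lra.
have [C C0 [hs hl]] := mgf_le_power F F_sym alpha ag1 tcm.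
have gE : alpha / (alpha - 1) = 1 + 2 / d%:R by rewrite /alpha; field; lra.
rewrite gE in hl.
have g0 : 0 < 2 / d%:R :> R by rewrite divr_gt0.
have [D D0 hD] := mean_le_critical d3 _ C g0 C0 hs hl erefl.
exists D => // n n3; have := hD n n3.
have -> : 1 - (1 + half^-1)^-1 = 2 / (2 + d%:R) :> R by field; lra.
by have -> : (1 + half^-1)^-1 = d%:R / (2 + d%:R) :> R by field; lra.
Qed.

End Upper.
End WallMean.

(** * Lower bounds on the mean *)

Section WallMeanLower.
Context {R : realType} {d : nat}.
Variable p : 'rV[int]_d -> R.
Hypothesis hp : step_distribution p.
Variable S : seq 'rV[int]_d.
Hypothesis S_uniq : uniq S.
Hypothesis S_supp : forall s, (s \in S) = (p s != 0).
Variable F : probability (measurableTypeR R) R.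
Hypothesis F_sym : symmetric_law F.
Context {dT : measure_display} {T : measurableType dT}.
Variables (P : probability T R) (eps : int -> 'rV[int]_d -> {RV P >-> R}).
Hypothesis eps_law : forall n i, has_law F (eps n i).
Hypothesis eps_indep :
  mutually_independent (fun ni : int * 'rV[int]_d => eps ni.1 ni.2).

Local Notation mu := (wall_mean p eps).

Let p_ge0 := step_distribution_ge0 p hp.
Let p_mass := step_distribution_mass p hp S S_uniq S_supp.

(** The variance of the free process for noise of unit variance. *)
Let V n : R := \sum_(k < n) \sum_(j <- reach S k) heat S p k j ^+ 2.

Let V_ge1 n : (0 < n)%N -> 1 <= V n.
Proof.
case: n => // n _; rewrite /V big_ord_recl /= big_seq1 /= eqxx expr1n lerDl.
by rewrite sumr_ge0// => k _; rewrite sumr_ge0// => j _; rewrite sqr_ge0.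
Qed.

(** With [lam] of order [1 / sqrt (V n)] the exponential moments at [lam] and [2 * lam] stay between
    constants, and [integral_reflected_ge] yields a mean of order [1 / lam]. *)
Lemma mean_ge_sqrt_variance alpha :
  1 <= alpha -> tail_class_minus alpha F -> F [set 0] != 1%E ->
  exists2 c : R, 0 < c & forall n, (0 < n)%N ->
    ((c * Num.sqrt (V n))%:E <= mu n)%E.
Proof.
move=> a1 tcm nd.
have [delta [K [delta0 K0 hK]]] := exp_moment F F_sym alpha a1 tcm.
have [C C0 hC] := mgf_le_quadratic F F_sym delta K delta0 K0 hK.
have [c1 c10 hc1] := mgf_ge_quadratic F F_sym nd.
(* At most [delta / 4], so that the argument [2 * lam * heat] stays within the quadratic upper
   bound, and at most 1 for the lower one. *)
pose t0 := Num.min (delta / 4) 1.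
have t00 : 0 < t0 by rewrite lt_min ltr01 divr_gt0.
have t01 : t0 <= 1 by rewrite ge_min lexx orbT.
have t0d : t0 <= delta / 4 by rewrite ge_min lexx.
pose a := expR (c1 * t0 ^+ 2); pose b := expR (4 * C * t0 ^+ 2).
have a1' : 0 < a - 1 by rewrite subr_gt0 expR_gt1 mulr_gt0 ?exprn_gt0.
have b1 : 0 < b - 1 by rewrite subr_gt0 expR_gt1 !mulr_gt0 ?exprn_gt0.
(* Small enough that the correction [eta * (b - 1)] takes at most half of [a - 1]. *)
pose eta := Num.min 2^-1 ((a - 1) / (2 * (b - 1))).
have eta0 : 0 < eta by rewrite lt_min invr_gt0 ltr0n /= divr_gt0 ?mulr_gt0.
have eta1 : eta <= 2^-1 by rewrite ge_min lexx.
have etab : eta * (b - 1) <= (a - 1) / 2.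
  have -> : (a - 1) / 2 = (a - 1) / (2 * (b - 1)) * (b - 1) by field; lra.
  by rewrite ler_pM2r// ge_min lexx orbT.
exists (eta / t0 * ((a - 1) / 2)); first by rewrite mulr_gt0// divr_gt0.
move=> n n0; have V1 := V_ge1 n n0; have V0 : 0 < V n by lra.
have sV0 : 0 < Num.sqrt (V n) by rewrite sqrtr_gt0.
have sV1 : 1 <= Num.sqrt (V n) by rewrite -[1]sqrtr1 ler_wsqrtr.
pose lam := t0 / Num.sqrt (V n).
have lam0 : 0 < lam by rewrite divr_gt0.
have lamt : lam <= t0 by rewrite ler_pdivrMr// ler_peMr// ltW.
have lamV : lam ^+ 2 * V n = t0 ^+ 2.
  by rewrite /lam -{2}(sqr_sqrtr (ltW V0)); field; lra.
have h0 k j : 0 <= heat S p k j by exact: heat_ge0.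
have h1 k j : heat S p k j <= 1 by exact: heat_le1.
have lh0 k j : 0 <= lam * heat S p k j by rewrite mulr_ge0 ?(ltW lam0).
have lh1 k j : lam * heat S p k j <= t0.
  by apply: le_trans lamt; rewrite ler_piMr ?(ltW lam0).
have up s : 0 <= s -> s <= 2 * t0 -> (mgf F s <= (expR (C * s ^+ 2))%:E)%E.
  by move=> s0 s1; apply: hC; rewrite ger0_norm//; lra.
have sumE r : \sum_(k < n) \sum_(j <- reach S k) r * (lam * heat S p k j) ^+ 2 =
    r * t0 ^+ 2.
  rewrite -lamV /V !mulr_sumr; apply: eq_bigr => k _.
  by rewrite !mulr_sumr; apply: eq_bigr => j _; rewrite exprMn.
rewrite (wall_meanE p S S_uniq S_supp).
apply: le_trans (integral_reflected_ge S p p_ge0 P eps lam eta a b n 0 lam0 _ _ _).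
- rewrite lee_fin.
  have -> : eta / t0 * ((a - 1) / 2) * Num.sqrt (V n) = eta / lam * ((a - 1) / 2).
    by rewrite /lam; field; lra.
  by rewrite ler_wpM2l ?divr_ge0 ?(ltW eta0) ?(ltW lam0)//; lra.
- by rewrite eta0.
- rewrite /a -sumE.
  apply: (integral_expR_free_ge S p F P eps eps_law eps_indep lam
    (fun k j => c1 * (lam * heat S p k j) ^+ 2)) => k j.
    rewrite ge0_fin_numE ?mgf_ge0//; apply: le_lt_trans (ltry _).
    by apply: up => //; have := lh1 k j; lra.
  by apply: hc1; rewrite lh0 (le_trans (lh1 k j)).
- have -> : b = expR (\sum_(k < n) \sum_(j <- reach S k) 
      4 * C * (lam * heat S p k j) ^+ 2) by rewrite sumE.
  apply: (integral_expR_free_le S p F P eps eps_law eps_indep (2 * lam)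
    (fun k j => 4 * C * (lam * heat S p k j) ^+ 2)) => k j.
  have -> : 4 * C * (lam * heat S p k j) ^+ 2 = C * (2 * lam * heat S p k j) ^+ 2 by ring.
  by have := lh0 k j; have := lh1 k j; move=> u v; apply: up; lra.
Qed.

Lemma mean_ge_quarter : d = 1%N -> tail_class_minus 1 F -> F [set 0] != 1%E ->
  exists2 c : R, 0 < c & forall n, (2 <= n)%N ->
    ((c * n%:R `^ (1 / 4))%:E <= mu n)%E.
Proof.
move=> d1 tcm nd; have [c c0 hc] := mean_ge_sqrt_variance 1 (lexx _) tcm nd.
have [b b0 hb] := heat_sq_ge p hp S S_uniq S_supp.
exists (c * Num.sqrt b); first by rewrite mulr_gt0 ?sqrtr_gt0.
move=> n n2; apply: le_trans (hc n (ltnW n2)); rewrite lee_fin -mulrA ler_pM2l//.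
have n0 : 0 < n%:R :> R by rewrite ltr0n ltnW.
have -> : n%:R `^ (1 / 4) = Num.sqrt (Num.sqrt n%:R) :> R.
  by rewrite -!powR12_sqrt ?powR_ge0// -powRrM; congr (_ `^ _); lra.
rewrite -sqrtrM ?(ltW b0)//; apply: ler_wsqrtr.
have -> : b * Num.sqrt n%:R = \sum_(k < n) b / Num.sqrt n%:R.
  rewrite sumr_const card_ord -(mulr_natr (b / _)) -[X in _ = _ * X](sqr_sqrtr (ltW n0)).
  by field; rewrite gt_eqF// sqrtr_gt0.
apply: ler_sum => k _; apply: le_trans (hb k); rewrite d1 expr1.
rewrite ler_pM2l// lef_pV2 ?posrE ?sqrtr_gt0// ler_wsqrtr// ler_nat.
exact: ltn_ord.
Qed.

Lemma mean_ge_sqrt_ln alpha : d = 2%N ->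
  1 <= alpha -> tail_class_minus alpha F -> F [set 0] != 1%E ->
  exists2 c : R, 0 < c & forall n, (2 <= n)%N ->
    ((c * ln n%:R `^ (1 / 2))%:E <= mu n)%E.
Proof.
move=> d2 a1 tcm nd; have [c c0 hc] := mean_ge_sqrt_variance alpha a1 tcm nd.
have [b b0 hb] := heat_sq_ge p hp S S_uniq S_supp.
exists (c * Num.sqrt b); first by rewrite mulr_gt0 ?sqrtr_gt0.
move=> n n2; apply: le_trans (hc n (ltnW n2)); rewrite lee_fin -mulrA ler_pM2l//.
have l0 : 0 <= ln n%:R :> R by rewrite ln_ge0// ler1n ltnW.
rewrite div1r powR12_sqrt// -sqrtrM ?(ltW b0)//; apply: ler_wsqrtr.
apply: (@le_trans _ _ (b * ln n.+1%:R)).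
  by rewrite ler_pM2l// ler_ln ?posrE ?ltr0n ?ler_nat// ltnW.
apply: (@le_trans _ _ (b * \sum_(k < n) k.+1%:R^-1)).
  by rewrite ler_pM2l// sum_inv_ge.
rewrite mulr_sumr; apply: ler_sum => k _.
by apply: le_trans (hb k); rewrite d2 sqr_sqrtr.
Qed.

(** The level [L] solves [c' * L ^ alpha = ln n], so noise exceeds it with probability at least
    [c / n], and [(1 - c / n) ^ n <= expR (- c)]. *)
Lemma mean_ge_tail alpha : 1 <= alpha -> tail_class_plus alpha F ->
  exists2 c : R, 0 < c & forall n, (2 <= n)%N ->
    ((c * ln n%:R `^ (1 / alpha))%:E <= mu n)%E.
Proof.
move=> a1 [c [c' [c0 c'0 hc]]].
have al0 : 0 < alpha by lra.
have e1 : 0 < 1 - expR (- c) by rewrite subr_gt0 expR_lt1 oppr_lt0.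
exists ((c'^-1) `^ (1 / alpha) * (1 - expR (- c))).
  by rewrite mulr_gt0 ?powR_gt0 ?invr_gt0.
move=> n n2; have n0 : 0 < n%:R :> R by rewrite ltr0n ltnW.
have l0 : 0 < ln n%:R :> R by rewrite ln_gt0// ltr1n.
pose L : R := (c'^-1 * ln n%:R) `^ (1 / alpha).
have u0 : 0 < c'^-1 * ln n%:R by rewrite mulr_gt0 ?invr_gt0.
have L0 : 0 < L by exact: powR_gt0.
have La : L `^ alpha = c'^-1 * ln n%:R.
  rewrite /L -powRrM div1r mulVf ?powRr1 ?(ltW u0)//; lra.
rewrite (wall_meanE p S S_uniq S_supp).
apply: le_trans (integral_reflected_ge_large S p p_ge0 p_mass F F_sym P eps
  eps_law eps_indep L L0 n 0).
rewrite lee_fin mulrAC -powRM ?invr_ge0 ?(ltW c'0) ?(ltW l0)// -/L ler_pM2l// lerB//.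
have mL : measurable ([set y | L < y] : set (measurableTypeR R)).
  have -> : [set y | L < y] = `]L, +oo[%classic by apply/seteqP; split => x /=; rewrite in_itv/= andbT.
  exact: measurable_itv.
have tfin : tail F L \is a fin_num by exact: fin_num_measure.
have q1 : fine (tail F L) <= 1.
  by rewrite -lee_fin fineK//; exact: probability_le1.
have qc : c / n%:R <= fine (tail F L).
  rewrite -lee_fin fineK//; apply: le_trans (hc L L0).
  by rewrite lee_fin La mulrA divff ?mul1r ?expRN ?lnK ?posrE// gt_eqF.
apply: (@le_trans _ _ (expR (- (c / n%:R)) ^+ n)).
  apply: lerXn2r; rewrite ?nnegrE ?expR_ge0//; first by lra.
  by apply: le_trans (expR_ge1Dx _); lra.
by rewrite -expRM_natr mulNr divfK// gt_eqF.
Qed.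

End WallMeanLower.

(** The law determines its exponent, which allows constants chosen before [alpha] in the theorem. *)
Lemma tail_class_unique {R : realType} (F : probability (measurableTypeR R) R)
  (alpha beta : R) : 1 <= alpha -> 1 <= beta ->
  tail_class alpha F -> tail_class beta F -> alpha = beta.
Proof.
move=> a1 b1 [am ap] [bm bp]; have [a0 b0] : 0 < alpha /\ 0 < beta by lra.
by apply/le_anti; rewrite (tail_class_le F beta alpha)// (tail_class_le F alpha beta).
Qed.

Theorem theorem1p2 (R : realType) (d : nat) (d_gt0 : (0 < d)%N)
    (p : 'rV[int]_d -> R) (hp : step_distribution p)
    (F : probability (measurableTypeR R) R)
    (F_int : integrable_law F) (F_sym : symmetric_law F)
    (dT : measure_display) (T : measurableType dT) (P : probability T R)
    (eps : int -> 'rV[int]_d -> {RV P >-> R})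
    (eps_law : forall n i, has_law F (eps n i))
    (eps_indep : mutually_independent
       (fun ni : int * 'rV[int]_d => eps ni.1 ni.2)) :
  let mu := wall_mean p eps in
  exists c C : R, [/\ 0 < c, 0 < C &
  [/\ (* (i); the law F is not the point mass at 0 *)
      d = 1%N -> tail_class_minus 1 F -> F [set 0] != 1%E ->
        forall n : nat, (2 <= n)%N ->
        ((c * n%:R `^ (1 / 4))%:E <= mu n)%E /\
        (mu n <= (C * (n%:R `^ (1 / 4) * Num.sqrt (ln n%:R)))%:E)%E,
      (* (ii) *)
      d = 2%N -> forall alpha : R, 1 <= alpha -> tail_class alpha F ->
        forall n : nat, (2 <= n)%N ->
        ((c * ln n%:R `^ (Num.max (1 / alpha) (1 / 2)))%:E <= mu n)%E /\
        (mu n <= (C * ln n%:R)%:E)%E,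
      (* (iii) *)
      (3 <= d)%N -> forall alpha : R, 1 <= alpha ->
        alpha != 1 + d%:R / 2 -> tail_class alpha F ->
        forall n : nat, (2 <= n)%N ->
        ((c * ln n%:R `^ (1 / alpha))%:E <= mu n)%E /\
        (mu n <=
          (C * ln n%:R `^ (Num.max (1 / alpha) (2 / (2 + d%:R))))%:E)%E &
      (* (iv) *)
      (3 <= d)%N -> tail_class (1 + d%:R / 2) F ->
        forall n : nat, (3 <= n)%N ->
        ((c * ln n%:R `^ (2 / (2 + d%:R)))%:E <= mu n)%E /\
        (mu n <= (C * (ln n%:R `^ (2 / (2 + d%:R)) *
                       ln (ln n%:R) `^ (d%:R / (2 + d%:R))))%:E)%E]].
Proof.
move=> mu.
have [S [S_uniq S_supp]] := step_distribution_support p hp.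
(* The constant is enlarged to be at least 1, so that [lam * B >= 1] and [ln B >= 0] later. *)
have [B [B1 hB]] : exists B : R, 1 <= B /\
    forall k j, heat S p k j <= B * k.+1%:R `^ (- (d%:R / 2)).
  have [B B0 hB] := heat_le p hp S S_uniq S_supp.
  exists (B + 1); split; first by lra.
  move=> k j; apply: le_trans (hB k j) _.
  by rewrite exprn_sqrt_powR// powRN ler_wpM2r ?invr_ge0 ?powR_ge0//; lra.
have [d1|dn1] := eqVneq d 1%N.
  (* The constants precede the assumptions on [F], so these are decided first; if they fail, the
     claim is vacuous and any constants do. *)
  case: (pselect (tail_class_minus 1 F /\ F [set 0] != 1%E)) => [[tcm nd]|no].
    have [c c0 hc] := mean_ge_quarter p hp S S_uniq S_supp F F_sym P eps
      eps_law eps_indep d1 tcm nd.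
    have [C C0 hC] := mean_le_quarter d_gt0 p hp S S_uniq S_supp F F_sym P eps
      eps_law eps_indep B B1 hB d1 tcm.
    exists c, C; split => //; split => //; [|by rewrite d1..].
    by move=> _ _ _ n n2; split; [exact: hc|exact: hC].
  by exists 1, 1; split => //; split => //; [|rewrite d1..] => // ? ? ?; case: no.
case: (pselect (exists2 alpha, 1 <= alpha & tail_class alpha F)); last first.
  move=> no; exists 1, 1; split => //; split => //.
  - by move=> d1; rewrite d1 in dn1.
  - by move=> _ alpha a1 tc; case: no; exists alpha.
  - by move=> _ alpha a1 _ tc; case: no; exists alpha.
  - by move=> _ tc; case: no; exists (1 + d%:R / 2) => //; rewrite lerDl divr_ge0.
move=> [alpha a1 tc]; have [tcm tcp] := tc.
have uniq_alpha beta : 1 <= beta -> tail_class beta F -> beta = alpha.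
  by move=> b1 tc'; exact: tail_class_unique b1 a1 tc' tc.
have [c c0 hc] := mean_ge_tail p hp S S_uniq S_supp F F_sym P eps
  eps_law eps_indep alpha a1 tcp.
have [d2|dn2] := eqVneq d 2%N.
  have [b b0 hb] := mean_ge_sqrt_ln p hp S S_uniq S_supp F F_sym P eps
    eps_law eps_indep alpha d2 a1 tcm (tail_plus_nondegenerate F alpha tcp).
  have d2' : (1 < d)%N by rewrite d2.
  have [C C0 hC] := mean_le_ln d_gt0 p hp S S_uniq S_supp F F_sym P eps
    eps_law eps_indep B B1 hB alpha a1 tcm d2'.
  (* The maximum in the exponent is either of two values, each with its own lower bound. *)
  exists (Num.min b c), C; rewrite lt_min b0 c0; split => //; split.
  - by rewrite d2.
  - move=> _ beta b1 tcb n n2; rewrite (uniq_alpha beta b1 tcb).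
    split; last exact: hC.
    case: (leP (1 / alpha)) => _; [apply: le_trans (hb n n2)|apply: le_trans (hc n n2)].
      by rewrite lee_fin ler_wpM2r ?powR_ge0// ge_min lexx.
    by rewrite lee_fin ler_wpM2r ?powR_ge0// ge_min lexx orbT.
  - by rewrite d2.
  - by rewrite d2.
have d3 : (3 <= d)%N by lia.
have aE : 1 / (1 + d%:R / 2) = 2 / (2 + d%:R) :> R.
  by field; rewrite !gt_eqF//; have : 0 <= d%:R :> R by []; lra.
have [ac|anc] := eqVneq alpha (1 + d%:R / 2).
  rewrite ac in tcm hc.
  have [C C0 hC] := mean_le_loglog d_gt0 p hp S S_uniq S_supp F F_sym P eps
    eps_law eps_indep B B1 hB d3 tcm.
  exists c, C; split => //; split.
  - by move=> d1; rewrite d1 in dn1.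
  - by move=> d2; rewrite d2 in dn2.
  - by move=> _ beta b1 bn tcb; rewrite (uniq_alpha beta b1 tcb) ac eqxx in bn.
  - by move=> _ _ n n3; split; [rewrite -aE; exact: hc (ltnW n3)|exact: hC].
have [C C0 hC] := mean_le_max d_gt0 p hp S S_uniq S_supp F F_sym P eps
  eps_law eps_indep B B1 hB alpha d3 a1 anc tcm.
exists c, C; split => //; split.
- by move=> d1; rewrite d1 in dn1.
- by move=> d2; rewrite d2 in dn2.
- move=> _ beta b1 _ tcb n n2; rewrite (uniq_alpha beta b1 tcb).
  by split; [exact: hc|exact: hC].
- move=> _ tcb; suff e : 1 + d%:R / 2 = alpha by rewrite e eqxx in anc.
  by apply: uniq_alpha tcb; rewrite lerDl divr_ge0.
Qed.
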